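(* Let $\alpha>0$ be a constant, $k\ge 1$ an integer, $T>0$, and $I=\mathbb{R}/2\pi\mathbb{Z}$. Suppose that the curve shortening--DeTurck flow $$|\partial_s \vec X|^2\big(\alpha\,\mathbb{I}+(1-\alpha)\,\vec\nu\otimes\vec\nu\big)\,\partial_t\vec X=\partial_s^2\vec X,\qquad \vec X(0,\cdot)=\vec X^0,$$ has a unique solution $\vec X(t,s)\in\mathbb{R}^2$, $s\in I$, which is smooth enough with respect to both $t$ and $s$ up to some time $t>T$ (where $s\mapsto\vec X(t,s)$ parametrizes a closed regular planar curve, so $\partial_s\vec X\neq 0$). Let $M\in\mathbb{N}$, $\Delta t=T/M$, $t_n=n\Delta t$, and consider the linearized Euler scheme: set $\vec X_h^0=\mathcal{R}_h^{\mathcal I}\vec X(0)$ and, for $n=0,\dots,M-1$, find $\vec X_h^{n+1}\in S(I)^2$ such that $$\Big(G(\vec X_h^n)\frac{\vec X_h^{n+1}-\vec X_h^n}{\Delta t},\vec\xi_h\Big)+\big(\partial_s\vec X_h^{n+1},\partial_s\vec\xi_h\big)=0\qquad\forall\,\vec\xi_h\in S(I)^2 .$$ Then there exists some $h_0\le 1$ such that for $h\le h_0$ and $\Delta t\le h^{1/2}$ being small enough, the scheme has a unique solution, and $\vec e_h^{\,m}:=\mathcal{R}_h^{\mathcal I}\vec X(t_m)-\vec X_h^m$ satisfies $$\|\vec e_h^{\,m}\|+\|\partial_s\vec e_h^{\,m}\|\le c(\alpha)\big(\Delta t+h^{k+1}\big)\qquad\text{for } m\Delta t\le T,$$ where $c(\alpha)$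 is a constant that is independent of $\Delta t$ and $h$ but depends on $\alpha$. Moreover (combining this with the estimate for $\mathcal{R}_h^{\mathcal I}\vec X-\vec X$), the optimal error bound $$\big\|\partial_s^p\big(\vec X_h^m-\vec X(t_m)\big)\big\|\le c(\alpha)\big(\Delta t+h^{k+1-p}\big),\qquad p=0,1,$$ holds for $m\Delta t\le T$.
   Context: Notation. $I=\mathbb{R}/2\pi\mathbb{Z}$ is the periodic interval; $(\cdot,\cdot)$ and $\|\cdot\|$ are the $L^2(I)$ inner product and norm (for vector-valued functions as well); $\mathbb{I}$ is the $2\times2$ identity matrix; $\vec a\otimes\vec b=\vec a\,\vec b^{T}$; $\vec\nu=(\partial_s\vec X)^\perp/|\partial_s\vec X|$ is the unit normal of the curve, with $^\perp$ the clockwise rotation by $\pi/2$. Finite element space. $I=\bigcup_{j=1}^N I_j$, $I_j=[s_{j-1},s_j]$, is a partition of $I$ with mesh size $h$. $S(I)$ is the space of continuous functions on $I$ whose restriction to each $I_j$ is a polynomial of degree (at most) $k$. Matrix $G$. For $\vec b\in H^1(I)^2$, $G(\vec b)=|\partial_s\vec b|^2\,\mathbb{I}+(\alpha-1)\,\partial_s\vec b\otimes\partial_s\vec b$. Operator $\mathcal{R}_h^{\mathcal I}$. If $k\ge2$, $\mathcal{R}_h^{\mathcal I}\vec y\in S(I)^2$ is the Ritz projection of $\vec y\in H^1(I)^2$, defined by $(\partial_s(\mathcal{R}_h^{\mathcal I}\vec y-\vec y),\partial_s\vec\xi_h)=0$ for all $\vec\xi_h\in S(I)^2$ together with $\int_I(\mathcal{R}_h^{\mathcal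 I}\vec y-\vec y)\,ds=\vec 0$. If $k=1$, $\mathcal{R}_h^{\mathcal I}$ is the piecewise linear (nodal) interpolation operator onto $S(I)^2$. *)

(* Defs.v *)
From Stdlib Require Import Reals List ClassicalEpsilon.
From Coquelicot Require Import Coquelicot.
Open Scope R_scope.

Notation R2 := (R * R)%type.

(* A 2x2 matrix is the pair of its rows; sums and scalar multiples of vectors
   and matrices are Coquelicot's [plus], [minus], [scal] on product modules. *)
Notation M22 := (R2 * R2)%type.

Definition dot (a b : R2) : R := fst a * fst b + snd a * snd b.
Definition norm2 (a : R2) : R := sqrt (dot a a).
Definition mulmv (A : M22) (v : R2) : R2 := (dot (fst A) v, dot (snd A) v).
Definition id22 : M22 := ((1, 0), (0, 1)).
Definition outer (a b : R2) : M22 := (scal (fst a) b, scal (snd a) b).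

Definition perp (a : R2) : R2 := (snd a, - fst a).

(* Functions on R/(2 pi Z) are represented by 2 pi-periodic functions on R. *)
Definition periodic {E : Type} (f : R -> E) : Prop :=
  forall s, f (s + 2 * PI) = f s.

(* For a continuous piecewise polynomial this is its weak derivative; the
   value at the finitely many nodes per period does not affect integrals. *)
Definition dS (f : R -> R2) (s : R) : R2 :=
  (Derive (fun u => fst (f u)) s, Derive (fun u => snd (f u)) s).

Definition dT (X : R -> R -> R2) (t s : R) : R2 :=
  (Derive (fun u => fst (X u s)) t, Derive (fun u => snd (X u s)) t).

(* All integrands occurring below are piecewise continuous on a period, so
   that the Riemann integral is the Lebesgue integral. *)
Definition inner (f g : R -> R2) : R :=
  RInt (fun s => dot (f s) (g s)) 0 (2 * PI).
Definition L2norm (f : R -> R2) : R := sqrt (inner f f).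

Definition diff (f g : R -> R2) (s : R) : R2 := minus (f s) (g s).

(* [f] is of class C^r on [0,T] x R, up to the boundary: [D i j] is the
   derivative of order i in t and j in s; for i > 0 it is given on
   {0} x R and {T} x R by continuous extension. *)
Definition C_strip (r : nat) (T : R) (f : R -> R -> R) : Prop :=
  exists D : nat -> nat -> R -> R -> R,
    (forall t s, 0 <= t <= T -> D 0%nat 0%nat t s = f t s) /\
    (forall i j, (i + j <= r)%nat -> forall t s, 0 <= t <= T ->
       filterlim (fun p : R2 => D i j (fst p) (snd p))
         (within (fun p : R2 => 0 <= fst p <= T) (locally (t, s)))
         (locally (D i j t s))) /\
    (forall i j, (i + j < r)%nat -> forall t s, 0 < t < T ->
       is_derive (fun u => D i j u s) t (D (S i) j t s)) /\
    (forall i j, (i + j < r)%nat -> forall t s, 0 <= t <= T ->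
       is_derive (fun u => D i j t u) s (D i (S j) t s)).

Definition smooth (r : nat) (T : R) (X : R -> R -> R2) : Prop :=
  C_strip r T (fun t s => fst (X t s)) /\ C_strip r T (fun t s => snd (X t s)).

Definition unit_normal (f : R -> R2) (s : R) : R2 :=
  scal (/ norm2 (dS f s)) (perp (dS f s)).

(* Classical solutions on [0,T] of the curve shortening--DeTurck flow, made of
   closed regular curves. *)
Definition flow_solution (alpha T : R) (X0 : R -> R2) (X : R -> R -> R2)
  : Prop :=
  smooth 2 T X /\
  (forall t, 0 <= t <= T -> periodic (X t)) /\
  (forall t s, 0 <= t <= T -> dS (X t) s <> (0, 0)) /\
  (forall s, X 0 s = X0 s) /\
  (forall t s, 0 < t < T ->
     let nu := unit_normal (X t) s in
     mulmv (scal (norm2 (dS (X t) s) ^ 2)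
              (plus (scal alpha id22) (scal (1 - alpha) (outer nu nu))))
           (dT X t s)
     = dS (dS (X t)) s).

(* The nodes are s_0 < ... < s_N = s_0 + 2 pi, with N = [nint P]. *)
Record partition := Partition {
  nint : nat;
  node : nat -> R;
  node_incr : forall j, (j < nint)%nat -> node j < node (S j);
  node_period : node nint = node 0%nat + 2 * PI
}.

Definition mesh_size (P : partition) : R :=
  fold_right Rmax 0
    (map (fun j => node P (S j) - node P j) (seq 0 (nint P))).

Definition fe_scalar (k : nat) (P : partition) (f : R -> R) : Prop :=
  periodic f /\ (forall s, continuous f s) /\
  (forall j, (j < nint P)%nat ->
     exists a : nat -> R, forall s, node P j <= s <= node P (S j) ->
       f s = sum_f_R0 (fun i => a i * s ^ i) k).

Definition fe_space (k : nat) (P : partition) (v : R -> R2) : Prop :=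
  fe_scalar k P (fun s => fst (v s)) /\ fe_scalar k P (fun s => snd (v s)).

Definition is_ritz (k : nat) (P : partition) (y yh : R -> R2) : Prop :=
  fe_space k P yh /\
  (forall xi, fe_space k P xi -> inner (dS (diff yh y)) (dS xi) = 0) /\
  RInt (fun s => fst (diff yh y s)) 0 (2 * PI) = 0 /\
  RInt (fun s => snd (diff yh y s)) 0 (2 * PI) = 0.

Definition is_nodal_interp (P : partition) (y yh : R -> R2) : Prop :=
  fe_space 1 P yh /\
  (forall j, (j <= nint P)%nat -> yh (node P j) = y (node P j)).

Definition is_RhI (k : nat) (P : partition) (y yh : R -> R2) : Prop :=
  if Nat.eqb k 1 then is_nodal_interp P y yh else is_ritz k P y yh.

(* The operator R_h^I: the function characterized by [is_RhI]. *)
Definition RhI (k : nat) (P : partition) (y : R -> R2) : R -> R2 :=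
  epsilon (inhabits (fun _ => (0, 0))) (is_RhI k P y).

Definition Gmat (alpha : R) (b : R -> R2) (s : R) : M22 :=
  plus (scal (norm2 (dS b s) ^ 2) id22)
       (scal (alpha - 1) (outer (dS b s) (dS b s))).

Definition euler_scheme (alpha : R) (k : nat) (P : partition) (dt : R)
    (M : nat) (X0 : R -> R2) (Xh : nat -> R -> R2) : Prop :=
  (forall s, Xh 0%nat s = RhI k P X0 s) /\
  (forall n, (n < M)%nat ->
     fe_space k P (Xh (S n)) /\
     forall xi, fe_space k P xi ->
       inner (fun s => mulmv (Gmat alpha (Xh n) s)
                         (scal (/ dt) (diff (Xh (S n)) (Xh n) s))) xi
       + inner (dS (Xh (S n))) (dS xi) = 0).

(* Main.v *)
(* Write d for the difference quotient in time and e for the error. The scheme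
   and the flow give (G(X_h) d e, xi) + (d_s e, d_s xi) = (F, xi) with F of
   order |d_s e| + h^k + dt. Differencing this equation once more in time and
   testing with d e bounds ||d e|| by h^k + dt as long as d_s e is uniformly
   small. Conversely, once ||d e|| is small, the equation at a fixed time says
   that d_s e is the cellwise L2 projection of a primitive of an L1 function, up
   to a constant; this bounds sup |d_s e| by h^k + dt without an inverse
   inequality for the mesh, and closes an induction over the time steps.

   For the order h^(k+1), the equation itself is tested with d e. The only
   defect terms of order h^k contain the factor d_s(R_h X - X): an integration by
   parts in s gains one power of h against xi in H^1, and a summation by parts in
   time moves the difference quotient from e to the defect. *)
From Stdlib Require Import ZArith Reals List Lra Lia ClassicalEpsilon FunctionalExtensionality.
From Coquelicot Require Import Coquelicot.
Require Import Defs.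
Open Scope R_scope.

(** * Riesz representation and local projections *)

(** The obstacle is that G(X_h) depends on d_s X_h while the mesh is arbitrary: an H^1 bound of the
    error does not control sup |d_s e|, yet this sup decides whether G(X_h) stays coercive, hence
    even whether the next step is solvable. Existence is therefore part of the induction over the
    steps. In the differenced equation the increment of G acts on d e and leaves, after Young's
    inequality, terms quartic in d e. In one space dimension sup |d e|^2 is bounded by the squared
    H^1 norm, so these terms are absorbed by the dissipation ||d_s d e||^2 once ||d e|| is below a
    fixed threshold, for which smallness of h^k + dt suffices. The recursion starts without loss
    because e vanishes at the initial time. The Ritz projection and, for k = 1, the interpolation
    are treated as one: both make the derivative of the projection error orthogonal to polynomials
    of degree k - 1 on every cell. Second time differences of the projection error cost two
    derivatives in t besides k + 1 in s; this is the origin of the smoothness index k + 3. *)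

Definition linear_on {V : Type} (comb : V -> R -> V -> V) (S : V -> Prop)
    (f : V -> R) : Prop :=
  forall v c w, S v -> S w -> f (comb v c w) = f v + c * f w.

(** [comb v c w] plays the role of v + c w. No vector space axioms are imposed on it, since vectors
    are only seen through functionals and forms; the same representation lemma then serves
    coefficient sequences and finite element functions. *)
Definition closed_under {V : Type} (comb : V -> R -> V -> V) (S : V -> Prop) :=
  forall v c w, S v -> S w -> S (comb v c w).

Record semi_inner {V : Type} (comb : V -> R -> V -> V) (S : V -> Prop)
    (B : V -> V -> R) : Prop := SemiInner {
  si_lin : forall u, S u -> linear_on comb S (fun v => B v u);
  si_sym : forall u v, S u -> S v -> B u v = B v u;
  si_pos : forall v, S v -> 0 <= B v v
}.

Lemma semi_inner_quad {V : Type} (comb : V -> R -> V -> V) S B :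
  closed_under comb S -> semi_inner comb S B ->
  forall w c v, S w -> S v -> 0 <= B w w + 2 * c * B w v + c * c * B v v.
Proof.
  intros Hc [Hl Hs Hp] w c v Hw Hv.
  assert (H := Hp _ (Hc w c v Hw Hv)).
  rewrite (Hl (comb w c v)) in H; auto.
  rewrite (Hs w (comb w c v)), (Hs v (comb w c v)) in H; auto.
  rewrite (Hl w), (Hl v) in H; auto.
  rewrite (Hs v w) in H; auto. lra.
Qed.

Lemma semi_inner_CS {V : Type} (comb : V -> R -> V -> V) S B :
  closed_under comb S -> semi_inner comb S B ->
  forall w v, S w -> S v -> B w v * B w v <= B w w * B v v.
Proof.
  intros Hc HB w v Hw Hv.
  assert (Q := fun c => semi_inner_quad comb S B Hc HB w c v Hw Hv).
  assert (Pv := si_pos _ _ _ HB v Hv).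
  destruct (Req_dec (B v v) 0) as [E|E].
  - rewrite E in *.
    destruct (Req_dec (B w v) 0) as [F|F]; [rewrite F; lra|].
    (* With [B v v = 0] the quadratic is affine in c, and this c makes it equal to -1. *)
    specialize (Q (- (B w w + 1) / (2 * B w v))).
    replace (B w w + 2 * (- (B w w + 1) / (2 * B w v)) * B w v + _) with (-1) in Q
      by (field; auto). lra.
  - specialize (Q (- (B w v / B v v))).
    replace (B w w + _ + _) with ((B w w * B v v - B w v * B w v) / B v v) in Q
      by (field; auto).
    assert (0 <= (B w w * B v v - B w v * B w v) / B v v * B v v)
      by (apply Rmult_le_pos; lra).
    unfold Rdiv in H. rewrite Rmult_assoc, Rinv_l in H; lra.
Qed.

(* The list [ls] of functionals plays the role of a basis of the dual: the
   induction restricts [S] to the kernel of the first of them. *)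
Lemma riesz {V : Type} (comb : V -> R -> V -> V) (z : V) :
  comb z (-1) z = z ->
  forall (ls : list (V -> R)) (S : V -> Prop) (B : V -> V -> R) (L : V -> R),
    S z -> closed_under comb S -> semi_inner comb S B ->
    (forall l, In l ls -> linear_on comb S l) -> linear_on comb S L ->
    (forall v, S v -> (forall l, In l ls -> l v = 0) -> B v v = 0) ->
    (forall v, S v -> B v v = 0 -> L v = 0) ->
    exists u, S u /\ forall v, S v -> B u v = L v.
Proof.
  intros Hz. induction ls as [|l ls IH]; intros S B L Sz Sc HB Hls HL Hsep HL0.
  - exists z. split; auto. intros v Hv.
    rewrite (HL0 v); auto using Hsep.
    + assert (E := si_lin _ _ _ HB v Hv z (-1) z Sz Sz).
      simpl in E. rewrite Hz in E. lra.
    + apply Hsep; auto. intros l [].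
  - set (S' := fun v => S v /\ l v = 0).
    assert (Hl : linear_on comb S l) by (apply Hls; left; auto).
    assert (Sz' : S' z).
    { split; auto. assert (E := Hl z (-1) z Sz Sz). rewrite Hz in E. lra. }
    assert (Sc' : closed_under comb S').
    { intros v c w [Hv Ev] [Hw Ew]. split; auto. rewrite Hl, Ev, Ew; auto. ring. }
    assert (HB' : semi_inner comb S' B).
    { destruct HB as [H1 H2 H3]. split.
      - intros u [Hu _] v c w [Hv _] [Hw _]. apply H1; auto.
      - intros u v [Hu _] [Hv _]. auto.
      - intros v [Hv _]. auto. }
    assert (Rz : forall F, linear_on comb S F -> (forall v, S v -> B v v = 0 -> F v = 0) ->
       exists u, S' u /\ forall v, S' v -> B u v = F v).
    { intros F HF HF0. apply IH; auto.
      - intros l' Hl' v c w [Hv _] [Hw _]. apply Hls; auto. right; auto.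
      - intros v c w [Hv _] [Hw _]. apply HF; auto.
      - intros v [Hv Ev] H. apply Hsep; auto. intros l' [<-|H']; auto.
      - intros v [Hv _]. auto. }
    destruct (Rz L HL HL0) as [u' [[Su' Eu'] Hu']].
    destruct (classic (exists w, S w /\ l w <> 0)) as [[w [Sw Ew]]|N].
    2:{ exists u'. split; auto. intros v Hv. apply Hu'. split; auto.
        apply NNPP. intro. apply N. exists v; auto. }
    assert (B0 : forall x v, S x -> S v -> B v v = 0 -> B x v = 0).
    { intros x v Hx Hv E. assert (C := semi_inner_CS comb S B Sc HB x v Hx Hv).
      rewrite E in C. apply Rsqr_0_uniq. unfold Rsqr. assert (0 <= B x v * B x v) by nra. lra. }
    (* [p] represents [B w] on the kernel of [l], so that [w' = w - p] is orthogonal to the kernel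
       and spans a complement of it. *)
    destruct (Rz (B w)) as [p [[Sp Ep] Hp]].
    { intros v c x Hv Hx. rewrite !(si_sym _ _ _ HB w); auto.
      apply (si_lin _ _ _ HB); auto. }
    { intros v Hv E. apply B0; auto. }
    set (w' := comb w (-1) p).
    assert (Sw' : S w') by (apply Sc; auto).
    assert (lw' : l w' = l w) by (unfold w'; rewrite Hl; auto; lra).
    assert (O' : forall v, S' v -> B w' v = 0).
    { intros v Hv. assert (S v) by apply Hv. unfold w'.
      rewrite (si_lin _ _ _ HB v) by auto. rewrite Hp; auto. lra. }
    (* The default 0 is harmless: if [w'] has length zero, then [L w' = 0] by [HL0]. *)
    set (t := if Req_EM_T (B w' w') 0 then 0 else L w' / B w' w').
    exists (comb u' t w').
    split; auto. intros v Hv.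
    set (c := l v / l w). set (v' := comb v (- c) w').
    assert (Sv' : S' v').
    { split; [apply Sc; auto|]. unfold v'. rewrite Hl, lw'; auto.
      unfold c. field; auto. }
    assert (Sv0 : S v') by apply Sv'.
    assert (E1 : L v = L v' + c * L w') by (unfold v'; rewrite HL; auto; lra).
    assert (E2 : forall x, S x -> B x v = B x v' + c * B x w').
    { intros x Hx. rewrite (si_sym _ _ _ HB x v), (si_sym _ _ _ HB x v'), (si_sym _ _ _ HB x w');
        auto. unfold v'. rewrite (si_lin _ _ _ HB x); auto. lra. }
    rewrite (si_lin _ _ _ HB v) by auto. rewrite !E2 by auto.
    rewrite Hu', O', E1 by auto.
    replace (B u' w') with 0.
    2:{ rewrite (si_sym _ _ _ HB); auto. rewrite O'; auto. split; auto. }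
    unfold t. destruct (Req_EM_T (B w' w') 0) as [E|E].
    + rewrite (HL0 w'); auto. lra.
    + field; auto.
Qed.

(** * Polynomials of bounded degree *)

Definition isP (d : nat) (f : R -> R) : Prop :=
  exists a : nat -> R, forall s, f s = sum_f_R0 (fun i => a i * s ^ i) d.

Lemma isP_ext d f g : (forall s, f s = g s) -> isP d f -> isP d g.
Proof. intros E [a H]. exists a. intros s. rewrite <- E; auto. Qed.

Lemma isP_const d c : isP d (fun _ => c).
Proof.
  exists (fun i => if Nat.eqb i 0 then c else 0). intros s.
  induction d as [|d IH]; simpl; [lra|]. simpl in IH. rewrite <- IH. lra.
Qed.

Lemma isP_plus d f g : isP d f -> isP d g -> isP d (fun s => f s + g s).
Proof.
  intros [a Ha] [b Hb]. exists (fun i => a i + b i). intros s.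
  rewrite Ha, Hb, <- plus_sum. apply sum_eq. intros; ring.
Qed.

Lemma isP_scal d c f : isP d f -> isP d (fun s => c * f s).
Proof.
  intros [a Ha]. exists (fun i => c * a i). intros s.
  rewrite Ha, scal_sum. apply sum_eq. intros; ring.
Qed.

Lemma isP_comb d v c w : isP d v -> isP d w -> isP d (fun s => v s + c * w s).
Proof. intros. apply isP_plus; auto. apply isP_scal; auto. Qed.

Lemma isP_mulX d f : isP d f -> isP (S d) (fun s => s * f s).
Proof.
  intros [a Ha]. exists (fun i => match i with O => 0 | S j => a j end). intros s.
  rewrite Ha, (decomp_sum _ (S d)) by lia. simpl. rewrite scal_sum.
  rewrite Rmult_0_l, Rplus_0_l. apply sum_eq. intros; ring.
Qed.

(** One Horner step. It lets degree raising, affine substitution and differentiation be handled by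
    induction on the degree rather than on coefficient sums. *)
Lemma isP_decomp d f : isP (S d) f ->
  exists c g, isP d g /\ forall s, f s = c + s * g s.
Proof.
  intros [a Ha]. exists (a O), (fun s => sum_f_R0 (fun i => a (S i) * s ^ i) d).
  split. { exists (fun i => a (S i)). auto. }
  intros s. rewrite Ha, decomp_sum by lia. simpl. rewrite scal_sum.
  f_equal; [ring|]. apply sum_eq. intros; ring.
Qed.

Lemma isP_0 f : isP 0 f -> forall s, f s = f 0.
Proof. intros [a Ha] s. rewrite !Ha. simpl. ring. Qed.

Lemma isP_S d f : isP d f -> isP (S d) f.
Proof.
  revert f. induction d as [|d IH]; intros f Hf.
  - apply (isP_ext _ (fun _ => f 0)); [intros; symmetry; apply isP_0; auto|].
    apply isP_const.
  - destruct (isP_decomp _ _ Hf) as [c [g [Hg E]]].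
    apply (isP_ext _ (fun s => c + s * g s)); [auto|].
    apply isP_plus; [apply isP_const|]. apply isP_mulX; auto.
Qed.

Lemma isP_lin d f u v : isP d f -> isP d (fun s => f (u * s + v)).
Proof.
  revert f. induction d as [|d IH]; intros f Hf.
  - apply (isP_ext _ (fun _ => f 0)); [|apply isP_const].
    intros s. symmetry. apply isP_0; auto.
  - destruct (isP_decomp _ _ Hf) as [c [g [Hg E]]].
    apply (isP_ext _ (fun s => (c + u * (s * g (u * s + v))) + v * g (u * s + v))).
    { intros s. rewrite E. ring. }
    apply isP_plus; [apply isP_plus; [apply isP_const|]|].
    + apply isP_scal. apply (isP_mulX d (fun s => g (u * s + v))). auto.
    + apply isP_scal, isP_S. auto.
Qed.

Lemma isP_derive d f : isP d f ->
  exists g, isP (pred d) g /\ forall s, is_derive f s (g s).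
Proof.
  revert f. induction d as [|d IH]; intros f Hf.
  - exists (fun _ => 0). split; [apply isP_const|]. intros s.
    apply (is_derive_ext (fun _ => f 0)); [intros; symmetry; apply isP_0; auto|].
    apply (is_derive_const (f 0) s).
  - destruct (isP_decomp _ _ Hf) as [c [g [Hg E]]].
    destruct (IH g Hg) as [g' [Hg' D]].
    exists (fun s => g s + s * g' s). split.
    + apply isP_plus; auto. simpl. destruct d as [|d]; simpl in *.
      * apply (isP_ext _ (fun _ => 0)); [|apply isP_const]. intros s.
        assert (0 = g' s); [|rewrite <- H; ring].
        rewrite <- (is_derive_unique _ _ _ (D s)).
        rewrite (Derive_ext g (fun _ => g 0)) by (apply isP_0; auto).
        symmetry; apply Derive_const.
      * apply isP_mulX; auto.
    + intros s. apply (is_derive_ext (fun s => c + s * g s)); [intros; rewrite E; auto|].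
      assert (D' := D s).
      assert (H := is_derive_plus (fun _ => c) _ s _ _ (is_derive_const (V:=R_NormedModule) c s)
         (is_derive_mult (fun s => s) g s 1 _ (is_derive_id s) D' Rmult_comm)).
      replace (g s + s * g' s) with (plus zero (plus (mult 1 (g s)) (mult s (g' s)))); [exact H|].
      unfold plus, mult, zero; simpl; ring.
Qed.

Lemma isP_prim d f : isP d f ->
  exists F, isP (S d) F /\ forall s, is_derive F s (f s).
Proof.
  intros [a Ha].
  exists (fun s => sum_f_R0 (fun i => (match i with O => 0 | S j => a j / INR (S j) end) * s ^ i) (S d)).
  split. { eexists; reflexivity. }
  intros s. rewrite Ha. clear Ha f.
  induction d as [|d IH].
  - simpl. auto_derive; auto. field.
  - rewrite tech5.
    apply (is_derive_ext (fun s0 => sum_f_R0 (fun i => match i with O => 0 | S j => a j / INR (S j) end * s0 ^ i) (S d)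
        + a (S d) / INR (S (S d)) * s0 ^ (S (S d)))).
    { intros t. rewrite (tech5 _ (S d)). auto. }
    apply (is_derive_plus (K := R_AbsRing) (V := R_NormedModule)); auto.
    auto_derive; auto.
    change (s ^ S d) with (s * s ^ d). rewrite ?S_INR. field.
    apply Rgt_not_eq. change (INR (S d) + 1 > 0). assert (H := pos_INR (S d)). lra.
Qed.

Lemma is_derive_cont (f : R -> R) s l : is_derive f s l -> continuous f s.
Proof.
  intros H. apply (ex_derive_continuous (K := R_AbsRing) (V := R_NormedModule)).
  exists l. exact H.
Qed.

Lemma isP_cont d f : isP d f -> forall s, continuous f s.
Proof.
  intros H s. destruct (isP_derive d f H) as [g [_ D]].
  exact (is_derive_cont f s _ (D s)).
Qed.

(** * Continuity and Riemann integrals of real functions *)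

Lemma cont_plus (f g : R -> R) s :
  continuous f s -> continuous g s -> continuous (fun x => f x + g x) s.
Proof. apply (continuous_plus (V := R_NormedModule)). Qed.

Lemma cont_mult (f g : R -> R) s :
  continuous f s -> continuous g s -> continuous (fun x => f x * g x) s.
Proof. apply (continuous_mult (K := R_AbsRing)). Qed.

Lemma cont_opp (f : R -> R) s : continuous f s -> continuous (fun x => - f x) s.
Proof. apply (continuous_opp (V := R_NormedModule)). Qed.

Lemma cont_minus (f g : R -> R) s :
  continuous f s -> continuous g s -> continuous (fun x => f x - g x) s.
Proof. intros. apply cont_plus; auto using cont_opp. Qed.

Lemma cont_const (c s : R) : continuous (fun _ : R => c) s.
Proof. apply continuous_const. Qed.

Lemma cont_id (s : R) : continuous (fun x : R => x) s.
Proof. apply continuous_id. Qed.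

Lemma cont_ex_RInt (f : R -> R) a b : (forall s, continuous f s) -> ex_RInt f a b.
Proof. intros H. apply (ex_RInt_continuous (V := R_CompleteNormedModule)). auto. Qed.

Lemma RInt_ge0 (f : R -> R) a b : a <= b -> ex_RInt f a b ->
  (forall s, a < s < b -> 0 <= f s) -> 0 <= RInt f a b.
Proof. intros. apply RInt_ge_0; auto. Qed.

(** If f x were nonzero, f would be nonzero on a nondegenerate interval near x, cut at a and b in
    case x is an endpoint, and f^2 would have a positive integral there. *)
Lemma RInt_sq_0 (f : R -> R) a b : a < b -> (forall s, continuous f s) ->
  RInt (fun s => f s * f s) a b = 0 -> forall s, a <= s <= b -> f s = 0.
Proof.
  intros ab Hc H0 x Hx. apply NNPP. intros Hn.
  assert (Hc2 : forall s, continuous (fun s => f s * f s) s) by (intros; apply cont_mult; auto).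
  assert (L : locally x (fun y => f y <> 0)).
  { apply (Hc x (fun y => y <> 0)). apply (open_neq 0 (f x) Hn). }
  destruct L as [d Hd].
  set (c1 := Rmax a (x - d / 2)). set (c2 := Rmin b (x + d / 2)).
  assert (dp := cond_pos d).
  assert (B1 : a <= c1 /\ c1 < c2 /\ c2 <= b).
  { unfold c1, c2, Rmax, Rmin. repeat destruct Rle_dec; lra. }
  assert (B2 : x - d / 2 <= c1 /\ c2 <= x + d / 2).
  { unfold c1, c2, Rmax, Rmin. repeat destruct Rle_dec; lra. }
  assert (P : 0 < RInt (fun s => f s * f s) c1 c2).
  { apply RInt_gt_0; [lra| |intros; auto].
    intros s Hs. assert (f s <> 0).
    { apply Hd. change (Rabs (s - x) < d). apply Rabs_def1; lra. }
    nra. }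
  assert (E : forall u v, ex_RInt (fun s => f s * f s) u v) by (intros; apply cont_ex_RInt; auto).
  rewrite <- (RInt_Chasles _ a c1 b), <- (RInt_Chasles _ c1 c2 b) in H0 by auto.
  unfold plus in H0; simpl in H0.
  assert (0 <= RInt (fun s => f s * f s) a c1) by (apply RInt_ge0; auto; try lra; intros; nra).
  assert (0 <= RInt (fun s => f s * f s) c2 b) by (apply RInt_ge0; auto; try lra; intros; nra).
  lra.
Qed.

Lemma RI_ext (f g : R -> R) a b : a <= b ->
  (forall s, a < s < b -> f s = g s) -> RInt f a b = RInt g a b.
Proof.
  intros ab H. apply (RInt_ext (V := R_CompleteNormedModule)). intros s Hs.
  rewrite Rmin_left, Rmax_right in Hs by lra. auto.
Qed.

Lemma RI_plus (f g : R -> R) a b : ex_RInt f a b -> ex_RInt g a b ->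
  RInt (fun s => f s + g s) a b = RInt f a b + RInt g a b.
Proof. apply (RInt_plus (V := R_CompleteNormedModule)). Qed.

Lemma RI_scal (f : R -> R) c a b : ex_RInt f a b ->
  RInt (fun s => c * f s) a b = c * RInt f a b.
Proof. apply (RInt_scal (V := R_CompleteNormedModule)). Qed.

Lemma RI_minus (f g : R -> R) a b : ex_RInt f a b -> ex_RInt g a b ->
  RInt (fun s => f s - g s) a b = RInt f a b - RInt g a b.
Proof. apply (RInt_minus (V := R_CompleteNormedModule)). Qed.

Lemma RI_const c a b : RInt (fun _ => c) a b = c * (b - a).
Proof. rewrite RInt_const. unfold scal; simpl; unfold mult; simpl. ring. Qed.

Lemma eRI_plus (f g : R -> R) a b : ex_RInt f a b -> ex_RInt g a b ->
  ex_RInt (fun s => f s + g s) a b.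
Proof. apply (ex_RInt_plus (V := R_NormedModule)). Qed.

Lemma eRI_scal (f : R -> R) c a b : ex_RInt f a b -> ex_RInt (fun s => c * f s) a b.
Proof. apply (ex_RInt_scal (V := R_NormedModule)). Qed.

Lemma RI_Chasles (f : R -> R) a b c : ex_RInt f a b -> ex_RInt f b c ->
  RInt f a c = RInt f a b + RInt f b c.
Proof. intros. symmetry. apply (RInt_Chasles (V := R_CompleteNormedModule)); auto. Qed.

Lemma RI_point (f : R -> R) a : RInt f a a = 0.
Proof. apply (RInt_point (V := R_CompleteNormedModule)). Qed.

(** * Coefficient sequences and the inverse inequality on one interval *)

Definition pev (d : nat) (a : nat -> R) (s : R) : R :=
  sum_f_R0 (fun i => a i * s ^ i) d.

Definition seq_comb (v : nat -> R) (c : R) (w : nat -> R) (i : nat) := v i + c * w i.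

Lemma isP_pev d a : isP d (pev d a).
Proof. exists a. reflexivity. Qed.

Lemma pev_comb d v c w s : pev d (seq_comb v c w) s = pev d v s + c * pev d w s.
Proof.
  unfold pev, seq_comb. rewrite scal_sum, <- plus_sum. apply sum_eq. intros; ring.
Qed.

Lemma pev_S d a s : pev (S d) a s = a O + s * pev d (fun i => a (S i)) s.
Proof.
  unfold pev. rewrite decomp_sum by lia. simpl. rewrite scal_sum.
  f_equal; [ring|]. apply sum_eq. intros; ring.
Qed.

(** The value at 0 gives a 0 = 0; the quotient by s then vanishes on (0, 1], and at 0 by continuity,
    so that the induction hypothesis applies to it. *)
Lemma pev_0_coef d a : (forall s, 0 <= s <= 1 -> pev d a s = 0) ->
  forall i, (i <= d)%nat -> a i = 0.
Proof.
  revert a. induction d as [|d IH]; intros a H i Hi.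
  - assert (i = O) by lia. subst. specialize (H 0 ltac:(lra)).
    unfold pev in H. simpl in H. lra.
  - assert (a0 : a O = 0).
    { specialize (H 0 ltac:(lra)). rewrite pev_S in H. lra. }
    destruct i as [|i]; auto.
    refine (IH (fun i => a (S i)) _ i ltac:(lia)).
    set (g := pev d (fun i0 => a (S i0))).
    assert (Hg : forall s, 0 < s <= 1 -> g s = 0).
    { intros s Hs. specialize (H s ltac:(lra)). rewrite pev_S, a0 in H.
      fold g in H. assert (E : s * g s = 0) by lra.
      apply Rmult_integral in E. destruct E; [lra|auto]. }
    intros s Hs. destruct (Req_dec s 0) as [->|]; [|apply Hg; lra].
    apply NNPP. intros Hn.
    assert (L : locally 0 (fun y => g y <> 0)).
    { apply (isP_cont d g (isP_pev _ _) 0 (fun y => y <> 0)). apply (open_neq 0 (g 0) Hn). }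
    destruct L as [e He]. assert (ep := cond_pos e).
    set (x := Rmin 1 (e / 2)).
    assert (0 < x <= 1 /\ x < e) by (unfold x, Rmin; destruct Rle_dec; lra).
    apply (He x); [|apply Hg; lra].
    change (Rabs (x - 0) < e). apply Rabs_def1; lra.
Qed.

(** Degenerate on sequences, since coefficients of index above d are ignored. This is why [riesz] is
    stated for semi-definite forms. *)
Definition pin (d : nat) (a b : R) (v w : nat -> R) : R :=
  RInt (fun s => pev d v s * pev d w s) a b.

Lemma isP_mult_cont d f g : isP d f -> (forall s, continuous g s) ->
  forall s, continuous (fun x => f x * g x) s.
Proof. intros Hf Hg s. apply cont_mult; auto. apply (isP_cont d); auto. Qed.

Lemma pin_ex d a b v w : ex_RInt (fun s => pev d v s * pev d w s) a b.
Proof.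
  apply cont_ex_RInt. apply (isP_mult_cont d); [apply isP_pev|].
  apply (isP_cont d), isP_pev.
Qed.

Lemma pin_semi_inner d a b : a <= b ->
  semi_inner seq_comb (fun _ => True) (pin d a b).
Proof.
  intros ab. split.
  - intros u _ v c w _ _. unfold pin.
    rewrite <- RI_scal, <- RI_plus; auto using pin_ex, eRI_scal.
    apply RI_ext; [lra|]. intros s _. rewrite pev_comb. lra.
  - intros u v _ _. apply RI_ext; [lra|]. intros s _. apply Rmult_comm.
  - intros v _. apply RInt_ge0; auto using pin_ex. intros; nra.
Qed.

Lemma pin_0 d a b v : a < b -> pin d a b v v = 0 ->
  forall s, a <= s <= b -> pev d v s = 0.
Proof. intros ab H. apply RInt_sq_0; auto. apply (isP_cont d), isP_pev. Qed.

Definition coefs (d : nat) : list ((nat -> R) -> R) :=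
  map (fun i (a : nat -> R) => a i) (seq 0 (S d)).

Lemma pin_riesz d a b (L : (nat -> R) -> R) : a < b ->
  linear_on seq_comb (fun _ => True) L ->
  (forall v, (forall s, a <= s <= b -> pev d v s = 0) -> L v = 0) ->
  exists u, forall v, pin d a b u v = L v.
Proof.
  intros ab HL H0.
  destruct (riesz seq_comb (fun _ => 0)) with (ls := coefs d) (S := fun _ : nat -> R => True)
    (B := pin d a b) (L := L) as [u [_ Hu]]; auto.
  - extensionality i. unfold seq_comb. ring.
  - intros v c w _ _. exact I.
  - apply pin_semi_inner; lra.
  - intros l Hl. apply in_map_iff in Hl. destruct Hl as [i [<- _]].
    intros v c w _ _. reflexivity.
  - intros v _ Hv. unfold pin.
    rewrite (RI_ext _ (fun _ => 0)); [rewrite RI_const; ring|lra|].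
    intros s _. replace (pev d v s) with 0; [ring|].
    unfold pev. symmetry. rewrite <- (Rmult_0_l (INR (S d))), <- sum_cte.
    apply sum_eq. intros i Hi. rewrite (Hv (fun a => a i)); [ring|].
    apply in_map_iff. exists i. split; auto. apply in_seq. lia.
  - intros v _ Hv. apply H0. apply (pin_0 d a b v); auto.
  - exists u. auto.
Qed.

(** Equivalence of norms in finite dimension without compactness: the functional [a i] is
    represented by some [u], and Cauchy-Schwarz gives the constant [pin d 0 1 u u]. *)
Lemma coef_bound d i : (i <= d)%nat ->
  exists C, 0 <= C /\ forall a, a i * a i <= C * pin d 0 1 a a.
Proof.
  intros Hi. destruct (pin_riesz d 0 1 (fun a => a i)) as [u Hu]; [lra| | |].
  - intros v c w _ _. reflexivity.
  - intros v Hv. apply (pev_0_coef d); auto.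
  - exists (pin d 0 1 u u). assert (Hs := pin_semi_inner d 0 1 ltac:(lra)). split.
    + apply (si_pos _ _ _ Hs); auto.
    + intros a. rewrite <- Hu. apply (semi_inner_CS seq_comb (fun _ => True)); auto.
      intros ? ? ? ? ?. exact I.
Qed.

(** Induction over the partial sums of degree n, all measured against the norm of the full
    polynomial of degree d, with (p + q)^2 <= 2 p^2 + 2 q^2 at each new term. *)
Lemma pev_bound_aux d n : (n <= d)%nat ->
  exists C, 0 <= C /\ forall a s, 0 <= s <= 1 -> pev n a s * pev n a s <= C * pin d 0 1 a a.
Proof.
  induction n as [|n IH]; intros Hn; destruct (coef_bound d _ Hn) as [C1 [HC1 H1]].
  - exists C1. split; auto. intros a s _. unfold pev. simpl. rewrite !Rmult_1_r. auto.
  - destruct IH as [C2 [HC2 H2]]; [lia|].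
    exists (2 * C1 + 2 * C2). split; [lra|]. intros a s Hs.
    specialize (H1 a). specialize (H2 a s Hs).
    replace (pev (S n) a s) with (pev n a s + a (S n) * s ^ S n) by (unfold pev; rewrite tech5; auto).
    assert (B : 0 <= s ^ S n <= 1).
    { split; [apply pow_le; lra|]. rewrite <- (pow1 (S n)). apply pow_incr; lra. }
    set (x := s ^ S n) in *. set (p := pev n a s) in *. set (q := a (S n)) in *.
    assert (q * q * (x * x) <= q * q * 1) by (apply Rmult_le_compat_l; nra).
    assert (0 <= (p - q * x) * (p - q * x)) by apply Rle_0_sqr.
    replace ((p + q * x) * (p + q * x)) with
      (2 * (p * p) + 2 * (q * q * (x * x)) - (p - q * x) * (p - q * x)) by ring.
    lra.
Qed.

(** The bound on [0, 1] is transported by the affine map onto [a, b], whose length enters only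
    through the factor 1/(b - a). *)
Lemma poly_inverse_ineq d : exists C, 0 <= C /\
  forall p a b, isP d p -> a < b ->
    forall s, a <= s <= b -> p s * p s <= C / (b - a) * RInt (fun s => p s * p s) a b.
Proof.
  destruct (pev_bound_aux d d) as [C [HC H]]; auto.
  exists C. split; auto. intros p a b Hp ab s Hs.
  destruct (isP_lin d p (b - a) a Hp) as [q Hq].
  specialize (H q ((s - a) / (b - a))).
  assert (Hr : 0 <= (s - a) / (b - a) <= 1).
  { split; [apply Rdiv_le_0_compat; lra|]. apply (Rmult_le_reg_r (b - a)); [lra|].
    unfold Rdiv. rewrite Rmult_assoc, Rinv_l by lra. lra. }
  specialize (H Hr). unfold pev in H at 1 2. rewrite <- Hq in H.
  replace ((b - a) * ((s - a) / (b - a)) + a) with s in H by (field; lra).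
  eapply Rle_trans; [apply H|]. apply Req_le.
  replace (RInt (fun s0 => p s0 * p s0) a b) with ((b - a) * pin d 0 1 q q);
    [field; lra|].
  assert (Cp : forall x, continuous (fun s => p s * p s) x).
  { apply (isP_mult_cont d); auto. apply (isP_cont d); auto. }
  unfold pin. rewrite <- RI_scal by apply pin_ex.
  assert (E := RInt_comp_lin (V := R_CompleteNormedModule) (fun s => p s * p s) (b - a) a 0 1
     ltac:(apply cont_ex_RInt; auto)).
  replace ((b - a) * 0 + a) with a in E by ring.
  replace ((b - a) * 1 + a) with b in E by ring.
  rewrite <- E. apply RI_ext; [lra|]. intros y _. unfold scal; simpl; unfold mult; simpl.
  unfold pev. rewrite <- Hq. reflexivity.
Qed.

(** * L2 projection and Taylor approximation on one interval *)

Lemma local_proj_exists d a b (y : R -> R) : a < b -> (forall s, continuous y s) ->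
  exists p, isP d p /\ forall q, isP d q -> RInt (fun s => (p s - y s) * q s) a b = 0.
Proof.
  intros ab Hy.
  assert (E : forall v, ex_RInt (fun s => pev d v s * y s) a b).
  { intros v. apply cont_ex_RInt. apply (isP_mult_cont d); auto using isP_pev. }
  destruct (pin_riesz d a b (fun v => RInt (fun s => pev d v s * y s) a b)) as [u Hu]; auto.
  - intros v c w _ _. rewrite <- RI_scal, <- RI_plus; auto using eRI_scal.
    apply RI_ext; [lra|]. intros s _. rewrite pev_comb. lra.
  - intros v Hv. rewrite (RI_ext _ (fun _ => 0)); [rewrite RI_const; ring|lra|].
    intros s Hs. rewrite Hv by lra. ring.
  - exists (pev d u). split; [apply isP_pev|]. intros q [v Hq].
    specialize (Hu v). unfold pin in Hu.
    rewrite (RI_ext _ (fun s => pev d u s * pev d v s - pev d v s * y s)); [|lra|].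
    + rewrite RI_minus; auto using pin_ex. lra.
    + intros s _. rewrite Hq. unfold pev. ring.
Qed.

(** Stability of the L2 projection in the sup norm, uniform in the interval: ||p||^2 = (y, p) gives
    ||p||^2 <= (b - a) Y^2, and the length cancels against the one in the inverse inequality. Only
    the test with p itself enters. *)
Lemma local_proj_bound d : exists C, 0 <= C /\
  forall p a b y Y, isP d p -> a < b -> ex_RInt (fun s => y s * p s) a b ->
    (forall s, a < s < b -> Rabs (y s) <= Y) ->
    RInt (fun s => p s * p s) a b = RInt (fun s => y s * p s) a b ->
    forall s, a <= s <= b -> Rabs (p s) <= C * Y.
Proof.
  destruct (poly_inverse_ineq d) as [C [HC H]].
  exists (sqrt C). split; [apply sqrt_pos|].
  intros p a b y Y Hp ab Ex Hy E s Hs.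
  assert (Y0 : 0 <= Y).
  { eapply Rle_trans; [apply Rabs_pos|apply (Hy ((a + b) / 2)); lra]. }
  assert (Cp : ex_RInt (fun s => p s * p s) a b).
  { apply cont_ex_RInt, (isP_mult_cont d); auto. apply (isP_cont d); auto. }
  assert (L : RInt (fun s => p s * p s) a b <= (b - a) * (Y * Y)).
  { assert (RInt (fun s => y s * p s) a b <= RInt (fun s => / 2 * (p s * p s) + / 2 * (Y * Y)) a b).
    { apply RInt_le; auto; try lra.
      - apply eRI_plus; [apply eRI_scal; auto|apply cont_ex_RInt; intros; apply cont_const].
      - intros x Hx. specialize (Hy x Hx). apply Rabs_le_between in Hy.
        assert (0 <= (y x - p x) * (y x - p x)) by apply Rle_0_sqr.
        assert (y x * y x <= Y * Y) by nra. lra. }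
    rewrite RI_plus, RI_scal, RI_const in H0; auto;
      [|apply eRI_scal; auto|apply cont_ex_RInt; intros; apply cont_const].
    lra. }
  specialize (H p a b Hp ab s Hs).
  apply Rsqr_incr_0_var; [|apply Rmult_le_pos; auto; apply sqrt_pos].
  rewrite <- Rsqr_abs. unfold Rsqr.
  replace (sqrt C * Y * (sqrt C * Y)) with (C / (b - a) * ((b - a) * (Y * Y))).
  - eapply Rle_trans; [apply H|]. apply Rmult_le_compat_l; auto.
    apply Rdiv_le_0_compat; lra.
  - replace (sqrt C * Y * (sqrt C * Y)) with (sqrt C * sqrt C * (Y * Y)) by ring.
    rewrite sqrt_sqrt by auto. field. lra.
Qed.

Lemma MVT_bound (f f' : R -> R) a b K : a <= b ->
  (forall s, a <= s <= b -> is_derive f s (f' s)) ->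
  (forall s, a <= s <= b -> Rabs (f' s) <= K) ->
  Rabs (f b - f a) <= K * (b - a).
Proof.
  intros ab Hd HK.
  destruct (MVT_gen f a b f') as [c [Hc E]]; rewrite ?Rmin_left, ?Rmax_right in * by lra.
  - intros x Hx. apply Hd; lra.
  - intros x Hx. apply continuity_pt_filterlim. apply (is_derive_cont f x (f' x)), Hd; lra.
  - rewrite E, Rabs_mult, (Rabs_right (b - a)) by lra.
    apply Rmult_le_compat_r; [lra|]. apply HK; lra.
Qed.

Lemma is_derive_minusR (f g : R -> R) s a b : is_derive f s a -> is_derive g s b ->
  is_derive (fun x => f x - g x) s (a - b).
Proof. apply (is_derive_minus (K := R_AbsRing) (V := R_NormedModule)). Qed.

Lemma is_derive_plusR (f g : R -> R) s a b : is_derive f s a -> is_derive g s b ->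
  is_derive (fun x => f x + g x) s (a + b).
Proof. apply (is_derive_plus (K := R_AbsRing) (V := R_NormedModule)). Qed.

Lemma is_derive_multR (f g : R -> R) s a b : is_derive f s a -> is_derive g s b ->
  is_derive (fun x => f x * g x) s (a * g s + f s * b).
Proof. intros H1 H2. apply (is_derive_mult f g s a b H1 H2 Rmult_comm). Qed.

Lemma is_derive_constR (c s : R) : is_derive (fun _ : R => c) s 0.
Proof. apply (is_derive_const (V := R_NormedModule)). Qed.

Lemma is_derive_scalR (f : R -> R) c s a : is_derive f s a ->
  is_derive (fun x => c * f x) s (c * a).
Proof.
  intros H. replace (c * a) with (0 * f s + c * a) by ring.
  apply is_derive_multR; auto. apply is_derive_constR.
Qed.

(** [D i] is the i-th derivative. The polynomial is a primitive of the approximant of the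
    derivative, adjusted to match at a; each integration gains a factor b - a. *)
Lemma taylor_approx (m : nat) : forall (D : nat -> R -> R) K a b, a < b ->
  (forall i, (i <= m)%nat -> forall s, is_derive (D i) s (D (S i) s)) ->
  (forall s, Rabs (D (S m) s) <= K) ->
  exists p, isP m p /\ forall s, a <= s <= b -> Rabs (D O s - p s) <= K * (b - a) ^ S m.
Proof.
  induction m as [|m IH]; intros D K a b ab HD HK.
  - exists (fun _ => D O a). split; [apply isP_const|]. intros s Hs.
    assert (K0 : 0 <= K) by (eapply Rle_trans; [apply Rabs_pos|apply (HK a)]).
    eapply Rle_trans; [apply (MVT_bound (D O) (D 1%nat) a s K); auto; lra|].
    simpl. rewrite Rmult_1_r. apply Rmult_le_compat_l; lra.
  - destruct (IH (fun i => D (S i)) K a b ab) as [p [Hp H]].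
    { intros i Hi. apply (HD (S i)). lia. }
    { apply HK. }
    assert (K0 : 0 <= K) by (eapply Rle_trans; [apply Rabs_pos|apply (HK a)]).
    destruct (isP_prim m p Hp) as [F [HF dF]].
    exists (fun s => F s + 1 * (D O a - F a)). split.
    { apply isP_plus; auto. apply isP_scal, isP_const. }
    intros s Hs.
    assert (B := MVT_bound (fun s => D O s - F s) (fun s => D 1%nat s - p s) a s
       (K * (b - a) ^ S m) ltac:(lra)).
    replace (D O s - (F s + 1 * (D O a - F a))) with (D O s - F s - (D O a - F a)) by ring.
    eapply Rle_trans; [apply B|].
    + intros x Hx. apply is_derive_minusR; auto. apply HD. lia.
    + intros x Hx. apply H. lra.
    + replace ((b - a) ^ S (S m)) with ((b - a) ^ S m * (b - a)) by (simpl; ring).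
      rewrite <- Rmult_assoc. apply Rmult_le_compat_l; [|lra].
      apply Rmult_le_pos; auto. apply pow_le; lra.
Qed.

(** * Piecewise continuous functions on the circle *)

Definition on_cells (P : partition) (Q : R -> Prop) : Prop :=
  forall j, (j < nint P)%nat -> forall s, node P j < s < node P (S j) -> Q s.

(** The function g, continuous on the whole line, encodes one-sided limits at the two ends of a
    cell; apart from periodicity the values at the nodes stay free. *)
Definition pcont (P : partition) (f : R -> R) : Prop :=
  periodic f /\ forall j, (j < nint P)%nat -> exists g : R -> R,
    (forall s, continuous g s) /\ forall s, node P j < s < node P (S j) -> f s = g s.

Definition pI (f : R -> R) : R := RInt f 0 (2 * PI).

(** A sum of n terms, empty for n = 0, in contrast to [sum_f_R0]. *)
Fixpoint csum (f : nat -> R) (n : nat) : R :=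
  match n with O => 0 | S m => csum f m + f m end.

Lemma twoPI : 0 < 2 * PI.
Proof. generalize PI_RGT_0; lra. Qed.

Lemma on_cells_imp2 P (Q1 Q2 Q : R -> Prop) : (forall s, Q1 s -> Q2 s -> Q s) ->
  on_cells P Q1 -> on_cells P Q2 -> on_cells P Q.
Proof. intros H H1 H2 j Hj s Hs. eauto. Qed.

Lemma on_cells_imp P (Q1 Q : R -> Prop) : (forall s, Q1 s -> Q s) ->
  on_cells P Q1 -> on_cells P Q.
Proof. intros H H1 j Hj s Hs. eauto. Qed.

Lemma on_cells_all P (Q : R -> Prop) : (forall s, Q s) -> on_cells P Q.
Proof. intros H j Hj s Hs. auto. Qed.

Lemma pcont_const P c : pcont P (fun _ => c).
Proof.
  split; [intros s; auto|]. intros j _. exists (fun _ => c). split; auto.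
  intros. apply cont_const.
Qed.

Lemma pcont_op2 P (op : R -> R -> R) f g :
  (forall (u v : R -> R) s, continuous u s -> continuous v s -> continuous (fun x => op (u x) (v x)) s) ->
  pcont P f -> pcont P g -> pcont P (fun s => op (f s) (g s)).
Proof.
  intros Hop [Pf Hf] [Pg Hg]. split.
  - intros s. rewrite Pf, Pg. auto.
  - intros j Hj. destruct (Hf j Hj) as [u [Cu Eu]], (Hg j Hj) as [v [Cv Ev]].
    exists (fun s => op (u s) (v s)). split; auto.
    intros s Hs. rewrite Eu, Ev; auto.
Qed.

Lemma pcont_plus P f g : pcont P f -> pcont P g -> pcont P (fun s => f s + g s).
Proof. apply (pcont_op2 P Rplus). intros; apply cont_plus; auto. Qed.

Lemma pcont_mult P f g : pcont P f -> pcont P g -> pcont P (fun s => f s * g s).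
Proof. apply (pcont_op2 P Rmult). intros; apply cont_mult; auto. Qed.

Lemma pcont_minus P f g : pcont P f -> pcont P g -> pcont P (fun s => f s - g s).
Proof. apply (pcont_op2 P Rminus). intros; apply cont_minus; auto. Qed.

Lemma pcont_opp P f : pcont P f -> pcont P (fun s => - f s).
Proof. intros H. apply (pcont_op2 P (fun a _ => - a) f f); auto. intros; apply cont_opp; auto. Qed.

Lemma pcont_abs P f : pcont P f -> pcont P (fun s => Rabs (f s)).
Proof.
  intros H. apply (pcont_op2 P (fun a _ => Rabs a) f f); auto.
  intros u _ s Hu _. apply (continuous_comp u Rabs); auto. apply continuous_Rabs.
Qed.

Lemma pcont_cont P f : periodic f -> (forall s, continuous f s) -> pcont P f.
Proof. intros Hp Hc. split; auto. intros j _. exists f. auto. Qed.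

Lemma pcont_ext P f g : periodic g -> on_cells P (fun s => f s = g s) ->
  pcont P f -> pcont P g.
Proof.
  intros Pg E [_ H]. split; auto. intros j Hj. destruct (H j Hj) as [u [Cu Eu]].
  exists u. split; auto. intros s Hs. rewrite <- Eu, (E j Hj s Hs); auto.
Qed.

Lemma pcont_ex_cell P f j : (j < nint P)%nat -> pcont P f ->
  ex_RInt f (node P j) (node P (S j)).
Proof.
  intros Hj [_ H]. destruct (H j Hj) as [g [Cg E]].
  apply (ex_RInt_ext g); [|apply cont_ex_RInt; auto].
  assert (N := node_incr P j Hj). intros x Hx.
  rewrite Rmin_left, Rmax_right in Hx by lra. symmetry; auto.
Qed.

Lemma node_le P i j : (i <= j <= nint P)%nat -> node P i <= node P j.
Proof.
  intros [H Hj]. induction H as [|j H IH]; [lra|].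
  assert (N := node_incr P j ltac:(lia)). specialize (IH ltac:(lia)). lra.
Qed.

Lemma pcont_csum P f j : (j <= nint P)%nat -> pcont P f ->
  ex_RInt f (node P 0) (node P j) /\
  RInt f (node P 0) (node P j) = csum (fun i => RInt f (node P i) (node P (S i))) j.
Proof.
  intros Hj Hf. induction j as [|j IH].
  - split; [apply ex_RInt_point|]. rewrite RInt_point. reflexivity.
  - destruct IH as [IH1 IH2]; [lia|].
    assert (E := pcont_ex_cell P f j ltac:(lia) Hf). split.
    + eapply ex_RInt_Chasles; eauto.
    + rewrite (RI_Chasles _ _ (node P j)); auto. simpl. rewrite <- IH2. auto.
Qed.

Lemma nint_pos P : (0 < nint P)%nat.
Proof.
  destruct (nint P) eqn:E; [|lia]. assert (H := node_period P). rewrite E in H.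
  generalize twoPI; lra.
Qed.

Lemma periodic_shift_ex (f : R -> R) a b : periodic f -> ex_RInt f a b ->
  ex_RInt f (a + 2 * PI) (b + 2 * PI) /\ RInt f (a + 2 * PI) (b + 2 * PI) = RInt f a b.
Proof.
  intros Pf Ex.
  assert (E : forall y, 1 * f (1 * y + - (2 * PI)) = f y).
  { intros y. rewrite <- (Pf (1 * y + - (2 * PI))). rewrite Rmult_1_l. f_equal. ring. }
  assert (Ea : forall a, 1 * (a + 2 * PI) + - (2 * PI) = a) by (intros; ring).
  split.
  - apply (ex_RInt_ext (fun y => 1 * f (1 * y + - (2 * PI)))); [intros; auto|].
    apply (ex_RInt_comp_lin (V := R_NormedModule)). rewrite !Ea. auto.
  - assert (H := RInt_comp_lin (V := R_CompleteNormedModule) f 1 (- (2 * PI)) (a + 2 * PI) (b + 2 * PI)).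
    rewrite !Ea in H. rewrite <- H by auto.
    apply (RInt_ext (V := R_CompleteNormedModule)). intros x _. symmetry. apply E.
Qed.

Lemma periodic_shift_ex_neg (f : R -> R) a b : periodic f -> ex_RInt f (a + 2 * PI) (b + 2 * PI) ->
  ex_RInt f a b.
Proof.
  intros Pf Ex.
  apply (ex_RInt_ext (fun y => 1 * f (1 * y + 2 * PI))).
  - intros x _. rewrite !Rmult_1_l. apply Pf.
  - apply (ex_RInt_comp_lin (V := R_NormedModule)). rewrite !Rmult_1_l. auto.
Qed.

(** The cells cover one period only. Its translates give integrability over n periods to either side
    of the first node, and every interval lies inside such a range. *)
Lemma pcont_ex P f a b : pcont P f -> ex_RInt f a b.
Proof.
  intros Hf. destruct (pcont_csum P f (nint P) ltac:(lia) Hf) as [Ex _].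
  assert (Pf := proj1 Hf). set (c := node P 0) in *. rewrite node_period in Ex. fold c in Ex.
  assert (E1 : forall n, ex_RInt f c (c + INR n * (2 * PI))).
  { induction n as [|n IH]; [simpl; replace (c + 0 * (2 * PI)) with c by ring; apply ex_RInt_point|].
    apply ex_RInt_Chasles with (1 := Ex).
    replace (c + INR (S n) * (2 * PI)) with (c + INR n * (2 * PI) + 2 * PI) by (rewrite S_INR; ring).
    apply periodic_shift_ex; auto. }
  assert (E2 : forall n, ex_RInt f (c - INR n * (2 * PI)) c).
  { induction n as [|n IH]; [simpl; replace (c - 0 * (2 * PI)) with c by ring; apply ex_RInt_point|].
    apply ex_RInt_Chasles with (c - 2 * PI).
    - apply periodic_shift_ex_neg; auto.
      replace (c - INR (S n) * (2 * PI) + 2 * PI) with (c - INR n * (2 * PI)) by (rewrite S_INR; ring).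
      replace (c - 2 * PI + 2 * PI) with c by ring. auto.
    - apply periodic_shift_ex_neg; auto. replace (c - 2 * PI + 2 * PI) with c by ring. auto. }
  assert (N : forall x, exists n, c - INR n * (2 * PI) <= x <= c + INR n * (2 * PI)).
  { intros x. destruct (INR_archimed (2 * PI) (Rabs (x - c)) twoPI) as [n Hn].
    exists n. assert (H := Rle_abs (x - c)). assert (H' := Rle_abs (- (x - c))).
    rewrite Rabs_Ropp in H'. lra. }
  assert (E3 : forall x, ex_RInt f c x).
  { intros x. destruct (N x) as [n Hn]. destruct (Rle_dec c x).
    - apply (ex_RInt_Chasles_1 f c x (c + INR n * (2 * PI))); auto; lra.
    - apply ex_RInt_swap.
      apply (ex_RInt_Chasles_2 f (c - INR n * (2 * PI)) x c); auto; lra. }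
  apply ex_RInt_Chasles with c; auto. apply ex_RInt_swap. auto.
Qed.

(** The nodes need not start at 0, so a sum over the cells computes the integral over a shifted
    period. *)
Lemma I_period P f c : pcont P f -> pI f = RInt f c (c + 2 * PI).
Proof.
  intros Hf. unfold pI.
  assert (Ex := fun a b => pcont_ex P f a b Hf).
  destruct (periodic_shift_ex f 0 c (proj1 Hf) (Ex _ _)) as [_ E].
  rewrite Rplus_0_l in E.
  rewrite (RI_Chasles f c (2 * PI)), (RI_Chasles f 0 c), E; auto.
  rewrite (RI_Chasles f c 0 (2 * PI)), (RI_Chasles f 0 c (2 * PI)) by auto.
  assert (S := RI_Chasles f c 0 c (Ex _ _) (Ex _ _)). rewrite RI_point in S. lra.
Qed.

Lemma I_csum P f : pcont P f ->
  pI f = csum (fun i => RInt f (node P i) (node P (S i))) (nint P).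
Proof.
  intros Hf. rewrite (I_period P f (node P 0)) by auto.
  rewrite <- node_period. apply pcont_csum; auto.
Qed.

Lemma csum_ext f g n : (forall i, (i < n)%nat -> f i = g i) -> csum f n = csum g n.
Proof. induction n; simpl; intros H; auto. rewrite IHn, H by auto. auto. Qed.

Lemma csum_le f g n : (forall i, (i < n)%nat -> f i <= g i) -> csum f n <= csum g n.
Proof.
  induction n as [|n IH]; simpl; intros H; [lra|].
  assert (H1 := H n ltac:(lia)). assert (H2 := IH (fun i Hi => H i ltac:(lia))). lra.
Qed.

Lemma csum_0 n : csum (fun _ => 0) n = 0.
Proof. induction n; simpl; lra. Qed.

Lemma csum_nonneg_0 f n : (forall i, (i < n)%nat -> 0 <= f i) -> csum f n = 0 ->
  forall i, (i < n)%nat -> f i = 0.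
Proof.
  induction n as [|n IH]; intros H E i Hi; [lia|]. simpl in E.
  assert (0 <= csum f n).
  { rewrite <- (csum_0 n). apply csum_le. intros; apply H; lia. }
  assert (H1 := H n ltac:(lia)).
  destruct (Nat.eq_dec i n) as [->|]; [lra|].
  apply IH; auto; try lia. lra.
Qed.

Lemma csum_single f n j : (j < n)%nat -> (forall i, (i < n)%nat -> i <> j -> f i = 0) ->
  csum f n = f j.
Proof.
  induction n as [|n IH]; intros Hj H; [lia|]. simpl.
  destruct (Nat.eq_dec j n) as [->|].
  - rewrite (csum_ext f (fun _ => 0)), csum_0; [lra|]. intros i Hi. apply H; lia.
  - rewrite IH, (H n); try lia; [lra|]. intros; apply H; lia.
Qed.

Lemma I_ext P f g : pcont P f -> pcont P g -> on_cells P (fun s => f s = g s) -> pI f = pI g.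
Proof.
  intros Hf Hg E. rewrite !(I_csum P) by auto. apply csum_ext. intros i Hi.
  assert (N := node_incr P i Hi). apply RI_ext; [lra|]. apply E; auto.
Qed.

Lemma I_le P f g : pcont P f -> pcont P g -> on_cells P (fun s => f s <= g s) -> pI f <= pI g.
Proof.
  intros Hf Hg E. rewrite !(I_csum P) by auto. apply csum_le. intros i Hi.
  assert (N := node_incr P i Hi). apply RInt_le; try lra.
  - apply pcont_ex_cell; auto.
  - apply pcont_ex_cell; auto.
  - apply E; auto.
Qed.

Lemma I_plus P f g : pcont P f -> pcont P g -> pI (fun s => f s + g s) = pI f + pI g.
Proof. intros. apply RI_plus; apply (pcont_ex P); auto. Qed.

Lemma I_minus P f g : pcont P f -> pcont P g -> pI (fun s => f s - g s) = pI f - pI g.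
Proof. intros. apply RI_minus; apply (pcont_ex P); auto. Qed.

Lemma I_scal P c f : pcont P f -> pI (fun s => c * f s) = c * pI f.
Proof. intros. apply RI_scal; apply (pcont_ex P); auto. Qed.

Lemma I_const c : pI (fun _ => c) = c * (2 * PI).
Proof. unfold pI. rewrite RI_const. ring. Qed.

Lemma I_ge0 P f : pcont P f -> on_cells P (fun s => 0 <= f s) -> 0 <= pI f.
Proof.
  intros Hf H. replace 0 with (pI (fun _ => 0)) by (rewrite I_const; ring).
  apply (I_le P); auto. apply pcont_const.
Qed.

Lemma I_sq_0 P f : pcont P f -> pI (fun s => f s * f s) = 0 ->
  on_cells P (fun s => f s = 0).
Proof.
  intros Hf E j Hj s Hs. rewrite (I_csum P) in E by (apply pcont_mult; auto).
  assert (N := node_incr P j Hj).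
  apply csum_nonneg_0 with (i := j) in E; auto.
  - destruct (proj2 Hf j Hj) as [g [Cg Eg]]. rewrite Eg by auto.
    apply (RInt_sq_0 g (node P j) (node P (S j))); auto; [|lra].
    rewrite <- E. apply RI_ext; [lra|]. intros x Hx. rewrite Eg; auto.
  - intros i Hi. assert (N' := node_incr P i Hi).
    apply RInt_ge0; [lra| |intros; nra]. apply pcont_ex_cell; auto. apply pcont_mult; auto.
Qed.

(** Continuous and piecewise C^1, with f' as weak derivative. The notion covers finite element
    functions, smooth functions and their products, so that one integration by parts serves them
    all. *)
Record pc1 (P : partition) (f f' : R -> R) : Prop := Pc1 {
  pc1_per : periodic f;
  pc1_cont : forall s, continuous f s;
  pc1_pcont : pcont P f';
  pc1_deriv : on_cells P (fun s => is_derive f s (f' s))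
}.

Lemma pc1_pcont0 P f f' : pc1 P f f' -> pcont P f.
Proof. intros []. apply pcont_cont; auto. Qed.

Lemma pc1_plus P f f' g g' : pc1 P f f' -> pc1 P g g' ->
  pc1 P (fun s => f s + g s) (fun s => f' s + g' s).
Proof.
  intros [A1 A2 A3 A4] [B1 B2 B3 B4]. split.
  - intros s. rewrite A1, B1. auto.
  - intros; apply cont_plus; auto.
  - apply pcont_plus; auto.
  - eapply on_cells_imp2; [|apply A4|apply B4]. intros s. apply is_derive_plusR.
Qed.

Lemma pc1_mult P f f' g g' : pc1 P f f' -> pc1 P g g' ->
  pc1 P (fun s => f s * g s) (fun s => f' s * g s + f s * g' s).
Proof.
  intros HA HB. assert (C1 := pc1_pcont0 _ _ _ HA). assert (C2 := pc1_pcont0 _ _ _ HB).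
  destruct HA as [A1 A2 A3 A4], HB as [B1 B2 B3 B4]. split.
  - intros s. rewrite A1, B1. auto.
  - intros; apply cont_mult; auto.
  - apply pcont_plus; apply pcont_mult; auto.
  - eapply on_cells_imp2; [|apply A4|apply B4]. intros s. apply is_derive_multR.
Qed.

Lemma pc1_scal P c f f' : pc1 P f f' -> pc1 P (fun s => c * f s) (fun s => c * f' s).
Proof.
  intros HA. destruct HA as [A1 A2 A3 A4]. split.
  - intros s. rewrite A1. auto.
  - intros; apply cont_mult; auto using cont_const.
  - apply pcont_mult; auto using pcont_const.
  - eapply on_cells_imp; [|apply A4]. intros s. apply is_derive_scalR.
Qed.

Lemma pc1_minus P f f' g g' : pc1 P f f' -> pc1 P g g' ->
  pc1 P (fun s => f s - g s) (fun s => f' s - g' s).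
Proof.
  intros [A1 A2 A3 A4] [B1 B2 B3 B4]. split.
  - intros s. rewrite A1, B1. auto.
  - intros; apply cont_minus; auto.
  - apply pcont_minus; auto.
  - eapply on_cells_imp2; [|apply A4|apply B4]. intros s. apply is_derive_minusR.
Qed.

Lemma pc1_smooth P (f f' : R -> R) : periodic f -> periodic f' ->
  (forall s, is_derive f s (f' s)) -> (forall s, continuous f' s) -> pc1 P f f'.
Proof.
  intros H1 H2 H3 H4. split; auto.
  - intros s. apply (is_derive_cont f s (f' s)); auto.
  - apply pcont_cont; auto.
  - apply on_cells_all; auto.
Qed.

(** The derivative may fail to exist at the ends of the cell. The mean value theorem is therefore
    applied to f minus the integral of the continuous extension g, which has zero derivative inside
    the cell. *)
Lemma pc1_FTC_cell P f f' j x : pc1 P f f' -> (j < nint P)%nat ->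
  node P j <= x <= node P (S j) -> RInt f' (node P j) x = f x - f (node P j).
Proof.
  intros [A1 A2 A3 A4] Hj Hx. set (a := node P j) in *. set (b := node P (S j)) in *.
  destruct (proj2 A3 j Hj) as [g [Cg Eg]].
  assert (Eg' : RInt f' a x = RInt g a x).
  { apply RI_ext; [lra|]. intros s Hs. apply Eg. fold a b; lra. }
  rewrite Eg'.
  assert (DG : forall y, is_derive (RInt g a) y (g y)).
  { intros y. apply (is_derive_RInt (V := R_NormedModule) g (RInt g a) a y); auto.
    apply filter_forall. intros z. apply (RInt_correct (V := R_CompleteNormedModule)).
    apply cont_ex_RInt; auto. }
  destruct (MVT_gen (fun y => f y - RInt g a y) a x (fun _ => 0)) as [c [_ E]].
  - intros y Hy. rewrite Rmin_left, Rmax_right in Hy by lra.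
    replace 0 with (g y - g y) by ring. apply is_derive_minusR; auto.
    rewrite <- Eg by (fold a b; lra). apply (A4 j Hj). fold a b; lra.
  - intros y Hy. apply continuity_pt_filterlim. apply cont_minus; auto.
    apply (is_derive_cont _ y (g y)); auto.
  - rewrite RI_point in E. lra.
Qed.

Lemma pc1_FTC P f f' x : pc1 P f f' -> node P 0 <= x <= node P (nint P) ->
  RInt f' (node P 0) x = f x - f (node P 0).
Proof.
  intros H Hx.
  assert (Ex := fun a b => pcont_ex P f' a b (pc1_pcont _ _ _ H)).
  assert (A : forall j, (j <= nint P)%nat -> RInt f' (node P 0) (node P j) = f (node P j) - f (node P 0)).
  { induction j as [|j IH]; intros Hj.
    - rewrite RI_point. lra.
    - rewrite (RI_Chasles _ _ (node P j)), IH, (pc1_FTC_cell P f f' j) by (auto; try lia;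
        generalize (node_incr P j ltac:(lia)); lra). lra. }
  assert (B : forall n, (n < nint P)%nat -> node P 0 <= x <= node P (S n) ->
     exists j, (j < nint P)%nat /\ node P j <= x <= node P (S j)).
  { induction n as [|n IH]; intros Hn Hx'; [exists O; auto|].
    destruct (Rle_dec x (node P (S n))) as [L|L].
    - apply IH; [lia|lra].
    - exists (S n). split; auto. lra. }
  destruct (B (pred (nint P))) as [j [Hj Hxj]].
  - generalize (nint_pos P); lia.
  - replace (S (pred (nint P))) with (nint P) by (generalize (nint_pos P); lia). auto.
  - rewrite (RI_Chasles _ _ (node P j)), A, (pc1_FTC_cell P f f' j) by (auto; lia). lra.
Qed.

Lemma pc1_I_0 P f f' : pc1 P f f' -> pI f' = 0.
Proof.
  intros H. rewrite (I_period P f' (node P 0)) by apply H.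
  rewrite <- node_period, (pc1_FTC P f f'); auto.
  - rewrite node_period, (pc1_per _ _ _ H). ring.
  - rewrite node_period. generalize twoPI; lra.
Qed.

Lemma pc1_ibp P f f' g g' : pc1 P f f' -> pc1 P g g' ->
  pI (fun s => f' s * g s) = - pI (fun s => f s * g' s).
Proof.
  intros Hf Hg. assert (E := pc1_I_0 _ _ _ (pc1_mult _ _ _ _ _ Hf Hg)).
  rewrite (I_plus P) in E; [lra| |]; apply pcont_mult;
    eauto using pc1_pcont0, pc1_pcont.
Qed.

(** * Reduction to one period and the Sobolev bound *)

Lemma period_repr (c x : R) : exists m : Z, c <= x - IZR m * (2 * PI) < c + 2 * PI.
Proof.
  assert (T := twoPI). exists (Int_part ((x - c) / (2 * PI))).
  destruct (base_Int_part ((x - c) / (2 * PI))) as [H1 H2].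
  set (m := IZR (Int_part _)) in *.
  assert (E : x - c = (x - c) / (2 * PI) * (2 * PI)) by (field; apply PI_neq0).
  set (q := (x - c) / (2 * PI)) in *.
  assert (0 <= (q - m) * (2 * PI)) by (apply Rmult_le_pos; lra).
  assert (0 < (1 - (q - m)) * (2 * PI)) by (apply Rmult_lt_0_compat; lra). lra.
Qed.

Lemma periodic_nat {E} (f : R -> E) : periodic f -> forall n x, f (x + INR n * (2 * PI)) = f x.
Proof.
  intros H. induction n as [|n IH]; intros x; [simpl; f_equal; ring|].
  rewrite S_INR. replace (x + (INR n + 1) * (2 * PI)) with (x + INR n * (2 * PI) + 2 * PI) by ring.
  rewrite H. auto.
Qed.

Lemma periodic_Z {E} (f : R -> E) : periodic f -> forall m x, f (x - IZR m * (2 * PI)) = f x.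
Proof.
  intros H m x. destruct (ZArith_dec.Z_le_gt_dec 0 m).
  - rewrite <- (periodic_nat f H (Z.to_nat m)). rewrite INR_IZR_INZ, Znat.Z2Nat.id by auto.
    f_equal. ring.
  - rewrite <- (periodic_nat f H (Z.to_nat (- m)) x). rewrite INR_IZR_INZ, Znat.Z2Nat.id by lia.
    rewrite opp_IZR. f_equal. ring.
Qed.

(** Sobolev embedding of H^1 into the bounded functions. With F = f^2 one has |F'| <= f^2 + f'^2, so
    F(x) - F(y) is at most the integral of the latter; averaging over y in one period gives the
    factor 1 + 1/(2 pi) <= 2. *)
Lemma pc1_sup P f f' : pc1 P f f' ->
  forall x, f x * f x <= 2 * pI (fun s => f s * f s + f' s * f' s).
Proof.
  intros H x. set (c := node P 0).
  destruct (period_repr c x) as [m Hm].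
  rewrite <- (periodic_Z f (pc1_per _ _ _ H) m x).
  set (x' := x - IZR m * (2 * PI)) in *.
  assert (H2 := pc1_mult _ _ _ _ _ H H).
  set (F := fun s => f s * f s) in *. set (F' := fun s => f' s * f s + f s * f' s) in *.
  assert (C0 := pc1_pcont0 _ _ _ H). assert (C1 := pc1_pcont _ _ _ H).
  set (g := fun s => f s * f s + f' s * f' s).
  assert (Cg : pcont P g) by (apply pcont_plus; apply pcont_mult; auto).
  assert (Ex := fun a b => pcont_ex P g a b Cg).
  assert (Ex' := fun a b => pcont_ex P F' a b (pc1_pcont _ _ _ H2)).
  assert (Np := node_period P). fold c in Np.
  assert (g0 : forall s, 0 <= g s) by (intros; unfold g; nra).
  assert (W : forall a b, c <= a <= b -> b <= c + 2 * PI -> RInt g a b <= pI g).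
  { intros a b Ha Hb. rewrite (I_period P g c) by auto.
    rewrite (RI_Chasles g c a (c + 2 * PI)), (RI_Chasles g a b (c + 2 * PI)) by auto.
    assert (0 <= RInt g c a) by (apply RInt_ge0; auto; lra).
    assert (0 <= RInt g b (c + 2 * PI)) by (apply RInt_ge0; auto; lra). lra. }
  assert (K : forall y, c <= y < c + 2 * PI -> F x' - F y <= pI g).
  { intros y Hy.
    assert (E1 := pc1_FTC P F F' x' H2 ltac:(rewrite Np; fold c; lra)).
    assert (E2 := pc1_FTC P F F' y H2 ltac:(rewrite Np; fold c; lra)).
    fold c in E1, E2.
    assert (Bd : forall s, - g s <= F' s <= g s).
    { intros s. unfold g, F'. assert (0 <= (f s - f' s) * (f s - f' s)) by apply Rle_0_sqr.
      assert (0 <= (f s + f' s) * (f s + f' s)) by apply Rle_0_sqr. lra. }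
    destruct (Rle_dec y x') as [L|L].
    - rewrite (RI_Chasles F' c y x') in E1 by auto.
      assert (RInt F' y x' <= RInt g y x') by (apply RInt_le; auto; intros; apply Bd).
      specialize (W y x' ltac:(lra) ltac:(lra)). lra.
    - rewrite (RI_Chasles F' c x' y) in E2 by auto.
      assert (RInt (fun s => -1 * g s) x' y <= RInt F' x' y).
      { apply RInt_le; auto; [lra|apply eRI_scal; auto|]. intros s _. specialize (Bd s). lra. }
      rewrite RI_scal in H0 by auto.
      specialize (W x' y ltac:(lra) ltac:(lra)). lra. }
  assert (CF : pcont P F) by (apply (pc1_pcont0 _ _ _ H2)).
  assert (A : F x' * (2 * PI) <= pI (fun s => F s + pI g)).
  { rewrite <- I_const. rewrite (I_period P (fun s => F s + pI g) c) by (apply pcont_plus; auto using pcont_const).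
    rewrite (I_period P _ c) by apply pcont_const. generalize twoPI; intros.
    apply RInt_le; try lra.
    - apply (pcont_ex P), pcont_const.
    - apply (pcont_ex P), pcont_plus; auto using pcont_const.
    - intros y Hy. specialize (K y ltac:(lra)). lra. }
  rewrite (I_plus P), I_const in A; auto using pcont_const.
  assert (pI F <= pI g).
  { apply (I_le P); auto. apply on_cells_all. intros s. unfold F, g. nra. }
  assert (3 < PI) by (generalize PI2_3_2; unfold PI2; lra).
  assert (0 <= pI g) by (apply (I_ge0 P); auto; apply on_cells_all; auto).
  change (F x' <= 2 * pI g). nra.
Qed.

(** * The finite element space *)

Lemma locally_between (a b s : R) (Q : R -> Prop) : a < s < b ->
  (forall y, a < y < b -> Q y) -> locally s Q.
Proof.
  intros Hs H. assert (Hd : 0 < Rmin (s - a) (b - s)) by (apply Rmin_glb_lt; lra).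
  exists (mkposreal _ Hd). intros y Hy. change (Rabs (y - s) < Rmin (s - a) (b - s)) in Hy.
  assert (H0 : Rabs (y - s) < s - a) by (eapply Rlt_le_trans; [exact Hy|apply Rmin_l]).
  assert (H1 : Rabs (y - s) < b - s) by (eapply Rlt_le_trans; [exact Hy|apply Rmin_r]).
  apply Rabs_def2 in H0. apply Rabs_def2 in H1. apply H. lra.
Qed.

Lemma is_derive_cell (f g : R -> R) a b s l :
  (forall s, a <= s <= b -> f s = g s) -> a < s < b ->
  is_derive g s l -> is_derive f s l.
Proof.
  intros E Hs D. apply (is_derive_ext_loc g); auto.
  apply (locally_between a b); auto. intros y Hy. symmetry. apply E. lra.
Qed.

Lemma Derive_periodic (f : R -> R) : periodic f -> periodic (Derive f).
Proof.
  intros H s. unfold Derive. f_equal. apply Lim_ext. intros h.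
  replace (s + 2 * PI + h) with (s + h + 2 * PI) by ring. rewrite !H. auto.
Qed.

Lemma fe_isP k P f j : fe_scalar k P f -> (j < nint P)%nat ->
  exists p, isP k p /\ forall s, node P j <= s <= node P (S j) -> f s = p s.
Proof.
  intros [_ [_ H]] Hj. destruct (H j Hj) as [a Ha].
  exists (fun s => sum_f_R0 (fun i => a i * s ^ i) k). split; auto. exists a. auto.
Qed.

Lemma fe_intro k P f : periodic f -> (forall s, continuous f s) ->
  (forall j, (j < nint P)%nat -> exists p, isP k p /\
     forall s, node P j <= s <= node P (S j) -> f s = p s) -> fe_scalar k P f.
Proof.
  intros H1 H2 H3. repeat split; auto. intros j Hj.
  destruct (H3 j Hj) as [p [[a Ha] E]]. exists a. intros s Hs. rewrite E; auto.
Qed.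

Lemma fe_comb k P v c w : fe_scalar k P v -> fe_scalar k P w ->
  fe_scalar k P (fun s => v s + c * w s).
Proof.
  intros Hv Hw. apply fe_intro.
  - intros s. rewrite (proj1 Hv), (proj1 Hw). auto.
  - intros s. apply cont_plus; [apply Hv|]. apply cont_mult; [apply cont_const|apply Hw].
  - intros j Hj. destruct (fe_isP _ _ _ j Hv Hj) as [p [Hp E]], (fe_isP _ _ _ j Hw Hj) as [q [Hq F]].
    exists (fun s => p s + c * q s). split; [apply isP_comb; auto|].
    intros s Hs. rewrite E, F; auto.
Qed.

Lemma fe_const k P c : fe_scalar k P (fun _ => c).
Proof.
  apply fe_intro; [intros s; auto|intros; apply cont_const|].
  intros j Hj. exists (fun _ => c). split; auto. apply isP_const.
Qed.

Lemma fe_derive_cell k P f j : fe_scalar k P f -> (j < nint P)%nat ->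
  exists q, isP (pred k) q /\ forall s, node P j < s < node P (S j) -> is_derive f s (q s).
Proof.
  intros H Hj. destruct (fe_isP _ _ _ j H Hj) as [p [Hp E]].
  destruct (isP_derive _ _ Hp) as [q [Hq D]]. exists q. split; auto.
  intros s Hs. apply (is_derive_cell f p (node P j) (node P (S j))); auto.
Qed.

Lemma fe_pc1 k P f : fe_scalar k P f -> pc1 P f (Derive f).
Proof.
  intros H. split; try apply H.
  - split; [apply Derive_periodic, H|]. intros j Hj.
    destruct (fe_derive_cell _ _ _ j H Hj) as [q [Hq D]]. exists q. split.
    + apply (isP_cont _ _ Hq).
    + intros s Hs. apply is_derive_unique; auto.
  - intros j Hj s Hs. destruct (fe_derive_cell _ _ _ j H Hj) as [q [Hq D]].
    apply Derive_correct. exists (q s). auto.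
Qed.

Lemma pc1_const_of_zero P f f' : pc1 P f f' -> on_cells P (fun s => f' s = 0) ->
  forall x, f x = f (node P 0).
Proof.
  intros H Z x. destruct (period_repr (node P 0) x) as [m Hm].
  rewrite <- (periodic_Z f (pc1_per _ _ _ H) m x). set (y := x - _) in *.
  assert (B : forall n, (n < nint P)%nat -> node P 0 <= y <= node P (S n) -> f y = f (node P 0)).
  { assert (C : forall j z, (j < nint P)%nat -> node P j <= z <= node P (S j) -> f z = f (node P j)).
    { intros j z Hj Hz. assert (E := pc1_FTC_cell P f f' j z H Hj Hz).
      rewrite (RI_ext _ (fun _ => 0)), RI_const in E; [lra|lra|].
      intros s Hs. apply (Z j); auto. lra. }
    assert (C0 : forall j, (j <= nint P)%nat -> f (node P j) = f (node P 0)).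
    { induction j as [|j IH]; intros Hj; auto. rewrite <- IH by lia.
      apply C; [lia|]. generalize (node_incr P j Hj); lra. }
    induction n as [|n IH]; intros Hn Hy; [apply C; auto|].
    destruct (Rle_dec y (node P (S n))); [apply IH; [lia|lra]|].
    rewrite <- (C0 (S n)) by lia. apply C; auto. lra. }
  apply (B (pred (nint P))); [generalize (nint_pos P); lia|].
  replace (S (pred (nint P))) with (nint P) by (generalize (nint_pos P); lia).
  rewrite node_period. lra.
Qed.

(** * Gluing polynomial pieces into finite element functions *)

Lemma cont_Rmax (f : R -> R) c s : continuous f s -> continuous (fun x => Rmax (f x) c) s.
Proof.
  intros H. apply (continuous_ext (fun x => (f x + c + Rabs (f x - c)) * / 2)).
  - intros x. unfold Rmax, Rabs. destruct Rle_dec, Rcase_abs; lra.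
  - apply cont_mult; [|apply cont_const]. apply cont_plus.
    + apply cont_plus; auto using cont_const.
    + apply (continuous_comp (fun x => f x - c) Rabs); [|apply continuous_Rabs].
      apply cont_minus; auto using cont_const.
Qed.

Lemma cont_Rmin (f : R -> R) c s : continuous f s -> continuous (fun x => Rmin (f x) c) s.
Proof.
  intros H. apply (continuous_ext (fun x => - Rmax (- f x) (- c))).
  - intros x. unfold Rmax, Rmin. destruct Rle_dec, Rle_dec; lra.
  - apply cont_opp, cont_Rmax, cont_opp; auto.
Qed.

Lemma periodic_extension (g : R -> R) c : (forall s, continuous g s) ->
  g (c + 2 * PI) = g c ->
  exists v, periodic v /\ (forall s, continuous v s) /\
    forall s, c <= s <= c + 2 * PI -> v s = g s.
Proof.
  intros Cg Eg. assert (TP := twoPI). set (T := 2 * PI) in *.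
  set (ip := fun x => Int_part ((x - c) / T)).
  set (v := fun x => g (x - IZR (ip x) * T)).
  assert (V : forall m x, c <= x - IZR m * T < c + T -> v x = g (x - IZR m * T)).
  { intros m x Hm. unfold v. replace (ip x) with m; auto. unfold ip.
    destruct (base_Int_part ((x - c) / T)) as [H1 H2].
    set (q := (x - c) / T) in *.
    assert (Eq : x - c = q * T) by (unfold q; field; lra).
    assert (IZR m <= q) by (apply (Rmult_le_reg_r T); lra).
    assert (q < IZR m + 1) by (apply (Rmult_lt_reg_r T); lra).
    assert (m < Int_part q + 1)%Z by (apply lt_IZR; rewrite plus_IZR; lra).
    assert (Int_part q < m + 1)%Z by (apply lt_IZR; rewrite plus_IZR; lra).
    lia. }
  assert (Rep : forall x, exists m : Z, c <= x - IZR m * T < c + T) by (intros; apply period_repr).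
  exists v. split; [|split].
  - intros x. destruct (Rep x) as [m Hm]. rewrite (V m x) by auto.
    fold T. rewrite (V (m + 1)%Z (x + T)); rewrite plus_IZR; [f_equal; ring|].
    lra.
  - intros x. destruct (Rep x) as [m Hm].
    set (a := IZR m * T) in *.
    (* One continuous formula on both sides of the seam c + a: to its right the second term is g(c +
       T) = g(c), to its left the first term is g(c), and -g(c) removes it. *)
    apply (continuous_ext_loc _ (fun y => g (Rmax (y - a) c) + g (Rmin (y - a + T) (c + T)) - g c)).
    + apply (locally_between (c + a - T) (c + a + T)); [lra|]. intros y Hy.
      destruct (Rle_dec (c + a) y).
      * rewrite (V m y) by (fold a; lra). fold a.
        rewrite Rmax_left, Rmin_right by lra. rewrite Eg. lra.
      * rewrite (V (m - 1)%Z y) by (rewrite minus_IZR, Rmult_minus_distr_r; fold a; lra).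
        rewrite minus_IZR, Rmult_minus_distr_r. fold a.
        rewrite Rmax_right, Rmin_left by lra.
        replace (y - (a - 1 * T)) with (y - a + T) by ring. lra.
    + assert (C1 : continuous (fun y => y - a) x) by (apply cont_minus; auto using cont_id, cont_const).
      apply cont_minus; [|apply cont_const]. apply cont_plus.
      * apply (continuous_comp (fun y => Rmax (y - a) c) g); auto. apply cont_Rmax; auto.
      * apply (continuous_comp (fun y => Rmin (y - a + T) (c + T)) g); auto. apply cont_Rmin.
        apply cont_plus; auto using cont_const.
  - intros s Hs. destruct (Rle_lt_or_eq_dec s (c + T)) as [L|L]; [lra| |].
    + rewrite (V 0%Z s) by lra. f_equal. ring.
    + rewrite (V 1%Z s) by lra. subst s. rewrite Eg. f_equal. ring.
Qed.

Lemma fe_glue k P (p : nat -> R -> R) :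
  (forall j, (j < nint P)%nat -> isP k (p j)) ->
  (forall j, (S j < nint P)%nat -> p j (node P (S j)) = p (S j) (node P (S j))) ->
  p (pred (nint P)) (node P (nint P)) = p O (node P 0) ->
  exists v, fe_scalar k P v /\
    forall j, (j < nint P)%nat -> forall s, node P j <= s <= node P (S j) -> v s = p j s.
Proof.
  intros Hp Hm Hper.
  assert (G : forall n, (n < nint P)%nat -> exists g : R -> R, (forall s, continuous g s) /\
     (forall j, (j <= n)%nat -> forall s, node P j <= s <= node P (S j) -> g s = p j s) /\
     (forall s, node P n <= s -> g s = p n s)).
  { induction n as [|n IH]; intros Hn.
    - exists (p O). split; [apply (isP_cont k); auto|]. split; auto.
      intros j Hj s _. replace j with O by lia. auto.
    - destruct (IH ltac:(lia)) as [g [Cg [Eg Eg']]].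
      (* To the left of the node the added difference is evaluated at the node, where it vanishes by
         matching; to the right it replaces p_n by p_(n+1). *)
      exists (fun s => g s + (p (S n) (Rmax s (node P (S n))) - p n (Rmax s (node P (S n))))).
      assert (Lo : forall s, s <= node P (S n) ->
        g s + (p (S n) (Rmax s (node P (S n))) - p n (Rmax s (node P (S n)))) = g s).
      { intros s Hs. rewrite Rmax_right by lra. rewrite (Hm n) by auto. ring. }
      assert (Hi : forall s, node P (S n) <= s ->
        g s + (p (S n) (Rmax s (node P (S n))) - p n (Rmax s (node P (S n)))) = p (S n) s).
      { intros s Hs. rewrite Rmax_left by lra. rewrite Eg'; [ring|].
        generalize (node_incr P n ltac:(lia)); lra. }
      split; [|split; auto].
      + intros s. apply cont_plus; auto.
        assert (Cm : continuous (fun x => Rmax x (node P (S n))) s) by (apply cont_Rmax, cont_id).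
        apply cont_minus;
          [apply (continuous_comp _ (p (S n))) | apply (continuous_comp _ (p n))]; auto;
          apply (isP_cont k); apply Hp; lia.
      + intros j Hj s Hs. destruct (Nat.eq_dec j (S n)) as [->|]; [apply Hi; lra|].
        rewrite Lo; [apply Eg; auto; lia|].
        generalize (node_le P (S j) (S n) ltac:(lia)); lra. }
  assert (N0 := nint_pos P).
  destruct (G (pred (nint P)) ltac:(lia)) as [g [Cg [Eg _]]].
  destruct (periodic_extension g (node P 0) Cg) as [v [Pv [Cv Ev]]].
  - rewrite <- node_period, (Eg (pred (nint P))), (Eg O); try lia; auto.
    + generalize (node_incr P 0 N0); lra.
    + replace (S (pred (nint P))) with (nint P) by lia.
      generalize (node_le P (pred (nint P)) (nint P) ltac:(lia)); lra.
  - assert (E : forall j, (j < nint P)%nat -> forall s, node P j <= s <= node P (S j) -> v s = p j s).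
    { intros j Hj s Hs. rewrite Ev; [apply Eg; auto; lia|].
      rewrite <- node_period. generalize (node_le P 0 j ltac:(lia)), (node_le P (S j) (nint P) ltac:(lia)); lra. }
    exists v. split; auto. apply fe_intro; auto.
    intros j Hj. exists (p j). auto.
Qed.

Lemma RInt_deriv (f f' : R -> R) a b : (forall s, is_derive f s (f' s)) ->
  (forall s, continuous f' s) -> RInt f' a b = f b - f a.
Proof.
  intros H1 H2. apply is_RInt_unique. apply (is_RInt_derive (V := R_CompleteNormedModule)); auto.
Qed.

(* Every [q] on one cell is, up to a global constant, the derivative of a
   finite element function: this localizes Galerkin orthogonality. *)
Lemma fe_test k P j q : (1 <= k)%nat -> (j < nint P)%nat -> isP (pred k) q ->
  let m := RInt q (node P j) (node P (S j)) / (2 * PI) in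
  exists xi, fe_scalar k P xi /\
    (forall s, node P j < s < node P (S j) -> Derive xi s = q s - m) /\
    (forall i, (i < nint P)%nat -> i <> j -> forall s, node P i < s < node P (S i) ->
       Derive xi s = - m).
Proof.
  intros Hk Hj Hq m.
  destruct (isP_prim _ _ Hq) as [Q [HQ DQ]].
  replace (S (pred k)) with k in HQ by lia.
  assert (EQ : RInt q (node P j) (node P (S j)) = Q (node P (S j)) - Q (node P j)).
  { apply RInt_deriv; auto. apply (isP_cont _ _ Hq). }
  (* A primitive of q, made constant outside cell j. Over one period it rises by the integral of q,
     and the linear term of slope -m restores periodicity. *)
  set (p := fun i s => (match Nat.compare i j with
     | Lt => 0 | Eq => Q s + (-1) * Q (node P j)
     | Gt => Q (node P (S j)) - Q (node P j) end) + (- m) * (s - node P 0)).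
  assert (Hm : m * (2 * PI) = Q (node P (S j)) - Q (node P j)).
  { unfold m. rewrite EQ. field. apply PI_neq0. }
  clearbody m.
  destruct (fe_glue k P p) as [xi [Hxi E]].
  - intros i Hi. unfold p. apply isP_plus.
    + destruct (Nat.compare i j); try apply isP_const.
      apply isP_plus; auto. apply isP_const.
    + apply isP_scal. apply (isP_ext _ (fun s => s * 1 + - node P 0)); [intros; ring|].
      apply isP_plus; [|apply isP_const].
      destruct k as [|k]; [lia|]. apply (isP_mulX k (fun _ => 1)), isP_const.
  - intros i Hi. unfold p. f_equal.
    destruct (Nat.compare_spec i j), (Nat.compare_spec (S i) j); subst; try lia; try lra;
     replace i with j in * by lia; lra.
  - unfold p. rewrite node_period.
    destruct (Nat.compare_spec (pred (nint P)) j), (Nat.compare_spec 0 j); subst; try lia;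
     rewrite ?Rmult_plus_distr_l.
    + assert (Np := node_period P).
      replace (S (pred (nint P))) with (nint P) in * by lia.
      replace (pred (nint P)) with O in * by lia. rewrite Np in *. lra.
    + assert (Np := node_period P).
      replace (S (pred (nint P))) with (nint P) in * by lia. rewrite Np in *. lra.
    + lra.
    + lra.
  - exists xi. split; auto. split.
    + intros s Hs. apply is_derive_unique.
      apply (is_derive_cell xi (p j) _ _ s _ (E j Hj) Hs).
      unfold p. rewrite Nat.compare_refl.
      replace (q s - m) with (q s + (-1) * 0 + (- m) * (1 - 0)) by ring.
      apply is_derive_plusR; [apply is_derive_plusR; auto; apply is_derive_scalR, is_derive_constR|].
      apply is_derive_scalR. apply is_derive_minusR; [apply (is_derive_id (K := R_AbsRing))|apply is_derive_constR].
    + intros i Hi Hij s Hs. apply is_derive_unique.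
      apply (is_derive_cell xi (p i) _ _ s _ (E i Hi) Hs).
      unfold p. replace (- m) with (0 + (- m) * (1 - 0)) by ring.
      apply is_derive_plusR.
      * destruct (Nat.compare_spec i j); try lia; apply is_derive_constR.
      * replace (0 + - m * (1 - 0)) with (- m) by ring.
        apply is_derive_scalR. apply is_derive_minusR; [apply (is_derive_id (K := R_AbsRing))|apply is_derive_constR].
Qed.

(** With the test functions of [fe_test], the integral of w xi' is that of w q over cell j minus m
    times the integral of w; the last term is the mean of w times the integral of q, hence the
    correction by the mean. *)
Lemma fe_local_orth k P w : (1 <= k)%nat -> pcont P w ->
  (forall xi, fe_scalar k P xi -> pI (fun s => w s * Derive xi s) = 0) ->
  forall j, (j < nint P)%nat -> forall q, isP (pred k) q ->
    RInt (fun s => (w s - pI w / (2 * PI)) * q s) (node P j) (node P (S j)) = 0.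
Proof.
  intros Hk Hw H j Hj q Hq.
  destruct (fe_test k P j q Hk Hj Hq) as [xi [Hxi [D1 D2]]].
  set (m := _ / _) in D1, D2.
  specialize (H xi Hxi).
  assert (Cx : pcont P (Derive xi)) by apply (pc1_pcont _ _ _ (fe_pc1 _ _ _ Hxi)).
  assert (C1 : pcont P (fun s => w s * (Derive xi s + m))).
  { apply pcont_mult; auto. apply pcont_plus; auto using pcont_const. }
  assert (E : pI (fun s => w s * Derive xi s) = pI (fun s => w s * (Derive xi s + m)) - m * pI w).
  { rewrite <- (I_scal P) by auto. rewrite <- (I_minus P); auto.
    - apply (I_ext P); auto using pcont_mult.
      + apply pcont_minus; auto. apply pcont_mult; auto using pcont_const.
      + apply on_cells_all. intros; ring.
    - apply pcont_mult; auto using pcont_const. }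
  rewrite E, (I_csum P), (csum_single _ _ j) in H; auto.
  - assert (N := node_incr P j Hj).
    assert (Eq : ex_RInt q (node P j) (node P (S j))) by (apply cont_ex_RInt, (isP_cont _ _ Hq)).
    assert (Ew : ex_RInt (fun s => w s * q s) (node P j) (node P (S j))).
    { apply (ex_RInt_ext (fun s => w s * (Derive xi s + m))); [|apply pcont_ex_cell; auto].
      intros s Hs. rewrite Rmin_left, Rmax_right in Hs by lra. rewrite D1 by auto.
      replace (q s - m + m) with (q s) by ring. auto. }
    rewrite (RI_ext _ (fun s => w s * q s)) in H;
      [|lra|intros s Hs; rewrite D1 by auto; ring].
    rewrite (RI_ext _ (fun s => w s * q s - pI w / (2 * PI) * q s)) by (try lra; intros; ring).
    rewrite RI_minus, RI_scal by auto using eRI_scal.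
    replace (pI w / (2 * PI) * RInt q (node P j) (node P (S j))) with (m * pI w).
    + lra.
    + unfold m. field. apply PI_neq0.
  - intros i Hi Hij. assert (N := node_incr P i Hi).
    rewrite (RI_ext _ (fun _ => 0)); [rewrite RI_const; ring|lra|].
    intros s Hs. rewrite (D2 i Hi Hij s Hs). ring.
Qed.

Lemma pc1_primitive P f : pcont P f -> pI f = 0 -> pc1 P (RInt f (node P 0)) f.
Proof.
  intros Hf H0. assert (Ex := fun a b => pcont_ex P f a b Hf).
  assert (IR : forall y, locally y (fun z => is_RInt f (node P 0) z (RInt f (node P 0) z))).
  { intros y. apply filter_forall. intros z. apply (RInt_correct (V := R_CompleteNormedModule)). auto. }
  split; auto.
  - intros s. rewrite (RI_Chasles _ _ s (s + 2 * PI)), <- (I_period P), H0; auto. lra.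
  - intros s. apply (continuous_RInt_1 (V := R_NormedModule) f (node P 0) s (RInt f (node P 0))); auto.
  - intros j Hj s Hs. apply (is_derive_RInt (V := R_NormedModule) f (RInt f (node P 0)) (node P 0)); auto.
    destruct (proj2 Hf j Hj) as [g [Cg Eg]].
    apply (continuous_ext_loc _ g); auto.
    apply (locally_between (node P j) (node P (S j))); auto.
    intros y Hy. symmetry. auto.
Qed.

Lemma I_abs_le P f : pcont P f -> Rabs (pI f) <= pI (fun s => Rabs (f s)).
Proof.
  intros Hf. apply abs_RInt_le; [generalize twoPI; lra|]. apply (pcont_ex P); auto.
Qed.

Lemma I_le_const P f A : pcont P f -> on_cells P (fun s => Rabs (f s) <= A) ->
  Rabs (pI f) <= A * (2 * PI).
Proof.
  intros Hf H. eapply Rle_trans; [apply (I_abs_le P); auto|].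
  rewrite <- I_const. apply (I_le P); auto using pcont_abs, pcont_const.
Qed.

(* With [z] a primitive of [f], [u'] is cellwise the L2 projection of [c - z]
   for a constant [c]; no inverse inequality for the mesh is involved. *)
Lemma fe_derive_sup k : (1 <= k)%nat -> exists C, 0 <= C /\
  forall P u f, fe_scalar k P u -> pcont P f ->
    (forall xi, fe_scalar k P xi -> pI (fun s => Derive u s * Derive xi s) = pI (fun s => f s * xi s)) ->
    on_cells P (fun s => Rabs (Derive u s) <= C * pI (fun s => Rabs (f s))).
Proof.
  intros Hk. destruct (local_proj_bound (pred k)) as [C [HC HB]].
  exists (C * 2). split; [lra|]. intros P u f Hu Hf H. assert (TP := twoPI).
  set (A := pI (fun s => Rabs (f s))).
  assert (Cd := fun v (Hv : fe_scalar k P v) => pc1_pcont _ _ _ (fe_pc1 _ _ _ Hv)).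
  (* The constant test function shows that f has zero mean, so that its primitive z is periodic. *)
  assert (f0 : pI f = 0).
  { specialize (H (fun _ => 1) (fe_const k P 1)). cbv beta in H.
    rewrite (I_ext P (fun s => f s * 1) f) in H; auto.
    - rewrite <- H. replace 0 with (pI (fun _ => 0)) by (rewrite I_const; ring).
      apply (I_ext P); auto using pcont_const.
      + apply pcont_mult; auto. apply Cd, fe_const.
      + apply on_cells_all. intros s. rewrite Derive_const. ring.
    - apply pcont_mult; auto using pcont_const.
    - apply on_cells_all. intros; ring. }
  set (z := RInt f (node P 0)).
  assert (Hz : pc1 P z f) by (apply pc1_primitive; auto).
  assert (Cz := pc1_pcont0 _ _ _ Hz).
  assert (zA : forall x, Rabs (z x) <= A).
  { intros x. destruct (period_repr (node P 0) x) as [m Hm].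
    rewrite <- (periodic_Z z (pc1_per _ _ _ Hz) m x). set (y := x - _) in *.
    assert (Ex := fun a b => pcont_ex P _ a b (pcont_abs P f Hf)).
    unfold z. eapply Rle_trans; [apply abs_RInt_le; [lra|apply (pcont_ex P); auto]|].
    unfold A. rewrite (I_period P _ (node P 0)) by auto using pcont_abs.
    rewrite (RI_Chasles _ _ y (node P 0 + 2 * PI)) by auto.
    assert (0 <= RInt (fun s => Rabs (f s)) y (node P 0 + 2 * PI)).
    { apply RInt_ge0; auto; [lra|]. intros; apply Rabs_pos. }
    lra. }
  (* Integration by parts turns (u', xi') = (f, xi) into (u' + z, xi') = 0. *)
  set (w := fun s => Derive u s + z s).
  assert (Cw : pcont P w) by (apply pcont_plus; auto).
  assert (Hw : forall xi, fe_scalar k P xi -> pI (fun s => w s * Derive xi s) = 0).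
  { intros xi Hxi.
    rewrite (I_ext P _ (fun s => Derive u s * Derive xi s + z s * Derive xi s)).
    - rewrite (I_plus P), H by (auto using pcont_mult).
      rewrite (pc1_ibp P z f xi (Derive xi) Hz (fe_pc1 _ _ _ Hxi)). ring.
    - apply pcont_mult; auto.
    - apply pcont_plus; apply pcont_mult; auto.
    - apply on_cells_all. intros; unfold w; ring. }
  assert (Ew : pI w = pI z).
  { unfold w. rewrite (I_plus P), (pc1_I_0 P u) by (auto; apply (fe_pc1 k); auto). ring. }
  set (c := pI w / (2 * PI)).
  assert (Hc : Rabs c <= A).
  { unfold c. rewrite Ew. unfold Rdiv. rewrite Rabs_mult, (Rabs_right (/ (2 * PI))).
    - apply (Rmult_le_reg_r (2 * PI)); auto. rewrite Rmult_assoc, Rinv_l, Rmult_1_r by lra.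
      apply (I_le_const P); auto. apply on_cells_all. auto.
    - apply Rle_ge, Rlt_le, Rinv_0_lt_compat; auto. }
  intros j Hj s Hs.
  destruct (fe_derive_cell _ _ _ j Hu Hj) as [p [Hp Dp]].
  rewrite (is_derive_unique _ _ _ (Dp s Hs)).
  assert (O := fe_local_orth k P w Hk Cw Hw j Hj p Hp). fold c in O.
  rewrite Rmult_assoc.
  assert (Exy : ex_RInt (fun s => (c - z s) * p s) (node P j) (node P (S j))).
  { apply cont_ex_RInt. intros x. apply cont_mult; [|apply (isP_cont _ _ Hp)].
    apply cont_minus; [apply cont_const|apply Hz]. }
  assert (Epp : ex_RInt (fun s => p s * p s) (node P j) (node P (S j))).
  { apply cont_ex_RInt. intros x. apply cont_mult; apply (isP_cont _ _ Hp). }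
  apply (HB p (node P j) (node P (S j)) (fun s => c - z s) (2 * A)); auto; try lra.
  - intros x _. eapply Rle_trans; [apply Rabs_triang|]. rewrite Rabs_Ropp.
    specialize (zA x). lra.
  - rewrite (RI_ext _ (fun s => p s * p s - (c - z s) * p s)) in O.
    + rewrite RI_minus in O by auto. lra.
    + lra.
    + intros x Hx. unfold w. rewrite (is_derive_unique _ _ _ (Dp x Hx)). ring.
Qed.

(** * The operator R_h^I *)

Lemma mesh_size_cell P j : (j < nint P)%nat -> node P (S j) - node P j <= mesh_size P.
Proof.
  intros Hj. unfold mesh_size.
  assert (H : In (node P (S j) - node P j) (map (fun j => node P (S j) - node P j) (seq 0 (nint P)))).
  { apply in_map_iff. exists j. split; auto. apply in_seq. lia. }
  induction (map _ _) as [|x l IH]; [destruct H|]. simpl. destruct H as [->|H].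
  - apply Rmax_l.
  - eapply Rle_trans; [apply IH; auto|apply Rmax_r].
Qed.

Lemma mesh_size_pos P : 0 < mesh_size P.
Proof.
  assert (H := mesh_size_cell P 0 (nint_pos P)). assert (N := node_incr P 0 (nint_pos P)). lra.
Qed.

(* [v] is what both variants of the operator R_h^I produce from [y]: in either
   case the derivative of the error is orthogonal to polynomials of degree
   k - 1 on every single cell. *)
Record is_loc (k : nat) (P : partition) (v y y1 : R -> R) : Prop := IsLoc {
  loc_fe : fe_scalar k P v;
  loc_per : periodic y;
  loc_der : forall s, is_derive y s (y1 s);
  loc_cont : forall s, continuous y1 s;
  loc_orth : forall j, (j < nint P)%nat -> forall q, isP (pred k) q ->
    RInt (fun s => (Derive v s - y1 s) * q s) (node P j) (node P (S j)) = 0;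
  loc_norm : if Nat.eqb k 1 then v (node P 0) = y (node P 0)
             else pI (fun s => v s - y s) = 0
}.

Lemma deriv_periodic (y y1 : R -> R) : periodic y -> (forall s, is_derive y s (y1 s)) -> periodic y1.
Proof.
  intros H D s. rewrite <- (is_derive_unique _ _ _ (D s)), <- (is_derive_unique _ _ _ (D (s + 2 * PI))).
  apply Derive_periodic; auto.
Qed.

Lemma is_loc_pc1_y k P v y y1 : is_loc k P v y y1 -> pc1 P y y1.
Proof. intros []. apply pc1_smooth; auto. apply (deriv_periodic y); auto. Qed.

Lemma is_loc_pc1 k P v y y1 : is_loc k P v y y1 ->
  pc1 P (fun s => v s - y s) (fun s => Derive v s - y1 s).
Proof.
  intros H. apply pc1_minus; [apply (fe_pc1 k), H|apply (is_loc_pc1_y k P v), H].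
Qed.

(** Linearity: a time difference of projections is the projection of the time difference, so that
    the error estimate applied to it produces the factors dt. *)
Lemma is_loc_comb k P v y y1 c w z z1 : is_loc k P v y y1 -> is_loc k P w z z1 ->
  is_loc k P (fun s => v s + c * w s) (fun s => y s + c * z s) (fun s => y1 s + c * z1 s).
Proof.
  intros H H'. assert (Q := is_loc_pc1 _ _ _ _ _ H). assert (Q' := is_loc_pc1 _ _ _ _ _ H').
  assert (Fv := fe_pc1 _ _ _ (loc_fe _ _ _ _ _ H)). assert (Fw := fe_pc1 _ _ _ (loc_fe _ _ _ _ _ H')).
  destruct H as [A1 A2 A3 A4 A5 A6], H' as [B1 B2 B3 B4 B5 B6]. split.
  - apply fe_comb; auto.
  - intros s. rewrite A2, B2. auto.
  - intros s. apply is_derive_plusR; auto. apply is_derive_scalR; auto.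
  - intros s. apply cont_plus; auto. apply cont_mult; auto using cont_const.
  - intros j Hj q Hq. assert (N := node_incr P j Hj).
    assert (Cq : forall x, continuous q x) by apply (isP_cont _ _ Hq).
    assert (Ex : forall u u1, fe_scalar k P u -> (forall s, continuous u1 s) ->
       ex_RInt (fun s => (Derive u s - u1 s) * q s) (node P j) (node P (S j))).
    { intros u u1 Hu Hc. destruct (fe_derive_cell _ _ _ j Hu Hj) as [r [Hr Dr]].
      apply (ex_RInt_ext (fun s => (r s - u1 s) * q s)).
      - intros s Hs. rewrite Rmin_left, Rmax_right in Hs by lra.
        rewrite (is_derive_unique _ _ _ (Dr s Hs)). auto.
      - apply cont_ex_RInt. intros x. apply cont_mult; auto. apply cont_minus; auto.
        apply (isP_cont _ _ Hr). }
    rewrite (RI_ext _ (fun s => (Derive v s - y1 s) * q s + c * ((Derive w s - z1 s) * q s))).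
    + rewrite RI_plus, RI_scal, A5, B5 by (auto; apply eRI_scal; auto). lra.
    + lra.
    + intros s Hs.
      assert (Dv := pc1_deriv _ _ _ Fv j Hj s Hs). assert (Dw := pc1_deriv _ _ _ Fw j Hj s Hs).
      replace (Derive (fun s0 => v s0 + c * w s0) s) with (Derive v s + c * Derive w s); [ring|].
      symmetry. apply is_derive_unique, is_derive_plusR; auto. apply is_derive_scalR; auto.
  - destruct (Nat.eqb k 1); [rewrite A6, B6; auto|].
    rewrite (I_ext P _ (fun s => (v s - y s) + c * (w s - z s))).
    + rewrite (I_plus P), (I_scal P), A6, B6; [ring|..];
      try apply pcont_mult; auto using pcont_const, (pc1_pcont0 _ _ _ Q), (pc1_pcont0 _ _ _ Q').
    + apply (pc1_pcont0 _ _ _ (pc1_minus _ _ _ _ _ (pc1_plus _ _ _ _ _ Fv (pc1_scal _ c _ _ Fw))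
         (pc1_plus _ _ _ _ _ (pc1_smooth P y y1 A2 (deriv_periodic _ _ A2 A3) A3 A4)
            (pc1_scal _ c _ _ (pc1_smooth P z z1 B2 (deriv_periodic _ _ B2 B3) B3 B4))))).
    + apply (pc1_pcont0 _ _ _ (pc1_plus _ _ _ _ _ Q (pc1_scal _ c _ _ Q'))).
    + apply on_cells_all. intros; ring.
Qed.

(** Orthogonality to q = 1 says that the error has the same value at both ends of every cell. *)
Lemma is_loc_nodes k P v y y1 : is_loc k P v y y1 ->
  forall j, (j <= nint P)%nat -> v (node P j) - y (node P j) = v (node P 0) - y (node P 0).
Proof.
  intros H. assert (Q := is_loc_pc1 _ _ _ _ _ H). induction j as [|j IH]; intros Hj; auto.
  assert (N := node_incr P j Hj).
  assert (E := pc1_FTC_cell _ _ _ j (node P (S j)) Q Hj ltac:(lra)). cbv beta in E.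
  assert (O := loc_orth _ _ _ _ _ H j Hj (fun _ => 1) (isP_const _ 1)).
  rewrite (RI_ext _ (fun s => Derive v s - y1 s)) in O by (try lra; intros; ring).
  rewrite <- IH by lia. lra.
Qed.

(** On each cell v' is the L2 projection of y', and v starts from y at the left node; orthogonality
    to 1 makes it meet y at the right node, so the pieces glue. A final constant adjusts the mean
    and is 0 for k = 1. *)
Lemma is_loc_exists k P y y1 : (1 <= k)%nat -> periodic y ->
  (forall s, is_derive y s (y1 s)) -> (forall s, continuous y1 s) ->
  exists v, is_loc k P v y y1 /\ (k = 1%nat -> forall j, (j <= nint P)%nat -> v (node P j) = y (node P j)).
Proof.
  intros Hk Py Dy Cy.
  assert (G : forall j, exists pq : (R -> R) * (R -> R), (j < nint P)%nat -> isP k (fst pq) /\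
    (forall s, is_derive (fst pq) s (snd pq s)) /\ isP (pred k) (snd pq) /\
    fst pq (node P j) = y (node P j) /\ fst pq (node P (S j)) = y (node P (S j)) /\
    forall q, isP (pred k) q -> RInt (fun s => (snd pq s - y1 s) * q s) (node P j) (node P (S j)) = 0).
  (* Beyond the last cell any pair will do; (y, y) is a dummy. *)
  { intros j. destruct (Nat.lt_ge_cases j (nint P)) as [Hj|Hj];
      [|exists (y, y); intros; lia].
    assert (N := node_incr P j Hj).
    destruct (local_proj_exists (pred k) _ _ y1 N Cy) as [p [Hp Op]].
    destruct (isP_prim _ _ Hp) as [F [HF DF]]. replace (S (pred k)) with k in HF by lia.
    assert (E : F (node P (S j)) - F (node P j) = y (node P (S j)) - y (node P j)).
    { rewrite <- (RInt_deriv F p), <- (RInt_deriv y y1); auto; [|apply (isP_cont _ _ Hp)].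
      assert (O := Op (fun _ => 1) (isP_const _ 1)).
      rewrite (RI_ext _ (fun s => p s - y1 s)) in O by (try lra; intros; ring).
      rewrite RI_minus in O; [lra| |]; apply cont_ex_RInt; auto. apply (isP_cont _ _ Hp). }
    exists (fun s => F s + (y (node P j) - F (node P j)), p). intros _. simpl.
    split; [|split; [|split; [|split; [|split]]]]; auto.
    - apply isP_plus; auto. apply isP_const.
    - intros x. replace (p x) with (p x + 0) by ring. apply is_derive_plusR; auto. apply is_derive_constR.
    - ring.
    - lra. }
  apply choice in G. destruct G as [pq G].
  assert (N0 := nint_pos P). assert (Np := node_period P).
  destruct (fe_glue k P (fun j => fst (pq j))) as [v0 [Hv0 E0]].
  - intros j Hj. apply G; auto.
  - intros j Hj. destruct (G j) as (_ & _ & _ & _ & -> & _); [lia|].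
    destruct (G (S j)) as (_ & _ & _ & -> & _); auto.
  - destruct (G (pred (nint P))) as (_ & _ & _ & _ & E1 & _); [lia|].
    destruct (G O) as (_ & _ & _ & E2 & _); [lia|].
    replace (S (pred (nint P))) with (nint P) in E1 by lia. rewrite E1, E2, Np. apply Py.
  - set (c := if Nat.eqb k 1 then 0 else - pI (fun s => v0 s - y s) / (2 * PI)).
    assert (Cv : pc1 P (fun s => v0 s - y s) (fun s => Derive v0 s - y1 s)).
    { apply pc1_minus; [apply (fe_pc1 k); auto|]. apply pc1_smooth; auto. apply (deriv_periodic y); auto. }
    assert (Vn : forall j, (j <= nint P)%nat -> v0 (node P j) = y (node P j)).
    { intros j Hj. destruct j as [|j].
      - rewrite (E0 O) by (auto; generalize (node_incr P 0 N0); lra). apply G; auto.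
      - rewrite (E0 j) by (auto; generalize (node_incr P j Hj); lra). apply G; auto. }
    exists (fun s => v0 s + c * 1). split; [split; auto|].
    + apply fe_comb; auto. apply fe_const.
    + intros j Hj q Hq. assert (N := node_incr P j Hj).
      destruct (G j Hj) as (H1 & H2 & H3 & H4 & H5 & H6). rewrite <- (H6 q Hq).
      apply RI_ext; [lra|]. intros s Hs. do 2 f_equal. apply is_derive_unique.
      replace (snd (pq j) s) with (snd (pq j) s + 0) by ring.
      apply is_derive_plusR; [|apply is_derive_constR].
      apply (is_derive_cell _ (fst (pq j)) (node P j) (node P (S j))); auto.
    + unfold c. destruct (Nat.eqb k 1); [rewrite Vn by lia; ring|].
      rewrite (I_ext P _ (fun s => (v0 s - y s) + - pI (fun s => v0 s - y s) / (2 * PI))).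
      * rewrite (I_plus P), I_const by (auto using pcont_const; apply (pc1_pcont0 _ _ _ Cv)).
        field. apply PI_neq0.
      * apply pcont_minus.
        -- apply pcont_plus; [apply (pc1_pcont0 _ _ _ (fe_pc1 _ _ _ Hv0))|apply pcont_const].
        -- apply pcont_cont; auto. intros s. apply (is_derive_cont y s (y1 s)); auto.
      * apply pcont_plus; auto using pcont_const. apply (pc1_pcont0 _ _ _ Cv).
      * apply on_cells_all. intros; ring.
    + intros -> j Hj. unfold c. simpl. rewrite Vn by auto. ring.
Qed.

(** On a cell, v' - t is the L2 projection of y' - t for a Taylor approximant t of y', and sup
    stability gives order h^k for v' - y'. Integrating from a node, where the error is a constant c
    by [is_loc_nodes], gains one more power of h; the normalization then bounds c. *)
Lemma is_loc_estimate k : (1 <= k)%nat -> exists C, 0 <= C /\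
  forall P v (D : nat -> R -> R) K, is_loc k P v (D O) (D 1%nat) ->
    (forall i, (i <= k)%nat -> forall s, is_derive (D i) s (D (S i) s)) ->
    (forall s, Rabs (D (S k) s) <= K) ->
    on_cells P (fun s => Rabs (Derive v s - D 1%nat s) <= C * K * mesh_size P ^ k) /\
    forall s, Rabs (v s - D O s) <= C * K * mesh_size P ^ (k + 1).
Proof.
  intros Hk. destruct (local_proj_bound (pred k)) as [C [HC HB]].
  exists (2 * (C + 1)). split; [lra|]. intros P v D K H HD HK.
  assert (TP := twoPI). assert (h0 := mesh_size_pos P). set (h := mesh_size P) in *.
  assert (K0 : 0 <= K) by (eapply Rle_trans; [apply Rabs_pos|apply (HK 0)]).
  assert (hk : 0 <= h ^ k) by (apply pow_le; lra).
  assert (B1 : on_cells P (fun s => Rabs (Derive v s - D 1%nat s) <= (C + 1) * K * h ^ k)).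
  { intros j Hj s Hs. assert (N := node_incr P j Hj).
    destruct (taylor_approx (pred k) (fun i => D (S i)) K (node P j) (node P (S j)) N) as [t [Ht Et]].
    { intros i Hi. apply HD. lia. }
    { replace (S (S (pred k))) with (S k) by lia. auto. }
    replace (S (pred k)) with k in Et by lia.
    set (l := node P (S j) - node P j) in *.
    assert (lh : K * l ^ k <= K * h ^ k).
    { apply Rmult_le_compat_l; auto. apply pow_incr. split; [unfold l; lra|apply mesh_size_cell; auto]. }
    destruct (fe_derive_cell _ _ _ j (loc_fe _ _ _ _ _ H) Hj) as [p [Hp Dp]].
    set (r := fun s => p s + (-1) * t s).
    assert (Hr : isP (pred k) r) by (apply isP_comb; auto).
    assert (Cr := isP_cont _ _ Hr). assert (Ct := isP_cont _ _ Ht).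
    assert (CD : forall x, continuous (D 1%nat) x).
    { apply H. }
    assert (Er : ex_RInt (fun s => (D 1%nat s - t s) * r s) (node P j) (node P (S j))).
    { apply cont_ex_RInt. intros x. apply cont_mult; auto. apply cont_minus; auto. }
    assert (Br : Rabs (r s) <= C * (K * l ^ k)).
    { apply (HB r (node P j) (node P (S j)) (fun s => D 1%nat s - t s)); auto; try lra.
      - intros x Hx. apply Et. lra.
      - assert (O := loc_orth _ _ _ _ _ H j Hj r Hr).
        rewrite (RI_ext _ (fun s => r s * r s - (D 1%nat s - t s) * r s)) in O.
        + rewrite RI_minus in O; auto; [lra|].
          apply cont_ex_RInt. intros x. apply cont_mult; auto.
        + lra.
        + intros x Hx. rewrite (is_derive_unique _ _ _ (Dp x Hx)). unfold r. ring. }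
    rewrite (is_derive_unique _ _ _ (Dp s Hs)).
    specialize (Et s ltac:(lra)). unfold r in Br.
    apply Rabs_le_between in Et. apply Rabs_le_between in Br. apply Rabs_le_between.
    assert (C * (K * l ^ k) <= C * (K * h ^ k)) by (apply Rmult_le_compat_l; auto). lra. }
  split.
  { eapply on_cells_imp; [|apply B1]. intros s Hs. cbv beta in *.
    assert (0 <= (C + 1) * K * h ^ k) by (repeat apply Rmult_le_pos; auto; lra). lra. }
  set (c := v (node P 0) - D O (node P 0)).
  set (B := (C + 1) * K * h ^ (k + 1)).
  assert (EB : B = (C + 1) * K * h ^ k * h) by (unfold B; rewrite pow_add; ring).
  assert (B0 : 0 <= (C + 1) * K * h ^ k) by (repeat apply Rmult_le_pos; auto; lra).
  assert (Q := is_loc_pc1 _ _ _ _ _ H).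
  assert (B2 : forall j, (j < nint P)%nat -> forall x, node P j <= x <= node P (S j) ->
     Rabs (v x - D O x - c) <= B).
  { intros j Hj x Hx. assert (E := pc1_FTC_cell _ _ _ j x Q Hj Hx). cbv beta in E.
    replace c with (v (node P j) - D O (node P j)) by (apply (is_loc_nodes k P v (D O) (D 1%nat)); auto; lia).
    rewrite <- E. assert (S := mesh_size_cell P j Hj). fold h in S.
    assert (Ex : ex_RInt (fun s => Derive v s - D 1%nat s) (node P j) x)
      by (apply (pcont_ex P), (pc1_pcont _ _ _ Q)).
    eapply Rle_trans; [apply abs_RInt_le; auto; lra|].
    apply Rle_trans with (RInt (fun _ => (C + 1) * K * h ^ k) (node P j) x).
    - apply RInt_le; try lra.
      + apply (pcont_ex P), pcont_abs, (pc1_pcont _ _ _ Q).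
      + apply (pcont_ex P), pcont_const.
      + intros y Hy. apply (B1 j Hj). lra.
    - rewrite RI_const, EB. apply Rmult_le_compat_l; auto. lra. }
  assert (B3 : forall x, Rabs (v x - D O x - c) <= B).
  { intros x. destruct (period_repr (node P 0) x) as [m Hm].
    rewrite <- (periodic_Z v (proj1 (loc_fe _ _ _ _ _ H)) m x), <- (periodic_Z (D O) (loc_per _ _ _ _ _ H) m x).
    set (y := x - _) in *.
    assert (L : forall n, (n < nint P)%nat -> node P 0 <= y <= node P (S n) -> Rabs (v y - D O y - c) <= B).
    { induction n as [|n IH]; intros Hn Hy; [apply (B2 O); auto|].
      destruct (Rle_dec y (node P (S n))); [apply IH; [lia|lra]|]. apply (B2 (S n)); auto. lra. }
    assert (N0 := nint_pos P). apply (L (pred (nint P))); [lia|].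
    replace (S (pred (nint P))) with (nint P) by lia. rewrite node_period. lra. }
  assert (B4 : 0 <= B) by (rewrite EB; apply Rmult_le_pos; lra).
  assert (Bc : Rabs c <= B).
  { assert (Nm := loc_norm _ _ _ _ _ H). destruct (Nat.eqb k 1).
    - unfold c. rewrite Nm, Rminus_diag, Rabs_R0. auto.
    - assert (Cr := pc1_pcont0 _ _ _ Q).
      assert (E := I_le_const P (fun s => v s - D O s - c) B ltac:(apply pcont_minus; auto using pcont_const)
        ltac:(apply on_cells_all; auto)).
      rewrite (I_minus P), Nm, I_const in E by auto using pcont_const.
      rewrite Rminus_0_l, Rabs_Ropp, Rabs_mult, (Rabs_right (2 * PI)) in E by lra.
      apply Rmult_le_reg_r in E; auto. }
  intros x. specialize (B3 x). apply Rabs_le_between in B3. apply Rabs_le_between in Bc.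
  apply Rabs_le_between. fold h. replace (2 * (C + 1) * K * h ^ (k + 1)) with (2 * B) by (unfold B; ring). lra.
Qed.

Lemma fe_space_pair k P f g : fe_scalar k P f -> fe_scalar k P g ->
  fe_space k P (fun s => (f s, g s)).
Proof. intros; split; auto. Qed.

Lemma cellwise_I_0 P f : pcont P f ->
  (forall j, (j < nint P)%nat -> RInt f (node P j) (node P (S j)) = 0) -> pI f = 0.
Proof.
  intros Hf H. rewrite (I_csum P) by auto. rewrite (csum_ext _ (fun _ => 0)); auto using csum_0.
Qed.

Lemma loc_orth_global k P v y y1 xi : is_loc k P v y y1 -> fe_scalar k P xi ->
  pI (fun s => (Derive v s - y1 s) * Derive xi s) = 0.
Proof.
  intros H Hx. apply (cellwise_I_0 P).
  - apply pcont_mult; [apply (pc1_pcont _ _ _ (is_loc_pc1 _ _ _ _ _ H))|].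
    apply (pc1_pcont _ _ _ (fe_pc1 _ _ _ Hx)).
  - intros j Hj. assert (N := node_incr P j Hj).
    destruct (fe_derive_cell _ _ _ j Hx Hj) as [q [Hq Dq]].
    rewrite (RI_ext _ (fun s => (Derive v s - y1 s) * q s)); [|lra|].
    + apply H; auto.
    + intros s Hs. rewrite (is_derive_unique _ _ _ (Dq s Hs)). auto.
Qed.

Lemma Derive_minus_cells k P v y y1 : fe_scalar k P v -> (forall s, is_derive y s (y1 s)) ->
  on_cells P (fun s => Derive (fun u => v u - y u) s = Derive v s - y1 s).
Proof.
  intros Hv Hy. eapply on_cells_imp; [|apply (pc1_deriv _ _ _ (fe_pc1 _ _ _ Hv))].
  intros s D. apply is_derive_unique, is_derive_minusR; auto.
Qed.

(** * The two variants of R_h^I by components *)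

Section RhI_components.
Variables (k : nat) (P : partition) (Y : R -> R2) (y1 y2 : R -> R).
Hypothesis hk : (1 <= k)%nat.
Hypothesis Yper : periodic Y.
Hypothesis D1 : forall s, is_derive (fun u => fst (Y u)) s (y1 s).
Hypothesis D2 : forall s, is_derive (fun u => snd (Y u)) s (y2 s).
Hypothesis C1 : forall s, continuous y1 s.
Hypothesis C2 : forall s, continuous y2 s.

Lemma fst_periodic : periodic (fun s => fst (Y s)).
Proof. intros s. rewrite Yper. auto. Qed.

Lemma snd_periodic : periodic (fun s => snd (Y s)).
Proof. intros s. rewrite Yper. auto. Qed.

Lemma ritz_integrand v xi : fe_space k P v -> fe_space k P xi ->
  inner (dS (diff v Y)) (dS xi) =
  pI (fun s => (Derive (fun u => fst (v u)) s - y1 s) * Derive (fun u => fst (xi u)) s) +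
  pI (fun s => (Derive (fun u => snd (v u)) s - y2 s) * Derive (fun u => snd (xi u)) s).
Proof.
  intros [Hv1 Hv2] [Hx1 Hx2].
  assert (Q1 := pc1_smooth P _ _ fst_periodic (deriv_periodic _ _ fst_periodic D1) D1 C1).
  assert (Q2 := pc1_smooth P _ _ snd_periodic (deriv_periodic _ _ snd_periodic D2) D2 C2).
  assert (X1 := pc1_pcont _ _ _ (fe_pc1 _ _ _ Hx1)). assert (X2 := pc1_pcont _ _ _ (fe_pc1 _ _ _ Hx2)).
  assert (R1 := pc1_pcont _ _ _ (pc1_minus _ _ _ _ _ (fe_pc1 _ _ _ Hv1) Q1)).
  assert (R2 := pc1_pcont _ _ _ (pc1_minus _ _ _ _ _ (fe_pc1 _ _ _ Hv2) Q2)).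
  assert (Pc : pcont P (fun s => (Derive (fun u => fst (v u)) s - y1 s) * Derive (fun u => fst (xi u)) s +
     (Derive (fun u => snd (v u)) s - y2 s) * Derive (fun u => snd (xi u)) s)).
  { apply pcont_plus; apply pcont_mult; auto. }
  assert (E : on_cells P (fun s => (Derive (fun u => fst (v u)) s - y1 s) * Derive (fun u => fst (xi u)) s +
     (Derive (fun u => snd (v u)) s - y2 s) * Derive (fun u => snd (xi u)) s =
     dot (dS (diff v Y) s) (dS xi s))).
  { eapply on_cells_imp2; [|apply (Derive_minus_cells _ _ _ _ _ Hv1 D1)|apply (Derive_minus_cells _ _ _ _ _ Hv2 D2)].
    intros s E1 E2. unfold dot, dS, diff; simpl. cbv beta in *. rewrite <- E1, <- E2. reflexivity. }
  rewrite <- (I_plus P) by (apply pcont_mult; auto). symmetry.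
  apply (I_ext P); auto. eapply pcont_ext; [|apply E|auto].
  assert (Pd : periodic (dS (diff v Y))).
  { intros s. unfold dS. f_equal.
    - apply (Derive_periodic (fun u => fst (diff v Y u))). intros x. unfold diff; simpl.
      rewrite Yper, (proj1 Hv1). auto.
    - apply (Derive_periodic (fun u => snd (diff v Y u))). intros x. unfold diff; simpl.
      rewrite Yper, (proj1 Hv2). auto. }
  intros s. rewrite Pd. unfold dot, dS; simpl. rewrite (proj1 X1), (proj1 X2). auto.
Qed.

(** The chosen function satisfies [is_RhI] because an admissible one exists. Either characterization
    then yields the cellwise orthogonality: for k = 1 since q is constant and the error vanishes at
    the nodes, for k >= 2 by [fe_local_orth], the derivative of a periodic function having zero
    mean. *)
Lemma RhI_is_loc :
  is_loc k P (fun s => fst (RhI k P Y s)) (fun s => fst (Y s)) y1 /\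
  is_loc k P (fun s => snd (RhI k P Y s)) (fun s => snd (Y s)) y2.
Proof.
  assert (R : is_RhI k P Y (RhI k P Y)).
  { unfold RhI. apply epsilon_spec.
    destruct (is_loc_exists k P _ _ hk fst_periodic D1 C1) as [v1 [L1 N1]].
    destruct (is_loc_exists k P _ _ hk snd_periodic D2 C2) as [v2 [L2 N2]].
    exists (fun s => (v1 s, v2 s)). unfold is_RhI.
    destruct (Nat.eqb_spec k 1) as [E|E].
    - split.
      + rewrite E in L1, L2. split; [apply L1|apply L2].
      + intros j Hj. rewrite N1, N2 by auto. symmetry. apply surjective_pairing.
    - assert (M1 := loc_norm _ _ _ _ _ L1). assert (M2 := loc_norm _ _ _ _ _ L2).
      apply Nat.eqb_neq in E. rewrite E in M1, M2.
      split; [|split; [|split; assumption]].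
      + split; [apply L1|apply L2].
      + intros xi Hx. rewrite ritz_integrand; auto; [|split; [apply L1|apply L2]].

        assert (G1 := loc_orth_global k P v1 (fun s => fst (Y s)) y1 _ L1 (proj1 Hx)).
        assert (G2 := loc_orth_global k P v2 (fun s => snd (Y s)) y2 _ L2 (proj2 Hx)).
        etransitivity; [apply (f_equal2 Rplus G1 G2)|ring]. }
  unfold is_RhI in R. set (v := RhI k P Y) in *.
  destruct (Nat.eqb_spec k 1) as [->|E].
  - destruct R as [[F1 F2] Nd].
    assert (Or : forall f y y', fe_scalar 1 P f -> periodic y -> (forall s, is_derive y s (y' s)) ->
       (forall s, continuous y' s) -> (forall j, (j <= nint P)%nat -> f (node P j) = y (node P j)) ->
       is_loc 1 P f y y').
    { intros f y y' Ff Py Dy Cy Hn. split; auto; [|apply Hn; lia].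
      intros j Hj q Hq. assert (N := node_incr P j Hj).
      assert (Q := pc1_minus _ _ _ _ _ (fe_pc1 _ _ _ Ff) (pc1_smooth P _ _ Py (deriv_periodic _ _ Py Dy) Dy Cy)).
      rewrite (RI_ext _ (fun s => q 0 * (Derive f s - y' s))); [|lra|].
      - rewrite RI_scal by (apply (pcont_ex P), (pc1_pcont _ _ _ Q)).
        rewrite (pc1_FTC_cell _ _ _ j (node P (S j)) Q Hj) by lra.
        rewrite !Hn by lia. lra.
      - intros s _. rewrite (isP_0 q Hq s). ring. }
    split; apply Or; auto using fst_periodic, snd_periodic.
    + intros j Hj. rewrite Nd; auto.
    + intros j Hj. rewrite Nd; auto.
  - destruct R as [[F1 F2] [Ort [M1 M2]]].
    assert (Ek : Nat.eqb k 1 = false) by (apply Nat.eqb_neq; auto).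
    assert (Lo : forall f y y', fe_scalar k P f -> periodic y -> (forall s, is_derive y s (y' s)) ->
       (forall s, continuous y' s) -> pI (fun s => f s - y s) = 0 ->
       (forall xi, fe_scalar k P xi -> pI (fun s => (Derive f s - y' s) * Derive xi s) = 0) ->
       is_loc k P f y y').
    { intros f y y' Ff Py Dy Cy Hn Ho. split; auto; [|rewrite Ek; auto].
      intros j Hj q Hq. assert (N := node_incr P j Hj).
      assert (Q := pc1_minus _ _ _ _ _ (fe_pc1 _ _ _ Ff) (pc1_smooth P _ _ Py (deriv_periodic _ _ Py Dy) Dy Cy)).
      assert (O := fe_local_orth k P _ hk (pc1_pcont _ _ _ Q) Ho j Hj q Hq).
      rewrite (pc1_I_0 _ _ _ Q) in O. rewrite <- O. apply RI_ext; [lra|].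
      intros s _. unfold Rdiv. ring. }
    assert (Z : forall g : R -> R, pI (fun s => g s * Derive (fun _ => 0) s) = 0).
    { intros g. rewrite <- (Rmult_0_l (2 * PI)), <- I_const. unfold pI.
      apply RI_ext; [generalize twoPI; lra|]. intros s _. rewrite Derive_const. ring. }
    split; apply Lo; auto using fst_periodic, snd_periodic.
    + intros xi Hx. specialize (Ort (fun s => (xi s, 0)) (fe_space_pair _ _ _ _ Hx (fe_const k P 0))).
      rewrite ritz_integrand in Ort; [|split; auto|apply fe_space_pair; auto using fe_const].
      simpl in Ort. rewrite Z in Ort. rewrite Rplus_0_r in Ort. apply Ort.
    + intros xi Hx. specialize (Ort (fun s => (0, xi s)) (fe_space_pair _ _ _ _ (fe_const k P 0) Hx)).
      rewrite ritz_integrand in Ort; [|split; auto|apply fe_space_pair; auto using fe_const].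
      simpl in Ort. rewrite Z in Ort. rewrite Rplus_0_l in Ort. apply Ort.
Qed.
End RhI_components.

(** * Planar vectors and the implicit Euler step *)

Definition vadd (a b : R2) : R2 := (fst a + fst b, snd a + snd b).
Definition vsub (a b : R2) : R2 := (fst a - fst b, snd a - snd b).
Definition vscl (c : R) (a : R2) : R2 := (c * fst a, c * snd a).

(* The trilinear form with [tri alpha b' b' v = G(b) v]. *)
Definition tri (alpha : R) (p q r : R2) : R2 :=
  (dot p q * fst r + (alpha - 1) * dot q r * fst p,
   dot p q * snd r + (alpha - 1) * dot q r * snd p).

Ltac vring := unfold tri, vadd, vsub, vscl, dot; simpl;
  lazymatch goal with |- (_, _) = (_, _) => f_equal | _ => idtac end; ring.

Lemma dot_ge0 a : 0 <= dot a a.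
Proof. unfold dot. nra. Qed.

Lemma norm2_ge0 a : 0 <= norm2 a.
Proof. apply sqrt_pos. Qed.

Lemma norm2_sq a : norm2 a * norm2 a = dot a a.
Proof. apply sqrt_sqrt, dot_ge0. Qed.

Lemma sq_le_le a b : 0 <= b -> a * a <= b * b -> a <= b.
Proof. intros. apply Rnot_lt_le. intros N. nra. Qed.

Lemma dot_le a b : Rabs (dot a b) <= norm2 a * norm2 b.
Proof.
  assert (Ha := norm2_ge0 a). assert (Hb := norm2_ge0 b).
  apply sq_le_le; [apply Rmult_le_pos; auto|].
  replace (Rabs (dot a b) * Rabs (dot a b)) with (dot a b * dot a b)
    by (rewrite <- Rabs_mult, Rabs_right; auto; apply Rle_ge, Rle_0_sqr).
  replace (norm2 a * norm2 b * (norm2 a * norm2 b)) with (dot a a * dot b b)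
    by (rewrite <- !norm2_sq; ring).
  unfold dot. assert (0 <= (fst a * snd b - snd a * fst b) * (fst a * snd b - snd a * fst b)) by apply Rle_0_sqr.
  lra.
Qed.

Lemma dot_le' a b : dot a b <= norm2 a * norm2 b.
Proof. eapply Rle_trans; [apply Rle_abs|apply dot_le]. Qed.

Lemma norm2_add a b : norm2 (vadd a b) <= norm2 a + norm2 b.
Proof.
  assert (Ha := norm2_ge0 a). assert (Hb := norm2_ge0 b).
  apply sq_le_le; [lra|]. rewrite norm2_sq.
  assert (D := dot_le' a b). assert (Sa := norm2_sq a). assert (Sb := norm2_sq b).
  replace (dot (vadd a b) (vadd a b)) with (dot a a + 2 * dot a b + dot b b) by vring.
  nra.
Qed.

Lemma norm2_scl c a : norm2 (vscl c a) = Rabs c * norm2 a.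
Proof.
  unfold norm2. replace (dot (vscl c a) (vscl c a)) with (c² * dot a a) by (unfold Rsqr; vring).
  rewrite sqrt_mult; [|apply Rle_0_sqr|apply dot_ge0]. rewrite sqrt_Rsqr_abs. auto.
Qed.

Lemma norm2_sub a b : norm2 (vsub a b) <= norm2 a + norm2 b.
Proof.
  replace (vsub a b) with (vadd a (vscl (-1) b)) by vring.
  eapply Rle_trans; [apply norm2_add|]. rewrite norm2_scl.
  replace (Rabs (-1)) with 1 by (rewrite Rabs_left; lra). lra.
Qed.

Lemma norm2_tri alpha p q r :
  norm2 (tri alpha p q r) <= (1 + Rabs (alpha - 1)) * norm2 p * norm2 q * norm2 r.
Proof.
  replace (tri alpha p q r) with (vadd (vscl (dot p q) r) (vscl ((alpha - 1) * dot q r) p)) by vring.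
  eapply Rle_trans; [apply norm2_add|]. rewrite !norm2_scl, Rabs_mult.
  assert (D1 := dot_le p q). assert (D2 := dot_le q r).
  assert (N1 := norm2_ge0 p). assert (N3 := norm2_ge0 r).
  assert (A := Rabs_pos (alpha - 1)).
  assert (Rabs (dot p q) * norm2 r <= norm2 p * norm2 q * norm2 r) by (apply Rmult_le_compat_r; auto).
  assert (Rabs (alpha - 1) * Rabs (dot q r) * norm2 p <= Rabs (alpha - 1) * (norm2 q * norm2 r) * norm2 p).
  { apply Rmult_le_compat_r; auto. apply Rmult_le_compat_l; auto. }
  lra.
Qed.

(** G has the eigenvalues |p|^2 and alpha |p|^2: its form is |p|^2 |q|^2 + (alpha - 1)(p.q)^2 with 0
    <= (p.q)^2 <= |p|^2 |q|^2. *)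
Lemma tri_coercive alpha p q : 0 < alpha ->
  Rmin 1 alpha * dot p p * dot q q <= dot (tri alpha p p q) q.
Proof.
  intros Ha. replace (dot (tri alpha p p q) q) with (dot p p * dot q q + (alpha - 1) * (dot p q * dot p q)) by vring.
  assert (dot p q * dot p q <= dot p p * dot q q).
  { unfold dot. assert (0 <= (fst p * snd q - snd p * fst q) * (fst p * snd q - snd p * fst q)) by apply Rle_0_sqr. lra. }
  unfold Rmin. destruct Rle_dec; nra.
Qed.

Lemma mulmv_Gmat alpha b s v : mulmv (Gmat alpha b s) v = tri alpha (dS b s) (dS b s) v.
Proof.
  unfold mulmv, Gmat. replace (norm2 (dS b s) ^ 2) with (dot (dS b s) (dS b s)) by (rewrite <- norm2_sq; ring).
  unfold tri, dot, id22, outer; simpl.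
  do 3 (unfold plus, scal, mult; simpl). f_equal; ring.
Qed.

(** * Vector-valued functions and finite element pairs *)

Definition pv (P : partition) (f : R -> R2) : Prop :=
  pcont P (fun s => fst (f s)) /\ pcont P (fun s => snd (f s)).

Lemma pv_add P f g : pv P f -> pv P g -> pv P (fun s => vadd (f s) (g s)).
Proof. intros [] []. split; apply pcont_plus; auto. Qed.

Lemma pv_sub P f g : pv P f -> pv P g -> pv P (fun s => vsub (f s) (g s)).
Proof. intros [] []. split; apply pcont_minus; auto. Qed.

Lemma pv_scl P c f : pv P f -> pv P (fun s => vscl c (f s)).
Proof. intros []. split; apply pcont_mult; auto using pcont_const. Qed.

Lemma pcont_dot P f g : pv P f -> pv P g -> pcont P (fun s => dot (f s) (g s)).
Proof. intros [] []. apply pcont_plus; apply pcont_mult; auto. Qed.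

Lemma pv_tri P alpha f g h : pv P f -> pv P g -> pv P h ->
  pv P (fun s => tri alpha (f s) (g s) (h s)).
Proof.
  intros Hf Hg Hh.
  split; apply pcont_plus; repeat apply pcont_mult; try apply pcont_dot; auto using pcont_const;
   try apply Hf; apply Hh.
Qed.

Ltac pc := repeat match goal with
  | |- pcont _ (fun s => _ + _) => apply pcont_plus
  | |- pcont _ (fun s => _ - _) => apply pcont_minus
  | |- pcont _ (fun s => _ * _) => apply pcont_mult
  | |- pcont _ (fun s => - _) => apply pcont_opp
  | |- pcont _ (fun s => dot _ _) => apply pcont_dot
  | |- pcont _ (fun s => Rabs _) => apply pcont_abs
  | |- pv _ (fun s => tri _ _ _ _) => apply pv_tri
  | |- pv _ (fun s => vadd _ _) => apply pv_add
  | |- pv _ (fun s => vsub _ _) => apply pv_sub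
  | |- pv _ (fun s => vscl _ _) => apply pv_scl
  | |- pcont _ (fun _ => ?c) => apply pcont_const
  | H : pv ?P ?f |- pv ?P (fun s => ?f s) => exact H
  end; auto.

Lemma fe_pv k P v : fe_space k P v -> pv P v.
Proof. intros [H1 H2]. split; eapply pc1_pcont0; eapply fe_pc1; eauto. Qed.

Lemma fe_pv_dS k P v : fe_space k P v -> pv P (dS v).
Proof. intros [H1 H2]. split; eapply pc1_pcont; eapply fe_pc1; eauto. Qed.

Definition fcomb (v : R -> R2) (c : R) (w : R -> R2) (s : R) : R2 := vadd (v s) (vscl c (w s)).

Lemma fe_space_comb k P v c w : fe_space k P v -> fe_space k P w -> fe_space k P (fcomb v c w).
Proof. intros [H1 H2] [H3 H4]. split; apply fe_comb; auto. Qed.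

Lemma dS_comb k P v c w : fe_space k P v -> fe_space k P w ->
  on_cells P (fun s => dS (fcomb v c w) s = vadd (dS v s) (vscl c (dS w s))).
Proof.
  intros [H1 H2] [H3 H4] j Hj s Hs.
  assert (E1 := pc1_deriv _ _ _ (fe_pc1 _ _ _ H1) j Hj s Hs). assert (E2 := pc1_deriv _ _ _ (fe_pc1 _ _ _ H2) j Hj s Hs).
  assert (E3 := pc1_deriv _ _ _ (fe_pc1 _ _ _ H3) j Hj s Hs). assert (E4 := pc1_deriv _ _ _ (fe_pc1 _ _ _ H4) j Hj s Hs).
  unfold dS, vadd, vscl; simpl. f_equal; apply is_derive_unique; apply is_derive_plusR; auto; apply is_derive_scalR; auto.
Qed.

Lemma fe_zero k P : fe_space k P (fun _ => (0, 0)).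
Proof. split; apply fe_const. Qed.

(** The finite list of functionals that [riesz] requires for the finite element space: cellwise
    moments against 1, ..., s^k separate its elements. *)
Definition moments (k : nat) (P : partition) : list ((R -> R2) -> R) :=
  flat_map (fun j => flat_map (fun i =>
    (fun v => RInt (fun s => fst (v s) * s ^ i) (node P j) (node P (S j))) ::
    (fun v => RInt (fun s => snd (v s) * s ^ i) (node P j) (node P (S j))) :: nil)
    (seq 0 (S k))) (seq 0 (nint P)).

Lemma in_moments k P i j : (i <= k)%nat -> (j < nint P)%nat ->
  In (fun v : R -> R2 => RInt (fun s => fst (v s) * s ^ i) (node P j) (node P (S j))) (moments k P) /\
  In (fun v : R -> R2 => RInt (fun s => snd (v s) * s ^ i) (node P j) (node P (S j))) (moments k P).
Proof.
  intros Hi Hj. unfold moments.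
  split; apply in_flat_map; exists j; (split; [apply in_seq; lia|]);
   apply in_flat_map; exists i; (split; [apply in_seq; lia|]); simpl; auto.
Qed.

Lemma moment_ex P (f : R -> R) i j : (forall s, continuous f s) ->
  ex_RInt (fun s => f s * s ^ i) (node P j) (node P (S j)).
Proof.
  intros H. apply cont_ex_RInt. intros s. apply cont_mult; auto.
  apply (isP_cont i (fun x => x ^ i)). clear. induction i; [apply (isP_const 0 1)|].
  apply (isP_mulX i (fun x => x ^ i)); auto.
Qed.

Lemma moment_comb P (f : R -> R) c g i j : (j < nint P)%nat ->
  (forall s, continuous f s) -> (forall s, continuous g s) ->
  RInt (fun s => (f s + c * g s) * s ^ i) (node P j) (node P (S j)) =
  RInt (fun s => f s * s ^ i) (node P j) (node P (S j)) +
  c * RInt (fun s => g s * s ^ i) (node P j) (node P (S j)).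
Proof.
  intros Hj Hf Hg. assert (N := node_incr P j Hj).
  assert (M := moment_ex P f i j Hf). assert (M' := moment_ex P g i j Hg).
  rewrite <- (RI_scal _ c), <- RI_plus by auto using eRI_scal.
  apply RI_ext; [lra|]. intros; ring.
Qed.

Lemma moments_linear k P l : In l (moments k P) -> linear_on fcomb (fe_space k P) l.
Proof.
  intros H. unfold moments in H. apply in_flat_map in H. destruct H as [j [Hj H]].
  apply in_flat_map in H. destruct H as [i [Hi H]]. apply in_seq in Hj.
  intros v c w [Hv1 Hv2] [Hw1 Hw2].
  destruct H as [<-|[<-|[]]].
  - apply (moment_comb P (fun s => fst (v s)) c (fun s => fst (w s)));
      [lia|apply Hv1|apply Hw1].
  - apply (moment_comb P (fun s => snd (v s)) c (fun s => snd (w s)));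
      [lia|apply Hv2|apply Hw2].
Qed.

(** On the cell f is itself a combination of the powers s^i, so the integral of f^2 is a combination
    of its moments. *)
Lemma moments_zero_scalar k P f j : fe_scalar k P f -> (j < nint P)%nat ->
  (forall i, (i <= k)%nat -> RInt (fun s => f s * s ^ i) (node P j) (node P (S j)) = 0) ->
  forall s, node P j <= s <= node P (S j) -> f s = 0.
Proof.
  intros Hf Hj H s Hs. assert (N := node_incr P j Hj).
  assert (Cf := proj1 (proj2 Hf)).
  apply (RInt_sq_0 f (node P j) (node P (S j))); auto.
  destruct (proj2 (proj2 Hf) j Hj) as [a Ha].
  rewrite (RI_ext _ (fun s => f s * sum_f_R0 (fun i => a i * s ^ i) k)); [|lra|].
  2:{ intros x Hx. rewrite <- Ha; auto; lra. }
  assert (L : forall n, (n <= k)%nat ->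
    ex_RInt (fun s => f s * sum_f_R0 (fun i => a i * s ^ i) n) (node P j) (node P (S j)) /\
    RInt (fun s => f s * sum_f_R0 (fun i => a i * s ^ i) n) (node P j) (node P (S j)) = 0).
  { induction n as [|n IH]; intros Hn.
    - assert (M := moment_ex P f 0 j Cf). split.
      + apply (ex_RInt_ext (fun s => a O * (f s * s ^ 0))); [intros; simpl; lra|]. apply eRI_scal; auto.
      + rewrite (RI_ext _ (fun s => a O * (f s * s ^ 0))) by (try lra; intros; simpl; ring).
        rewrite RI_scal, H by auto. lra.
    - destruct IH as [E1 E2]; [lia|]. assert (M := moment_ex P f (S n) j Cf). split.
      + apply (ex_RInt_ext (fun s => f s * sum_f_R0 (fun i => a i * s ^ i) n + a (S n) * (f s * s ^ (S n)))).
        * intros x _. rewrite tech5. lra.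
        * apply eRI_plus; auto. apply eRI_scal; auto.
      + rewrite (RI_ext _ (fun s => f s * sum_f_R0 (fun i => a i * s ^ i) n + a (S n) * (f s * s ^ (S n)))).
        * rewrite RI_plus, RI_scal, E2, H by (auto; apply eRI_scal; auto). lra.
        * lra.
        * intros x _. rewrite tech5. ring. }
  apply L; auto.
Qed.

Lemma fe_scalar_zero_cells k P f : fe_scalar k P f -> on_cells P (fun s => f s = 0) ->
  forall s, f s = 0.
Proof.
  intros Hf H. assert (Q := fe_pc1 _ _ _ Hf).
  assert (D0 : on_cells P (fun s => Derive f s = 0)).
  { intros j Hj s Hs. transitivity (Derive (fun _ : R => 0) s); [|apply Derive_const].
    apply Derive_ext_loc. apply (locally_between (node P j) (node P (S j))); auto.
    intros y Hy. apply (H j Hj y Hy). }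
  intros s. rewrite (pc1_const_of_zero P f _ Q D0).
  assert (N := node_incr P 0 (nint_pos P)).
  rewrite <- (pc1_const_of_zero P f _ Q D0 ((node P 0 + node P 1) / 2)).
  apply (H O (nint_pos P)). lra.
Qed.

Lemma fe_zero_of_sq k P v : fe_space k P v -> pI (fun s => dot (v s) (v s)) = 0 ->
  forall s, v s = (0, 0).
Proof.
  intros Hv E. assert (Pv := fe_pv _ _ _ Hv). destruct Pv as [P1 P2].
  unfold dot in E. rewrite (I_plus P) in E by (apply pcont_mult; auto).
  assert (0 <= pI (fun s => fst (v s) * fst (v s))).
  { apply (I_ge0 P); [apply pcont_mult; auto|]. apply on_cells_all. intros; nra. }
  assert (0 <= pI (fun s => snd (v s) * snd (v s))).
  { apply (I_ge0 P); [apply pcont_mult; auto|]. apply on_cells_all. intros; nra. }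
  assert (Z1 := fe_scalar_zero_cells k P _ (proj1 Hv) (I_sq_0 P (fun s => fst (v s)) P1 ltac:(lra))).
  assert (Z2 := fe_scalar_zero_cells k P _ (proj2 Hv) (I_sq_0 P (fun s => snd (v s)) P2 ltac:(lra))).
  intros s. rewrite (surjective_pairing (v s)), Z1, Z2. auto.
Qed.

Lemma inner_pI f g : inner f g = pI (fun s => dot (f s) (g s)).
Proof. reflexivity. Qed.

(** The form of one implicit step for the unknown u. As G is frozen at the old level b, the step is
    linear and the form symmetric, so that [riesz] solves it. *)
Definition step_form (alpha dt : R) (b u v : R -> R2) : R :=
  pI (fun s => dot (tri alpha (dS b s) (dS b s) (vscl (/ dt) (u s))) (v s)) +
  pI (fun s => dot (dS u s) (dS v s)).

(** * Unique solvability of one implicit step when |d_s b| is bounded below *)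

Section Step.
Context (alpha dt : R) (k : nat) (P : partition) (b : R -> R2) (m : R).
Hypothesis ha : 0 < alpha.
Hypothesis hdt : 0 < dt.
Hypothesis hm : 0 < m.
Hypothesis hb : fe_space k P b.
Hypothesis hreg : on_cells P (fun s => m <= dot (dS b s) (dS b s)).

Lemma step_form_coercive v : fe_space k P v ->
  Rmin 1 alpha * m / dt * pI (fun s => dot (v s) (v s)) <= step_form alpha dt b v v.
Proof.
  intros Hv. assert (Pb := fe_pv_dS _ _ _ hb). assert (Pv := fe_pv _ _ _ Hv). assert (Pd := fe_pv_dS _ _ _ Hv).
  unfold step_form. rewrite <- (I_scal P) by pc.
  assert (0 <= pI (fun s => dot (dS v s) (dS v s))).
  { apply (I_ge0 P); [pc|]. apply on_cells_all. intros; apply dot_ge0. }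
  assert (pI (fun s => Rmin 1 alpha * m / dt * dot (v s) (v s)) <=
     pI (fun s => dot (tri alpha (dS b s) (dS b s) (vscl (/ dt) (v s))) (v s))); [|lra].
  apply (I_le P); [pc|pc|]. eapply on_cells_imp; [|apply hreg]. intros s Hs. cbv beta in *.
  replace (dot (tri alpha (dS b s) (dS b s) (vscl (/ dt) (v s))) (v s)) with
    (dot (tri alpha (dS b s) (dS b s) (v s)) (v s) * / dt) by vring.
  assert (C := tri_coercive alpha (dS b s) (v s) ha).
  assert (Rmin 1 alpha * m * dot (v s) (v s) <= Rmin 1 alpha * dot (dS b s) (dS b s) * dot (v s) (v s)).
  { apply Rmult_le_compat_r; [apply dot_ge0|]. apply Rmult_le_compat_l; auto.
    apply Rlt_le, Rmin_glb_lt; lra. }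
  replace (Rmin 1 alpha * m / dt * dot (v s) (v s)) with (Rmin 1 alpha * m * dot (v s) (v s) * / dt) by (unfold Rdiv; ring).
  apply Rmult_le_compat_r; [|lra]. apply Rlt_le, Rinv_0_lt_compat; auto.
Qed.

Lemma step_form_definite v : fe_space k P v -> step_form alpha dt b v v = 0 -> forall s, v s = (0, 0).
Proof.
  intros Hv E. apply (fe_zero_of_sq k P); auto.
  assert (C := step_form_coercive v Hv). rewrite E in C.
  assert (0 <= pI (fun s => dot (v s) (v s))).
  { assert (Pv := fe_pv _ _ _ Hv). apply (I_ge0 P); [pc|]. apply on_cells_all. intros; apply dot_ge0. }
  assert (0 < Rmin 1 alpha * m / dt).
  { apply Rdiv_lt_0_compat; auto. apply Rmult_lt_0_compat; auto. apply Rmin_glb_lt; lra. }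
  nra.
Qed.

Lemma step_form_semi_inner : semi_inner fcomb (fe_space k P) (step_form alpha dt b).
Proof.
  assert (Pb := fe_pv_dS _ _ _ hb). split.
  - intros u Hu v c w Hv Hw. unfold step_form.
    assert (Pu := fe_pv _ _ _ Hu). assert (Pu' := fe_pv_dS _ _ _ Hu).
    assert (Pv := fe_pv _ _ _ Hv). assert (Pv' := fe_pv_dS _ _ _ Hv).
    assert (Pw := fe_pv _ _ _ Hw). assert (Pw' := fe_pv_dS _ _ _ Hw).
    assert (Hc := fe_space_comb _ _ v c w Hv Hw).
    assert (Pc := fe_pv _ _ _ Hc). assert (Pc' := fe_pv_dS _ _ _ Hc).
    rewrite !Rmult_plus_distr_l, <- !(I_scal P) by pc.
    rewrite <- !(I_plus P) by pc.
    apply (I_ext P); [pc|pc|].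
    eapply on_cells_imp; [|apply (dS_comb k P v c w Hv Hw)].
    intros s E. cbv beta in *. rewrite E. unfold fcomb. vring.
  - intros u v Hu Hv. unfold step_form.
    f_equal; apply RI_ext; try (generalize twoPI; lra); intros; vring.
  - intros v Hv. assert (C := step_form_coercive v Hv).
    eapply Rle_trans; [|apply C]. apply Rmult_le_pos.
    + apply Rlt_le, Rdiv_lt_0_compat; auto. apply Rmult_lt_0_compat; auto. apply Rmin_glb_lt; lra.
    + assert (Pv := fe_pv _ _ _ Hv). apply (I_ge0 P); [pc|]. apply on_cells_all. intros; apply dot_ge0.
Qed.

Lemma step_eq u xi : fe_space k P u -> fe_space k P xi ->
  inner (fun s => mulmv (Gmat alpha b s) (scal (/ dt) (diff u b s))) xi + inner (dS u) (dS xi) =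
  step_form alpha dt b u xi -
  pI (fun s => dot (tri alpha (dS b s) (dS b s) (vscl (/ dt) (b s))) (xi s)).
Proof.
  intros Hu Hx. assert (Pb := fe_pv_dS _ _ _ hb). assert (Pb' := fe_pv _ _ _ hb).
  assert (Pu := fe_pv _ _ _ Hu).
  assert (Px := fe_pv _ _ _ Hx).
  unfold step_form. rewrite !inner_pI.
  replace (pI (fun s => dot (mulmv (Gmat alpha b s) (scal (/ dt) (diff u b s))) (xi s))) with
    (pI (fun s => dot (tri alpha (dS b s) (dS b s) (vscl (/ dt) (u s))) (xi s) -
       dot (tri alpha (dS b s) (dS b s) (vscl (/ dt) (b s))) (xi s))).
  - rewrite (I_minus P) by pc. ring.
  - apply RI_ext; [generalize twoPI; lra|]. intros s _. rewrite mulmv_Gmat.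
    change (scal (/ dt) (diff u b s)) with (vscl (/ dt) (vsub (u s) (b s))). vring.
Qed.

Lemma step_exists : exists u, fe_space k P u /\ forall xi, fe_space k P xi ->
  inner (fun s => mulmv (Gmat alpha b s) (scal (/ dt) (diff u b s))) xi + inner (dS u) (dS xi) = 0.
Proof.
  assert (Pb := fe_pv_dS _ _ _ hb). assert (Pb' := fe_pv _ _ _ hb).
  destruct (riesz fcomb (fun _ => (0, 0))) with (ls := moments k P) (S := fe_space k P)
    (B := step_form alpha dt b)
    (L := fun xi => pI (fun s => dot (tri alpha (dS b s) (dS b s) (vscl (/ dt) (b s))) (xi s))) as [u [Hu E]].
  - extensionality s. unfold fcomb. vring.
  - apply fe_zero.
  - intros v c w. apply fe_space_comb.
  - apply step_form_semi_inner.
  - intros l. apply moments_linear.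
  - intros v c w Hv Hw. assert (Pv := fe_pv _ _ _ Hv). assert (Pw := fe_pv _ _ _ Hw).
    rewrite <- (I_scal P), <- (I_plus P) by pc.
    apply RI_ext; [generalize twoPI; lra|]. intros s _. unfold fcomb. vring.
  - intros v Hv Hl.
    assert (Z1 : forall s, fst (v s) = 0).
    { apply (fe_scalar_zero_cells k P _ (proj1 Hv)). intros j Hj s Hs.
      apply (moments_zero_scalar k P (fun s => fst (v s)) j); auto; [apply Hv| |lra].
      intros i Hi. destruct (in_moments k P i j Hi Hj) as [I1 I2]. apply (Hl _ I1). }
    assert (Z2 : forall s, snd (v s) = 0).
    { apply (fe_scalar_zero_cells k P _ (proj2 Hv)). intros j Hj s Hs.
      apply (moments_zero_scalar k P (fun s => snd (v s)) j); auto; [apply Hv| |lra].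
      intros i Hi. destruct (in_moments k P i j Hi Hj) as [I1 I2]. apply (Hl _ I2). }
    assert (Zd : forall s, dS v s = (0, 0)).
    { intros s. unfold dS. rewrite (Derive_ext _ (fun _ => 0)), (Derive_ext (fun u => snd (v u)) (fun _ => 0)), Derive_const; auto. }
    unfold step_form.
    assert (Z : forall f : R -> R, (forall s, f s = 0) -> pI f = 0).
    { intros f Hf. rewrite <- (Rmult_0_l (2 * PI)), <- I_const. apply RI_ext; [generalize twoPI; lra|]. auto. }
    rewrite !Z; [ring| |].
    + intros s. rewrite Zd. vring.
    + intros s. unfold dot at 1. rewrite Z1, Z2. ring.
  - intros v Hv Ev. assert (Z := step_form_definite v Hv Ev).
    rewrite <- (Rmult_0_l (2 * PI)), <- I_const. apply RI_ext; [generalize twoPI; lra|].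
    intros s _. rewrite Z. vring.
  - exists u. split; auto. intros xi Hx. rewrite step_eq, E by auto. ring.
Qed.

Lemma step_unique u v : fe_space k P u -> fe_space k P v ->
  (forall xi, fe_space k P xi ->
     inner (fun s => mulmv (Gmat alpha b s) (scal (/ dt) (diff u b s))) xi + inner (dS u) (dS xi) = 0) ->
  (forall xi, fe_space k P xi ->
     inner (fun s => mulmv (Gmat alpha b s) (scal (/ dt) (diff v b s))) xi + inner (dS v) (dS xi) = 0) ->
  forall s, u s = v s.
Proof.
  intros Hu Hv Eu Ev.
  assert (Hd := fe_space_comb _ _ u (-1) v Hu Hv).
  assert (Z : step_form alpha dt b (fcomb u (-1) v) (fcomb u (-1) v) = 0).
  { assert (L := si_lin _ _ _ step_form_semi_inner (fcomb u (-1) v) Hd u (-1) v Hu Hv). cbv beta in L.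
    rewrite L. specialize (Eu _ Hd). specialize (Ev _ Hd). rewrite step_eq in Eu, Ev by auto. lra. }
  intros s. assert (E := step_form_definite _ Hd Z s). unfold fcomb, vadd, vscl in E.
  injection E as E1 E2. rewrite (surjective_pairing (u s)), (surjective_pairing (v s)). f_equal; lra.
Qed.
End Step.

(** * Pointwise estimates for the energy argument *)

Definition Ca (alpha : R) : R := 1 + Rabs (alpha - 1).

Lemma Ca_ge1 alpha : 1 <= Ca alpha.
Proof. unfold Ca. assert (H := Rabs_pos (alpha - 1)). lra. Qed.

Lemma Rmult_le_compat3 a b c a' b' c' : 0 <= a <= a' -> 0 <= b <= b' -> 0 <= c <= c' ->
  a * b * c <= a' * b' * c'.
Proof.
  intros. apply Rmult_le_compat; try lra; [apply Rmult_le_pos; lra|].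
  apply Rmult_le_compat; lra.
Qed.

Lemma norm2_tri_le alpha p q r a b c : norm2 p <= a -> norm2 q <= b -> norm2 r <= c ->
  norm2 (tri alpha p q r) <= Ca alpha * (a * b * c).
Proof.
  intros. eapply Rle_trans; [apply norm2_tri|]. fold (Ca alpha).
  assert (C1 := Ca_ge1 alpha). rewrite !Rmult_assoc. apply Rmult_le_compat_l; [lra|].
  rewrite <- !Rmult_assoc. apply Rmult_le_compat3; split; auto using norm2_ge0.
Qed.

Lemma young (t x y : R) : 0 < t -> x * y <= t * (x * x) + / (4 * t) * (y * y).
Proof.
  intros Ht. assert (0 <= (2 * t * x - y) * (2 * t * x - y)) by apply Rle_0_sqr.
  assert (0 < / (4 * t)) by (apply Rinv_0_lt_compat; lra).
  assert (0 <= / (4 * t) * ((2 * t * x - y) * (2 * t * x - y))) by (apply Rmult_le_pos; lra).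
  replace (/ (4 * t) * ((2 * t * x - y) * (2 * t * x - y))) with
    (t * (x * x) + / (4 * t) * (y * y) - x * y) in H1 by (field; lra). lra.
Qed.

(** Discrete product rule for the weighted energy 1/2 G(V)a.a. The vector dt X is (G(V) - G(V0)) b,
    so the change of the weight carries a factor dt, while the quadratic term in a - b has a
    sign. *)
Lemma rough_energy_identity alpha dt V0 v a b :
  let V := vadd V0 (vscl dt v) in
  let X := vadd (tri alpha v V b) (tri alpha V0 v b) in
  dot (vsub (tri alpha V V a) (tri alpha V0 V0 b)) a =
  / 2 * dot (tri alpha V V a) a - / 2 * dot (tri alpha V0 V0 b) b +
  / 2 * dot (tri alpha V V (vsub a b)) (vsub a b) + dt * (dot X a - / 2 * dot X b).
Proof. intros V X. unfold X, V, tri, vadd, vsub, vscl, dot. simpl. field. Qed.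

(** V and r stand for the derivatives of the discrete and of the projected curve, v and w for their
    quotients in time, q for the quotient of the projected curve and z for the defect. The left side
    is the increment of the right side of the error equation; by trilinearity each of its terms
    contains b1, e or z1 and a factor dt. *)
Lemma rough_defect_identity alpha dt V0 v r0 w q0 q1 z0 z1 :
  let V := vadd V0 (vscl dt v) in let r := vadd r0 (vscl dt w) in
  let q := vadd q0 (vscl dt q1) in let z := vadd z0 (vscl dt z1) in
  let e := vsub r V in let b1 := vsub w v in
  vsub (vadd (vsub (tri alpha V V q) (tri alpha r r q)) z)
       (vadd (vsub (tri alpha V0 V0 q0) (tri alpha r0 r0 q0)) z0) =
  vscl dt (vsub z1 (vadd (vadd (vadd (tri alpha b1 r0 q0) (tri alpha e w q0)) (tri alpha e r q1))
    (vadd (vadd (tri alpha V0 b1 q0) (tri alpha v e q0)) (tri alpha V e q1)))).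
Proof. intros V r q z e b1. unfold b1, e, z, q, r, V. vring. Qed.

Lemma tri_nonneg alpha p q : 0 < alpha -> 0 <= dot (tri alpha p p q) q.
Proof.
  intros Ha. eapply Rle_trans; [|apply tri_coercive; auto].
  repeat apply Rmult_le_pos; try apply dot_ge0. apply Rmin_glb; lra.
Qed.

(** The differenced error equation at one point, tested with the new quotient a; b is the old
    quotient and b1 the quotient of d_s e. The term 1/8 |b1|^2 is left to the dissipation, and the
    quartic terms come from the change of G in time. Quantifying over all values makes c depend on
    alpha and K alone. *)
Definition rough_bound (alpha K c : R) : Prop :=
  forall dt H V0 v r0 w q0 q1 z0 z1 a b, 0 < dt -> 0 <= H ->
  let V := vadd V0 (vscl dt v) in let r := vadd r0 (vscl dt w) in
  let q := vadd q0 (vscl dt q1) in let z := vadd z0 (vscl dt z1) in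
  let e := vsub r V in let b1 := vsub w v in
  norm2 r0 <= K -> norm2 r <= K -> norm2 w <= K -> norm2 q0 <= K -> norm2 q1 <= K ->
  norm2 z1 <= K * H -> norm2 V0 <= K + 1 -> norm2 V <= K + 1 -> norm2 e <= 1 ->
  / 2 * dot (tri alpha V V a) a - / 2 * dot (tri alpha V0 V0 b) b <=
  dot (vsub (tri alpha V V a) (tri alpha V0 V0 b)) a -
  dot (vsub (vadd (vsub (tri alpha V V q) (tri alpha r r q)) z)
            (vadd (vsub (tri alpha V0 V0 q0) (tri alpha r0 r0 q0)) z0)) a +
  dt * (/ 8 * dot b1 b1 + c * (dot a a * dot b b + dot b b * dot b b) +
        c * (dot a a + dot b b + dot e e + H * H)).

Lemma rough_pointwise alpha K : 0 < alpha -> 1 <= K ->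
  exists c, 1 <= c /\ rough_bound alpha K c.
Proof.
  intros Ha HK. assert (C1 := Ca_ge1 alpha). set (C := Ca alpha) in *.
  (* [c2] bounds X by (K + |b1|)|b|, and [c3] bounds the forcing by |b1| + |e| + H. *)
  set (c2 := 2 * C * (K + 1)). set (c3 := 8 * C * (K * K)).
  assert (K2 : K <= K * K) by nra.
  assert (CK : K * K <= C * (K * K)) by nra.
  assert (H2 : 1 <= c2) by (unfold c2; nra).
  assert (H3 : 1 <= c3) by (unfold c3; nra).
  exists (8 * (c2 * c2) + 2 * c2 * K + 4 * (c3 * c3) + c3).
  assert (c2K : 0 <= c2 * K) by nra. assert (c22 : 1 <= c2 * c2) by nra. assert (c33 : 1 <= c3 * c3) by nra.
  split; [lra|].
  intros dt H V0 v r0 w q0 q1 z0 z1 a b Hdt HH V r q z e b1 Nr0 Nr Nw Nq0 Nq1 Nz1 NV0 NV Ne.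
  assert (E1 := rough_energy_identity alpha dt V0 v a b). cbv zeta in E1. fold V in E1.
  set (X := vadd (tri alpha v V b) (tri alpha V0 v b)) in E1.
  assert (E2 := rough_defect_identity alpha dt V0 v r0 w q0 q1 z0 z1). cbv zeta in E2. fold V r q z e b1 in E2.
  rewrite E1, E2. clear E1 E2.
  set (G := vadd (vadd (vadd _ _) _) _).
  assert (S0 := tri_nonneg alpha V (vsub a b) Ha).
  assert (A0 := norm2_ge0 a). assert (B0 := norm2_ge0 b). assert (b0 := norm2_ge0 b1). assert (e0 := norm2_ge0 e).
  rewrite <- !norm2_sq with (a := a), <- !norm2_sq with (a := b), <- !norm2_sq with (a := b1), <- !norm2_sq with (a := e).
  assert (Nv : norm2 v <= K + norm2 b1).
  { replace v with (vsub w b1). 2:{ unfold b1. destruct v, w. vring. }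
    eapply Rle_trans; [apply norm2_sub|]. lra. }
  set (A := norm2 a) in *. set (B := norm2 b) in *. set (B1 := norm2 b1) in *. set (E := norm2 e) in *.
  assert (NX : norm2 X <= c2 * ((K + B1) * B)).
  { unfold X. eapply Rle_trans; [apply norm2_add|].
    assert (T1 := norm2_tri_le alpha v V b (K + B1) (K + 1) B Nv NV (Rle_refl _)).
    assert (T2 := norm2_tri_le alpha V0 v b (K + 1) (K + B1) B NV0 Nv (Rle_refl _)).
    fold C in T1, T2. unfold c2. lra. }
  assert (NG : norm2 G <= 7 * C * (K * K) * (B1 + E)).
  { unfold G.
    assert (T1 := norm2_tri_le alpha b1 r0 q0 B1 K K (Rle_refl _) Nr0 Nq0).
    assert (T2 := norm2_tri_le alpha e w q0 E K K (Rle_refl _) Nw Nq0).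
    assert (T3 := norm2_tri_le alpha e r q1 E K K (Rle_refl _) Nr Nq1).
    assert (T4 := norm2_tri_le alpha V0 b1 q0 (K + 1) B1 K NV0 (Rle_refl _) Nq0).
    assert (T5 := norm2_tri_le alpha v e q0 (K + B1) E K Nv (Rle_refl _) Nq0).
    assert (T6 := norm2_tri_le alpha V e q1 (K + 1) E K NV (Rle_refl _) Nq1).
    fold C in T1, T2, T3, T4, T5, T6.
    assert (norm2 (vadd (vadd (vadd (tri alpha b1 r0 q0) (tri alpha e w q0)) (tri alpha e r q1))
       (vadd (vadd (tri alpha V0 b1 q0) (tri alpha v e q0)) (tri alpha V e q1))) <=
       C * (B1 * K * K) + C * (E * K * K) + C * (E * K * K) + C * ((K + 1) * B1 * K) + C * ((K + B1) * E * K) + C * ((K + 1) * E * K)).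
    { eapply Rle_trans; [apply norm2_add|].
      eapply Rle_trans; [apply Rplus_le_compat; (eapply Rle_trans; [apply norm2_add|]);
        (apply Rplus_le_compat_r; apply norm2_add)|]. lra. }
    eapply Rle_trans; [apply H0|].
    replace (C * (B1 * K * K) + C * (E * K * K) + C * (E * K * K) + C * ((K + 1) * B1 * K) + C * ((K + B1) * E * K) + C * ((K + 1) * E * K))
      with (C * (B1 * (2 * (K * K) + K + K * E) + E * (4 * (K * K) + K))) by ring.
    rewrite (Rmult_assoc 7), (Rmult_comm 7), !Rmult_assoc. apply Rmult_le_compat_l; [lra|].
    assert (K * E <= K * K) by nra.
    assert (B1 * (2 * (K * K) + K + K * E) <= B1 * (7 * (K * K))) by (apply Rmult_le_compat_l; lra).
    assert (E * (4 * (K * K) + K) <= E * (7 * (K * K))) by (apply Rmult_le_compat_l; lra).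
    lra. }
  assert (Da : dot (vscl dt (vsub z1 G)) a <= dt * (c3 * (B1 + E + H) * A)).
  { replace (dot (vscl dt (vsub z1 G)) a) with (dt * dot (vsub z1 G) a) by vring.
    apply Rmult_le_compat_l; [lra|]. eapply Rle_trans; [apply dot_le'|]. fold A.
    apply Rmult_le_compat_r; auto. eapply Rle_trans; [apply norm2_sub|].
    assert (K * H <= C * (K * K) * H) by (apply Rmult_le_compat_r; lra).
    assert (0 <= C * (K * K) * (B1 + E)) by (apply Rmult_le_pos; nra).
    assert (0 <= C * (K * K) * H) by (apply Rmult_le_pos; nra).
    unfold c3. lra. }
  assert (Xa : - (dot X a - / 2 * dot X b) <= c2 * ((K + B1) * B) * (A + B)).
  { assert (D1 := dot_le X a). assert (D2 := dot_le X b). fold A in D1. fold B in D2.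
    apply Rabs_le_between in D1. apply Rabs_le_between in D2.
    assert (norm2 X * (A + B) <= c2 * ((K + B1) * B) * (A + B)) by (apply Rmult_le_compat_r; lra). lra. }
  assert (Y1 : c2 * ((K + B1) * B) * (A + B) + c3 * (B1 + E + H) * A <=
    / 8 * (B1 * B1) + (8 * (c2 * c2) + 2 * c2 * K + 4 * (c3 * c3) + c3) * (A * A * (B * B) + B * B * (B * B)) +
    (8 * (c2 * c2) + 2 * c2 * K + 4 * (c3 * c3) + c3) * (A * A + B * B + E * E + H * H)).
  { assert (Z1 := young (/ 32) B1 (c2 * (B * A)) ltac:(lra)).
    assert (Z2 := young (/ 32) B1 (c2 * (B * B)) ltac:(lra)).
    assert (Z3 := young (/ 16) B1 (c3 * A) ltac:(lra)).
    assert (Z4 : E * A <= / 2 * (E * E) + / 2 * (A * A)) by (assert (0 <= (E - A) * (E - A)) by apply Rle_0_sqr; lra).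
    assert (Z5 : H * A <= / 2 * (H * H) + / 2 * (A * A)) by (assert (0 <= (H - A) * (H - A)) by apply Rle_0_sqr; lra).
    assert (Z6 : B * A <= / 2 * (B * B) + / 2 * (A * A)) by (assert (0 <= (B - A) * (B - A)) by apply Rle_0_sqr; lra).
    replace (/ (4 * / 32)) with 8 in * by field. replace (/ (4 * / 16)) with 4 in * by field.
    set (Q := A * A * (B * B) + B * B * (B * B)) in *.
    assert (Q0 : 0 <= Q) by (unfold Q; repeat apply Rplus_le_le_0_compat; repeat apply Rmult_le_pos; auto).
    assert (AA : 0 <= A * A) by nra. assert (BB : 0 <= B * B) by nra. assert (EE : 0 <= E * E) by nra. assert (HH' : 0 <= H * H) by nra.
    assert (W1 : c2 * K * (B * (A + B)) <= 2 * c2 * K * (A * A + B * B)).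
    { replace (2 * c2 * K * (A * A + B * B)) with (c2 * K * (2 * (A * A + B * B))) by ring.
      apply Rmult_le_compat_l; lra. }
    assert (W2 : c3 * (E * A + H * A) <= c3 * (A * A + B * B + E * E + H * H)).
    { apply Rmult_le_compat_l; lra. }
    assert (W3 : 4 * (c3 * c3) * (A * A) <= 4 * (c3 * c3) * (A * A + B * B + E * E + H * H)).
    { apply Rmult_le_compat_l; lra. }
    assert (W4 : 0 <= 2 * c2 * K * (E * E + H * H)) by (apply Rmult_le_pos; lra).
    assert (W5 : 0 <= 8 * (c2 * c2) * (A * A + B * B + E * E + H * H)) by (apply Rmult_le_pos; lra).
    assert (W6 : 0 <= (2 * c2 * K + 4 * (c3 * c3) + c3) * Q) by (apply Rmult_le_pos; lra).
    assert (W7 : 8 * (c2 * (B * A) * (c2 * (B * A))) + 8 * (c2 * (B * B) * (c2 * (B * B))) = 8 * (c2 * c2) * Q) by (unfold Q; ring).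
    lra. }
  assert (Y2 := Rmult_le_compat_l dt _ _ ltac:(lra) Y1).
  assert (Xa' := Rmult_le_compat_l dt _ _ ltac:(lra) Xa).
  lra.
Qed.

(** * Energy estimates *)

Lemma fe_scalar_lin k P c v w : fe_scalar k P v -> fe_scalar k P w ->
  fe_scalar k P (fun s => c * (v s - w s)).
Proof.
  intros Hv Hw.
  replace (fun s => c * (v s - w s)) with (fun s => (0 + c * v s) + (- c) * w s)
    by (extensionality s; ring).
  apply fe_comb; auto. apply (fe_comb k P (fun _ => 0)); auto. apply fe_const.
Qed.

Lemma fe_space_lin k P c v w : fe_space k P v -> fe_space k P w ->
  fe_space k P (fun s => vscl c (vsub (v s) (w s))).
Proof. intros [] []. split; apply fe_scalar_lin; auto. Qed.

Lemma dS_lin k P c v w : fe_space k P v -> fe_space k P w ->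
  on_cells P (fun s => dS (fun s => vscl c (vsub (v s) (w s))) s = vscl c (vsub (dS v s) (dS w s))).
Proof.
  intros [H1 H2] [H3 H4] j Hj s Hs.
  assert (E1 := pc1_deriv _ _ _ (fe_pc1 _ _ _ H1) j Hj s Hs). assert (E2 := pc1_deriv _ _ _ (fe_pc1 _ _ _ H2) j Hj s Hs).
  assert (E3 := pc1_deriv _ _ _ (fe_pc1 _ _ _ H3) j Hj s Hs). assert (E4 := pc1_deriv _ _ _ (fe_pc1 _ _ _ H4) j Hj s Hs).
  unfold dS, vsub, vscl; simpl. f_equal; apply is_derive_unique; apply is_derive_scalR, is_derive_minusR; auto.
Qed.

Lemma vsub_scl1 a b : vsub a b = vscl 1 (vsub a b).
Proof. unfold vscl, vsub. simpl. f_equal; ring. Qed.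

Lemma fe_space_sub k P v w : fe_space k P v -> fe_space k P w ->
  fe_space k P (fun s => vsub (v s) (w s)).
Proof.
  intros Hv Hw. assert (E := fe_space_lin k P 1 v w Hv Hw).
  replace (fun s => vsub (v s) (w s)) with (fun s => vscl 1 (vsub (v s) (w s))); auto.
  extensionality s. symmetry. apply vsub_scl1.
Qed.

Lemma dS_sub k P v w : fe_space k P v -> fe_space k P w ->
  on_cells P (fun s => dS (fun s => vsub (v s) (w s)) s = vsub (dS v s) (dS w s)).
Proof.
  intros Hv Hw. assert (E := dS_lin k P 1 v w Hv Hw).
  replace (fun s => vsub (v s) (w s)) with (fun s => vscl 1 (vsub (v s) (w s))).
  - eapply on_cells_imp; [|apply E]. intros s Es. cbv beta in *. rewrite Es. symmetry. apply vsub_scl1.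
  - extensionality s. symmetry. apply vsub_scl1.
Qed.

Lemma pI_dot P f g : pv P f -> pv P g -> pI (fun s => dot (f s) (g s)) =
  pI (fun s => fst (f s) * fst (g s)) + pI (fun s => snd (f s) * snd (g s)).
Proof. intros [] []. apply (I_plus P); apply pcont_mult; auto. Qed.

Lemma fe_sup k P v : fe_space k P v -> forall s,
  dot (v s) (v s) <= 2 * (pI (fun s => dot (v s) (v s)) + pI (fun s => dot (dS v s) (dS v s))).
Proof.
  intros Hv s. assert (Pv := fe_pv _ _ _ Hv). assert (Pd := fe_pv_dS _ _ _ Hv).
  rewrite !(pI_dot P) by auto.
  assert (S1 := pc1_sup P _ _ (fe_pc1 _ _ _ (proj1 Hv)) s).
  assert (S2 := pc1_sup P _ _ (fe_pc1 _ _ _ (proj2 Hv)) s). cbv beta in *.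
  destruct Pv as [P1 P2], Pd as [P3 P4].
  rewrite (I_plus P) in S1, S2 by (apply pcont_mult; auto).
  unfold dot. unfold dS. simpl. simpl in *. lra.
Qed.

Definition dq (dt : R) (f : nat -> R -> R2) (n : nat) (s : R) : R2 :=
  vscl (/ dt) (vsub (f (S n) s) (f n s)).

Lemma norm2_quot dt x y K : 0 < dt -> norm2 (vsub x y) <= K * dt ->
  norm2 (vscl (/ dt) (vsub x y)) <= K.
Proof.
  intros Hdt H. rewrite norm2_scl, Rabs_right by (apply Rle_ge, Rlt_le, Rinv_0_lt_compat; auto).
  apply (Rmult_le_reg_l dt); auto. rewrite <- Rmult_assoc, Rinv_r by lra. lra.
Qed.

Lemma vadd_quot dt x y : dt <> 0 -> vadd y (vscl dt (vscl (/ dt) (vsub x y))) = x.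
Proof.
  intros H. destruct x, y. unfold vadd, vscl, vsub; simpl. f_equal; field; auto.
Qed.

Lemma Rabs_fst_le v : Rabs (fst v) <= norm2 v.
Proof.
  apply sq_le_le; [apply norm2_ge0|]. rewrite norm2_sq, <- Rabs_mult, Rabs_right by (apply Rle_ge, Rle_0_sqr).
  unfold dot. nra.
Qed.

Lemma Rabs_snd_le v : Rabs (snd v) <= norm2 v.
Proof.
  apply sq_le_le; [apply norm2_ge0|]. rewrite norm2_sq, <- Rabs_mult, Rabs_right by (apply Rle_ge, Rle_0_sqr).
  unfold dot. nra.
Qed.

Lemma norm2_le_abs v : norm2 v <= Rabs (fst v) + Rabs (snd v).
Proof.
  assert (A := Rabs_pos (fst v)). assert (B := Rabs_pos (snd v)).
  apply sq_le_le; [lra|]. rewrite norm2_sq. unfold dot.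
  assert (E1 : Rabs (fst v) * Rabs (fst v) = fst v * fst v) by (rewrite <- Rabs_mult; apply Rabs_right, Rle_ge, Rle_0_sqr).
  assert (E2 : Rabs (snd v) * Rabs (snd v) = snd v * snd v) by (rewrite <- Rabs_mult; apply Rabs_right, Rle_ge, Rle_0_sqr).
  nra.
Qed.

(** All that the energy argument knows of the exact solution: its projections [Rn] are regular
    curves, they and their quotients are bounded and Lipschitz in time, and they satisfy the scheme
    up to a defect of size H. The differenced equation needs the defect to vary by H dt only from
    one step to the next. *)
Record approx_data (alpha : R) (k : nat) (P : partition) (M : nat) (dt K m H : R)
    (Rn z : nat -> R -> R2) : Prop := ApproxData {
  ad_fe : forall n, (n <= M)%nat -> fe_space k P (Rn n);
  ad_z : forall n, (n < M)%nat -> pv P (z n);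
  ad_R1 : forall n, (n <= M)%nat ->
    on_cells P (fun s => norm2 (dS (Rn n) s) <= K /\ m <= norm2 (dS (Rn n) s));
  ad_dR1 : forall n, (n < M)%nat ->
    on_cells P (fun s => norm2 (vsub (dS (Rn (S n)) s) (dS (Rn n) s)) <= K * dt);
  ad_q : forall n, (n < M)%nat -> on_cells P (fun s => norm2 (dq dt Rn n s) <= K);
  ad_dq : forall n, (S n < M)%nat ->
    on_cells P (fun s => norm2 (vsub (dq dt Rn (S n) s) (dq dt Rn n s)) <= K * dt);
  ad_zb : forall n, (n < M)%nat -> on_cells P (fun s => norm2 (z n s) <= K * H);
  ad_dz : forall n, (S n < M)%nat ->
    on_cells P (fun s => norm2 (vsub (z (S n) s) (z n s)) <= K * H * dt);
  ad_eq : forall n, (n < M)%nat -> forall xi, fe_space k P xi ->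
    pI (fun s => dot (tri alpha (dS (Rn n) s) (dS (Rn n) s) (dq dt Rn n s)) (xi s)) +
    pI (fun s => dot (dS (Rn (S n)) s) (dS xi s)) = pI (fun s => dot (z n s) (xi s))
}.

Definition scheme_at (alpha : R) (k : nat) (P : partition) (dt : R) (U : nat -> R -> R2) (n : nat) : Prop :=
  fe_space k P (U (S n)) /\ forall xi, fe_space k P xi ->
    pI (fun s => dot (tri alpha (dS (U n) s) (dS (U n) s) (dq dt U n s)) (xi s)) +
    pI (fun s => dot (dS (U (S n)) s) (dS xi s)) = 0.

(** Coercivity constant of G(U) where |d_s U| >= m/2. *)
Definition coer (alpha m : R) : R := Rmin 1 alpha * (m / 2 * (m / 2)).

(** * The differenced error equation and the bootstrap *)

Section Energy.
Context (alpha K m dt H : R) (k M : nat) (P : partition) (Rn z U : nat -> R -> R2).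
Hypothesis halpha : 0 < alpha.
Hypothesis hK : 1 <= K.
Hypothesis hm : 0 < m.
Hypothesis hdt : 0 < dt.
Hypothesis hH : 0 < H.
Hypothesis hk : (1 <= k)%nat.
Hypothesis data : approx_data alpha k P M dt K m H Rn z.

Let er (n : nat) (s : R) : R2 := vsub (Rn n s) (U n s).
Let er1 (n : nat) (s : R) : R2 := vsub (dS (Rn n) s) (dS (U n) s).
Let a (n : nat) : R -> R2 := dq dt er n.
Let a1 (n : nat) : R -> R2 := dq dt er1 n.
(** Right side of the error equation once G is evaluated at the discrete curve in the term with the
    quotient of the error. *)
Let F (n : nat) (s : R) : R2 :=
  vadd (vsub (tri alpha (dS (U n) s) (dS (U n) s) (dq dt Rn n s))
             (tri alpha (dS (Rn n) s) (dS (Rn n) s) (dq dt Rn n s))) (z n s).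
Let g (n : nat) : R := pI (fun s => dot (tri alpha (dS (U n) s) (dS (U n) s) (a n s)) (a n s)).
Let A (n : nat) : R := pI (fun s => dot (a n s) (a n s)).
Let A1 (n : nat) : R := pI (fun s => dot (a1 n s) (a1 n s)).
Let E (n : nat) : R := pI (fun s => dot (er1 n s) (er1 n s)).
Let lam : R := coer alpha m.
(** The bootstrap condition: m/2 keeps the discrete curve regular and 1 keeps its derivative below K
    + 1. *)
Let good (n : nat) : Prop := on_cells P (fun s => norm2 (er1 n s) <= Rmin (m / 2) 1).
Let feU (n : nat) : Prop := fe_space k P (U n).

Lemma lam_pos : 0 < lam.
Proof.
  unfold lam, coer. apply Rmult_lt_0_compat; [apply Rmin_glb_lt; lra|]. apply Rmult_lt_0_compat; lra.
Qed.

Lemma pv_Rn n : (n <= M)%nat -> pv P (Rn n).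
Proof. intros Hn. apply (fe_pv k), (ad_fe _ _ _ _ _ _ _ _ _ _ data); auto. Qed.
Lemma pv_Rn1 n : (n <= M)%nat -> pv P (dS (Rn n)).
Proof. intros Hn. apply (fe_pv_dS k), (ad_fe _ _ _ _ _ _ _ _ _ _ data); auto. Qed.
Lemma pv_U n : feU n -> pv P (U n).
Proof. apply fe_pv. Qed.
Lemma pv_U1 n : feU n -> pv P (dS (U n)).
Proof. apply fe_pv_dS. Qed.
Lemma pv_er n : (n <= M)%nat -> feU n -> pv P (er n).
Proof. intros Hn HU. assert (H1 := pv_Rn n Hn). assert (H2 := pv_U n HU). unfold er. pc. Qed.
Lemma pv_er1 n : (n <= M)%nat -> feU n -> pv P (er1 n).
Proof. intros Hn HU. assert (H1 := pv_Rn1 n Hn). assert (H2 := pv_U1 n HU). unfold er1. pc. Qed.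
Lemma pv_dq f n : pv P (f n) -> pv P (f (S n)) -> pv P (dq dt f n).
Proof. intros. unfold dq. pc. Qed.
Lemma pv_a n : (n < M)%nat -> feU n -> feU (S n) -> pv P (a n).
Proof. intros. apply pv_dq; apply pv_er; auto; lia. Qed.
Lemma pv_a1 n : (n < M)%nat -> feU n -> feU (S n) -> pv P (a1 n).
Proof. intros. apply pv_dq; apply pv_er1; auto; lia. Qed.
Lemma pv_F n : (n < M)%nat -> feU n -> pv P (F n).
Proof.
  intros Hn HU. assert (H1 := pv_Rn1 n ltac:(lia)). assert (H2 := pv_U1 n HU).
  assert (H3 := ad_z _ _ _ _ _ _ _ _ _ _ data n Hn).
  assert (H4 : pv P (dq dt Rn n)) by (apply pv_dq; apply pv_Rn; lia).
  unfold F. pc.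
Qed.

Lemma er_fe n : (n <= M)%nat -> feU n -> fe_space k P (er n).
Proof. intros Hn HU. apply fe_space_sub; auto. apply (ad_fe _ _ _ _ _ _ _ _ _ _ data); auto. Qed.
Lemma er_dS n : (n <= M)%nat -> feU n -> on_cells P (fun s => dS (er n) s = er1 n s).
Proof. intros Hn HU. apply (dS_sub k); auto. apply (ad_fe _ _ _ _ _ _ _ _ _ _ data); auto. Qed.
Lemma a_fe n : (n < M)%nat -> feU n -> feU (S n) -> fe_space k P (a n).
Proof. intros. apply fe_space_lin; apply er_fe; auto; lia. Qed.
Lemma a_dS n : (n < M)%nat -> feU n -> feU (S n) -> on_cells P (fun s => dS (a n) s = a1 n s).
Proof.
  intros Hn H1 H2. assert (D1 := er_dS n ltac:(lia) H1). assert (D2 := er_dS (S n) ltac:(lia) H2).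
  assert (D3 := dS_lin k P (/ dt) (er (S n)) (er n) (er_fe (S n) ltac:(lia) H2) (er_fe n ltac:(lia) H1)).
  intros j Hj s Hs. specialize (D1 j Hj s Hs). specialize (D2 j Hj s Hs). specialize (D3 j Hj s Hs).
  cbv beta in *. unfold a1, dq. rewrite <- D1, <- D2. exact D3.
Qed.

Lemma err_eq n xi : (n < M)%nat -> feU n -> scheme_at alpha k P dt U n -> fe_space k P xi ->
  pI (fun s => dot (tri alpha (dS (U n) s) (dS (U n) s) (a n s)) (xi s)) +
  pI (fun s => dot (er1 (S n) s) (dS xi s)) = pI (fun s => dot (F n s) (xi s)).
Proof.
  intros Hn HU [HU' Hs] Hx. specialize (Hs xi Hx).
  assert (HR := ad_eq _ _ _ _ _ _ _ _ _ _ data n Hn xi Hx).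
  assert (P1 := pv_Rn1 n ltac:(lia)). assert (P2 := pv_Rn1 (S n) ltac:(lia)).
  assert (P3 := pv_U1 n HU). assert (P4 := pv_U1 (S n) HU').
  assert (P5 : pv P (dq dt Rn n)) by (apply pv_dq; apply pv_Rn; lia).
  assert (P6 : pv P (dq dt U n)) by (apply pv_dq; apply pv_U; auto). assert (P8 := ad_z _ _ _ _ _ _ _ _ _ _ data n Hn).
  assert (P9 := fe_pv _ _ _ Hx). assert (P10 := fe_pv_dS _ _ _ Hx).
  assert (E1 : pI (fun s => dot (tri alpha (dS (U n) s) (dS (U n) s) (a n s)) (xi s)) =
    pI (fun s => dot (tri alpha (dS (U n) s) (dS (U n) s) (dq dt Rn n s)) (xi s)) -
    pI (fun s => dot (tri alpha (dS (U n) s) (dS (U n) s) (dq dt U n s)) (xi s))).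
  { rewrite <- (I_minus P) by pc. apply RI_ext; [generalize twoPI; lra|]. intros s _.
    unfold a, dq, er. vring. }
  assert (E2 : pI (fun s => dot (er1 (S n) s) (dS xi s)) =
    pI (fun s => dot (dS (Rn (S n)) s) (dS xi s)) - pI (fun s => dot (dS (U (S n)) s) (dS xi s))).
  { rewrite <- (I_minus P) by pc. apply RI_ext; [generalize twoPI; lra|]. intros s _.
    unfold er1. vring. }
  assert (E3 : pI (fun s => dot (F n s) (xi s)) =
    pI (fun s => dot (tri alpha (dS (U n) s) (dS (U n) s) (dq dt Rn n s)) (xi s)) -
    pI (fun s => dot (tri alpha (dS (Rn n) s) (dS (Rn n) s) (dq dt Rn n s)) (xi s)) +
    pI (fun s => dot (z n s) (xi s))).
  { rewrite <- (I_minus P), <- (I_plus P) by pc. apply RI_ext; [generalize twoPI; lra|]. intros s _.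
    unfold F. vring. }
  lra.
Qed.

Lemma good_bounds n : (n <= M)%nat -> good n ->
  on_cells P (fun s => norm2 (dS (U n) s) <= K + 1 /\ m / 2 <= norm2 (dS (U n) s) /\ norm2 (er1 n s) <= 1).
Proof.
  intros Hn G. eapply on_cells_imp2; [|apply G|apply (ad_R1 _ _ _ _ _ _ _ _ _ _ data n Hn)].
  intros s H1 [H2 H3]. cbv beta in *.
  assert (L1 := Rmin_l (m / 2) 1). assert (L2 := Rmin_r (m / 2) 1).
  assert (T1 : norm2 (dS (U n) s) <= norm2 (dS (Rn n) s) + norm2 (er1 n s)).
  { replace (dS (U n) s) with (vsub (dS (Rn n) s) (er1 n s)); [apply norm2_sub|].
    unfold er1. rewrite (surjective_pairing (dS (U n) s)). vring. }
  assert (T2 : norm2 (dS (Rn n) s) <= norm2 (dS (U n) s) + norm2 (er1 n s)).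
  { replace (dS (Rn n) s) with (vadd (dS (U n) s) (er1 n s)) at 1; [apply norm2_add|].
    unfold er1. rewrite (surjective_pairing (dS (Rn n) s)). vring. }
  lra.
Qed.

Lemma good_coer n : (n <= M)%nat -> good n ->
  on_cells P (fun s => forall x, lam * dot x x <= dot (tri alpha (dS (U n) s) (dS (U n) s) x) x).
Proof.
  intros Hn G. eapply on_cells_imp; [|apply (good_bounds n Hn G)].
  intros s [_ [H1 _]] x. eapply Rle_trans; [|apply tri_coercive; auto].
  apply Rmult_le_compat_r; [apply dot_ge0|]. unfold lam, coer.
  apply Rmult_le_compat_l; [apply Rmin_glb; lra|]. rewrite <- norm2_sq.
  apply Rmult_le_compat; lra.
Qed.

Lemma A_le_g n : (n < M)%nat -> good n -> feU n -> feU (S n) -> lam * A n <= g n.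
Proof.
  intros Hn G HU HU'. assert (P1 := pv_a n Hn HU HU'). assert (P2 := pv_U1 n HU).
  unfold A, g. rewrite <- (I_scal P) by pc. apply (I_le P); [pc|pc|].
  eapply on_cells_imp; [|apply (good_coer n ltac:(lia) G)]. intros s Hs. apply Hs.
Qed.

Lemma E_step n : (n < M)%nat -> feU n -> feU (S n) ->
  E (S n) <= E n + dt * (/ 8 * A1 n + 8 * E n) + dt * dt * A1 n.
Proof.
  intros Hn HU HU'. assert (P1 := pv_er1 n ltac:(lia) HU). assert (P2 := pv_er1 (S n) ltac:(lia) HU').
  assert (P3 := pv_a1 n Hn HU HU').
  unfold E, A1. rewrite <- !(I_scal P), <- !(I_plus P), <- !(I_scal P), <- !(I_plus P) by pc.
  apply (I_le P); [pc|pc|]. apply on_cells_all. intros s. cbv beta.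
  replace (er1 (S n) s) with (vadd (er1 n s) (vscl dt (a1 n s))) by (apply vadd_quot; lra).
  assert (D := dot_le' (er1 n s) (a1 n s)).
  replace (dot (vadd (er1 n s) (vscl dt (a1 n s))) (vadd (er1 n s) (vscl dt (a1 n s)))) with
    (dot (er1 n s) (er1 n s) + dt * (2 * dot (er1 n s) (a1 n s)) + dt * dt * dot (a1 n s) (a1 n s)) by vring.
  rewrite <- !norm2_sq. set (x := norm2 (er1 n s)) in *. set (y := norm2 (a1 n s)) in *.
  assert (Y' := young (/ 16) y (2 * x) ltac:(lra)).
  replace (/ (4 * / 16)) with 4 in Y' by field.
  assert (2 * dot (er1 n s) (a1 n s) <= / 8 * (y * y) + 8 * (x * x)).
  { assert (0 <= (y - 8 * x) * (y - 8 * x)) by apply Rle_0_sqr. lra. }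
  assert (dt * (2 * dot (er1 n s) (a1 n s)) <= dt * (/ 8 * (y * y) + 8 * (x * x))) by (apply Rmult_le_compat_l; lra).
  lra.
Qed.

Lemma I_nonneg f : pv P f -> 0 <= pI (fun s => dot (f s) (f s)).
Proof. intros Hf. apply (I_ge0 P); [pc|]. apply on_cells_all. intros; apply dot_ge0. Qed.

Lemma sup_a n : (n < M)%nat -> feU n -> feU (S n) -> forall s, dot (a n s) (a n s) <= 2 * (A n + A1 n).
Proof.
  intros Hn HU HU' s. assert (Fa := a_fe n Hn HU HU').
  eapply Rle_trans; [apply (fe_sup k P _ Fa)|]. apply Req_le. unfold A, A1. do 2 f_equal.
  assert (P1 := fe_pv_dS _ _ _ Fa). assert (P2 := pv_a1 n Hn HU HU').
  apply (I_ext P); [pc|pc|]. eapply on_cells_imp; [|apply (a_dS n Hn HU HU')].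
  intros x Ex. cbv beta in *. rewrite Ex. auto.
Qed.

(** One factor is taken in the sup norm by [sup_a], the other in L2; here the single space dimension
    enters. *)
Lemma quartic n n' : (n < M)%nat -> feU n -> feU (S n) -> (n' < M)%nat -> feU n' -> feU (S n') ->
  pI (fun s => dot (a n s) (a n s) * dot (a n' s) (a n' s)) <= 2 * (A n + A1 n) * A n'.
Proof.
  intros H1 H2 H3 H4 H5 H6. assert (P1 := pv_a n H1 H2 H3). assert (P2 := pv_a n' H4 H5 H6).
  unfold A at 2. rewrite <- (I_scal P) by pc. apply (I_le P); [pc|pc|].
  apply on_cells_all. intros s. apply Rmult_le_compat_r; [apply dot_ge0|]. apply sup_a; auto.
Qed.

(** The increment of the forcing contains d_s e, hence the summand E. Half of the dissipation, 1/2
    dt A1 n, is kept to pay for the terms with [a1 n] that appear one step later, and H^2 makes the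
    recursion homogeneous. *)
Definition Yn (n : nat) : R := / 2 * g n + E (S n) + / 2 * dt * A1 n + H * H.

(** The scheme starts at the projection, so the error vanishes at level 0, the forcing reduces to
    [z 0], and the derivative of the error at level 1 is dt times that of the first quotient.
    Testing with this quotient bounds it by H without a factor 1/dt. *)
Lemma Y_base : (0 < M)%nat -> (forall s, U O s = Rn O s) -> scheme_at alpha k P dt U 0 ->
  good 0 /\ (dt <= 1 -> Yn 0 <= (8 * (K * K) / lam + 1) * (H * H)).
Proof.
  intros HM E0 Hs. assert (HU : feU O).
  { unfold feU. replace (U O) with (Rn O) by (extensionality s; auto). apply (ad_fe _ _ _ _ _ _ _ _ _ _ data); lia. }
  assert (HU' : feU 1) by apply Hs.
  assert (e10 : forall s, er1 O s = (0, 0)).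
  { intros s. unfold er1. replace (U O) with (Rn O) by (extensionality x; auto). vring. }
  assert (G : good 0).
  { apply on_cells_all. intros s. rewrite e10. replace (norm2 (0, 0)) with 0.
    - apply Rmin_glb; lra.
    - unfold norm2, dot; simpl. rewrite !Rmult_0_l, Rplus_0_l, sqrt_0. auto. }
  split; auto. intros Hdt1.
  assert (Fa := a_fe 0 HM HU HU'). assert (Q := err_eq 0 (a 0) HM HU Hs Fa).
  assert (P1 := pv_a 0 HM HU HU'). assert (P2 := pv_a1 0 HM HU HU').
  assert (P3 := pv_F 0 HM HU). assert (P4 := pv_U1 0 HU). assert (P5 := pv_er1 1 ltac:(lia) HU').
  assert (P6 := fe_pv_dS _ _ _ Fa).
  change (g 0 + pI (fun s => dot (er1 1 s) (dS (a 0) s)) = pI (fun s => dot (F 0 s) (a 0 s))) in Q.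
  assert (e11 : forall s, er1 1 s = vscl dt (a1 0 s)).
  { intros s. unfold a1, dq. rewrite e10. rewrite (surjective_pairing (er1 1 s)).
    unfold vscl, vsub; simpl. f_equal; field; lra. }
  assert (Q1 : pI (fun s => dot (er1 1 s) (dS (a 0) s)) = dt * A1 0).
  { unfold A1. rewrite <- (I_scal P) by pc. apply (I_ext P); [pc|pc|].
    eapply on_cells_imp; [|apply (a_dS 0 HM HU HU')]. intros s Es. cbv beta in *. rewrite Es, e11. vring. }
  assert (Q2 : E 1 = dt * dt * A1 0).
  { unfold E, A1. rewrite <- (I_scal P) by pc. apply RI_ext; [generalize twoPI; lra|]. intros s _. rewrite e11. vring. }
  assert (L := lam_pos). assert (PI4 := PI_4).
  assert (Q3 : pI (fun s => dot (F 0 s) (a 0 s)) <= / 2 * g 0 + 4 * (K * K) / lam * (H * H)).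
  { apply Rle_trans with (pI (fun s => / 2 * dot (tri alpha (dS (U 0) s) (dS (U 0) s) (a 0 s)) (a 0 s) +
       K * K * (H * H) / (2 * lam))).
    - apply (I_le P); [pc|pc|].
      assert (Gc := good_coer 0 ltac:(lia) G). assert (Gz := ad_zb _ _ _ _ _ _ _ _ _ _ data 0 HM).
      eapply on_cells_imp2; [|apply Gc|apply Gz]. intros s C1 C2. cbv beta in *.
      specialize (C1 (a 0 s)).
      replace (F 0 s) with (z 0 s).
      2:{ unfold F. replace (U 0) with (Rn 0) by (extensionality x; auto).
          rewrite (surjective_pairing (z 0 s)). vring. }
      eapply Rle_trans; [apply dot_le'|]. assert (N' := norm2_ge0 (z 0 s)).
      assert (Y := young (lam / 2) (norm2 (a 0 s)) (norm2 (z 0 s)) ltac:(lra)).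
      rewrite norm2_sq in Y.
      replace (/ (4 * (lam / 2))) with (/ (2 * lam)) in Y by (field; lra).
      assert (norm2 (z 0 s) * norm2 (z 0 s) <= K * H * (K * H)) by (apply Rmult_le_compat; auto).
      assert (IL : 0 < / (2 * lam)) by (apply Rinv_0_lt_compat; lra).
      assert (/ (2 * lam) * (norm2 (z 0 s) * norm2 (z 0 s)) <= / (2 * lam) * (K * H * (K * H))) by (apply Rmult_le_compat_l; lra).
      replace (K * K * (H * H) / (2 * lam)) with (/ (2 * lam) * (K * H * (K * H))) by (field; lra).
      lra.
    - rewrite (I_plus P), (I_scal P), I_const by pc. fold (g 0).
      apply Rplus_le_compat_l.
      replace (4 * (K * K) / lam * (H * H)) with (K * K * (H * H) / (2 * lam) * 8) by (field; lra).
      apply Rmult_le_compat_l; [|lra].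
      apply Rdiv_le_0_compat; [|lra]. repeat apply Rmult_le_pos; lra. }
  assert (A10 : 0 <= A1 0) by (apply I_nonneg; auto).
  unfold Yn. rewrite Q2. rewrite Q1 in Q.
  assert (dt * A1 0 >= 0) by (apply Rle_ge, Rmult_le_pos; lra).
  assert (dt * (dt * A1 0) <= 1 * (dt * A1 0)) by (apply Rmult_le_compat_r; lra).
  assert (0 <= g 0).
  { eapply Rle_trans; [|apply (A_le_g 0 HM G HU HU')]. apply Rmult_le_pos; [lra|apply I_nonneg; auto]. }
  replace ((8 * (K * K) / lam + 1) * (H * H)) with (2 * (4 * (K * K) / lam * (H * H)) + H * H) by (unfold Rdiv; ring).
  lra.
Qed.

(** The error equations at levels n and n + 1 are subtracted and tested with the new quotient; the
    stiffness terms leave dt [A1 (S n)]. By [quartic], the threshold on [A n] turns the quartic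
    terms into 1/8 of A + A1 at both levels, so that their A1 parts are absorbed. *)
Lemma Y_step c n : 1 <= c -> rough_bound alpha K c -> dt <= / 8 -> (S n < M)%nat -> feU n ->
  scheme_at alpha k P dt U n -> scheme_at alpha k P dt U (S n) -> good n -> good (S n) ->
  A n <= / (16 * c) ->
  Yn (S n) <= Yn n + dt * ((c + 9) * (2 / lam + 8)) * (Yn (S n) + Yn n).
Proof.
  intros Hc HB Hdt8 Hn HU Sn SSn Gn GSn HA.
  assert (HU1 : feU (S n)) by apply Sn. assert (HU2 : feU (S (S n))) by apply SSn.
  assert (Fa := a_fe (S n) Hn HU1 HU2).
  assert (Q1 := err_eq n (a (S n)) ltac:(lia) HU Sn Fa).
  assert (Q2 := err_eq (S n) (a (S n)) Hn HU1 SSn Fa).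
  assert (P1 := pv_a n ltac:(lia) HU HU1). assert (P2 := pv_a (S n) Hn HU1 HU2).
  assert (P3 := pv_a1 n ltac:(lia) HU HU1). assert (P4 := pv_a1 (S n) Hn HU1 HU2).
  assert (P5 := pv_F n ltac:(lia) HU). assert (P6 := pv_F (S n) Hn HU1).
  assert (P7 := pv_U1 n HU). assert (P8 := pv_U1 (S n) HU1).
  assert (P9 := pv_er1 (S n) ltac:(lia) HU1). assert (P10 := pv_er1 (S (S n)) ltac:(lia) HU2).
  assert (P11 := fe_pv_dS _ _ _ Fa).
  assert (D1 : pI (fun s => dot (er1 (S (S n)) s) (dS (a (S n)) s)) - pI (fun s => dot (er1 (S n) s) (dS (a (S n)) s)) = dt * A1 (S n)).
  { unfold A1. rewrite <- (I_minus P), <- (I_scal P) by pc. apply (I_ext P); [pc|pc|].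
    eapply on_cells_imp; [|apply (a_dS (S n) Hn HU1 HU2)]. intros s Es. cbv beta in *. rewrite Es.
    replace (er1 (S (S n)) s) with (vadd (er1 (S n) s) (vscl dt (a1 (S n) s))) by (apply vadd_quot; lra). vring. }
  set (T := fun n s => tri alpha (dS (U n) s) (dS (U n) s) (a n s)) in *.
  change (pI (fun s => dot (T n s) (a (S n) s)) + pI (fun s => dot (er1 (S n) s) (dS (a (S n)) s)) =
    pI (fun s => dot (F n s) (a (S n) s))) in Q1.
  change (g (S n) + pI (fun s => dot (er1 (S (S n)) s) (dS (a (S n)) s)) =
    pI (fun s => dot (F (S n) s) (a (S n) s))) in Q2.
  assert (PT1 : pv P (T n)) by (unfold T; pc). assert (PT2 : pv P (T (S n))) by (unfold T; pc).
  set (Rem := fun s => / 8 * dot (a1 n s) (a1 n s) +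
     c * (dot (a (S n) s) (a (S n) s) * dot (a n s) (a n s) + dot (a n s) (a n s) * dot (a n s) (a n s)) +
     c * (dot (a (S n) s) (a (S n) s) + dot (a n s) (a n s) + dot (er1 (S n) s) (er1 (S n) s) + H * H)).
  assert (PRem : pcont P Rem) by (unfold Rem; pc).
  assert (Pw : pI (fun s => / 2 * dot (T (S n) s) (a (S n) s) - / 2 * dot (T n s) (a n s)) <=
     pI (fun s => (dot (T (S n) s) (a (S n) s) - dot (T n s) (a (S n) s)) -
        (dot (F (S n) s) (a (S n) s) - dot (F n s) (a (S n) s)) + dt * Rem s)).
  { apply (I_le P); [pc|pc|]. intros j Hj s Hs.
    assert (B0 := good_bounds n ltac:(lia) Gn j Hj s Hs). assert (B1 := good_bounds (S n) ltac:(lia) GSn j Hj s Hs).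
    assert (B2 := ad_R1 _ _ _ _ _ _ _ _ _ _ data n ltac:(lia) j Hj s Hs).
    assert (B3 := ad_R1 _ _ _ _ _ _ _ _ _ _ data (S n) ltac:(lia) j Hj s Hs).
    assert (B4 := ad_dR1 _ _ _ _ _ _ _ _ _ _ data n ltac:(lia) j Hj s Hs).
    assert (B5 := ad_q _ _ _ _ _ _ _ _ _ _ data n ltac:(lia) j Hj s Hs).
    assert (B6 := ad_dq _ _ _ _ _ _ _ _ _ _ data n ltac:(lia) j Hj s Hs).
    assert (B7 := ad_dz _ _ _ _ _ _ _ _ _ _ data n ltac:(lia) j Hj s Hs).
    cbv beta in *.
    assert (N4 := norm2_quot dt _ _ _ hdt B4). assert (N6 := norm2_quot dt _ _ _ hdt B6). assert (N7 := norm2_quot dt _ _ _ hdt B7).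
    assert (X := HB dt H (dS (U n) s) (vscl (/ dt) (vsub (dS (U (S n)) s) (dS (U n) s)))
      (dS (Rn n) s) (vscl (/ dt) (vsub (dS (Rn (S n)) s) (dS (Rn n) s)))
      (dq dt Rn n s) (vscl (/ dt) (vsub (dq dt Rn (S n) s) (dq dt Rn n s)))
      (z n s) (vscl (/ dt) (vsub (z (S n) s) (z n s))) (a (S n) s) (a n s) hdt (Rlt_le _ _ hH)).
    cbv zeta in X. rewrite !vadd_quot in X by lra.
    specialize (X ltac:(lra) ltac:(lra) N4 B5 N6 N7 ltac:(lra) ltac:(lra) ltac:(apply B1)).
    fold (er1 (S n) s) in X.
    replace (vsub (vscl (/ dt) (vsub (dS (Rn (S n)) s) (dS (Rn n) s))) (vscl (/ dt) (vsub (dS (U (S n)) s) (dS (U n) s))))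
      with (a1 n s) in X by (unfold a1, dq, er1; vring).
    fold (T (S n) s) (T n s) in X.
    fold (F (S n) s) (F n s) in X. fold (Rem s) in X.
    replace (dot (T (S n) s) (a (S n) s) - dot (T n s) (a (S n) s)) with (dot (vsub (T (S n) s) (T n s)) (a (S n) s)) by vring.
    replace (dot (F (S n) s) (a (S n) s) - dot (F n s) (a (S n) s)) with (dot (vsub (F (S n) s) (F n s)) (a (S n) s)) by vring.
    exact X. }
  rewrite !(I_minus P), !(I_scal P) in Pw by pc.
  rewrite (I_plus P), !(I_minus P), (I_scal P) in Pw by pc.
  change (pI (fun s => dot (T (S n) s) (a (S n) s))) with (g (S n)) in *.
  change (pI (fun s => dot (T n s) (a n s))) with (g n) in *.
  assert (L := lam_pos).
  assert (NA := I_nonneg _ P1). assert (NA' := I_nonneg _ P2). assert (NA1 := I_nonneg _ P3). assert (NA1' := I_nonneg _ P4).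
  assert (NE := I_nonneg _ P9).
  fold (A n) in NA. fold (A (S n)) in NA'. fold (A1 n) in NA1. fold (A1 (S n)) in NA1'. fold (E (S n)) in NE.
  assert (R1 : pI Rem <= / 8 * A1 n + / 8 * (A (S n) + A1 (S n) + A n + A1 n) + c * (A (S n) + A n + E (S n) + 8 * (H * H))).
  { unfold Rem. rewrite !(I_plus P), !(I_scal P), !(I_plus P), I_const by pc.
    fold (A1 n) (A n) (A (S n)) (E (S n)).
    assert (q1 := quartic (S n) n Hn HU1 HU2 ltac:(lia) HU HU1).
    assert (q2 := quartic n n ltac:(lia) HU HU1 ltac:(lia) HU HU1).
    assert (M1 : 2 * (A (S n) + A1 (S n)) * A n <= 2 * (A (S n) + A1 (S n)) * / (16 * c)) by (apply Rmult_le_compat_l; lra).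
    assert (M2 : 2 * (A n + A1 n) * A n <= 2 * (A n + A1 n) * / (16 * c)) by (apply Rmult_le_compat_l; lra).
    assert (q3 : c * (pI (fun s => dot (a (S n) s) (a (S n) s) * dot (a n s) (a n s)) + pI (fun s => dot (a n s) (a n s) * dot (a n s) (a n s)))
       <= c * (2 * (A (S n) + A1 (S n)) * / (16 * c) + 2 * (A n + A1 n) * / (16 * c))) by (apply Rmult_le_compat_l; lra).
    replace (c * (2 * (A (S n) + A1 (S n)) * / (16 * c) + 2 * (A n + A1 n) * / (16 * c))) with
      (/ 8 * (A (S n) + A1 (S n) + A n + A1 n)) in q3 by (field; lra).
    assert (pp : H * H * (2 * PI) <= 8 * (H * H)).
    { rewrite (Rmult_comm 8). apply Rmult_le_compat_l; [nra|]. assert (PB := PI_4). lra. }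
    assert (c * (A (S n) + A n + E (S n) + H * H * (2 * PI)) <= c * (A (S n) + A n + E (S n) + 8 * (H * H))) by (apply Rmult_le_compat_l; lra).
    lra. }
  assert (Es := E_step (S n) Hn HU1 HU2).
  (* The bound dt <= 1/8 puts the second order term of [E_step] under the dissipation. *)
  assert (dA : dt * dt * A1 (S n) <= dt * (/ 8 * A1 (S n))).
  { rewrite Rmult_assoc. apply Rmult_le_compat_l; [lra|]. apply Rmult_le_compat_r; lra. }
  assert (G1 := A_le_g n ltac:(lia) Gn HU HU1). assert (G2 := A_le_g (S n) Hn GSn HU1 HU2).
  assert (HH : 0 <= H * H) by nra.
  assert (dA1 : 0 <= dt * A1 n) by (apply Rmult_le_pos; lra). assert (dA2 : 0 <= dt * A1 (S n)) by (apply Rmult_le_pos; lra).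
  assert (NE2 : 0 <= E (S (S n))) by (apply I_nonneg; auto).
  assert (gn0 : 0 <= g n) by (eapply Rle_trans; [|apply G1]; apply Rmult_le_pos; lra).
  assert (gn1 : 0 <= g (S n)) by (eapply Rle_trans; [|apply G2]; apply Rmult_le_pos; lra).
  assert (R2' := Rmult_le_compat_l dt _ _ (Rlt_le _ _ hdt) R1).
  assert (S1 : Yn (S n) <= Yn n + dt * (c + 9) * (A (S n) + A n + E (S n) + 8 * (H * H))).
  { unfold Yn.
    assert (0 <= dt * E (S n)) by (apply Rmult_le_pos; lra).
    assert (0 <= dt * A n) by (apply Rmult_le_pos; lra).
    assert (0 <= dt * A (S n)) by (apply Rmult_le_pos; lra).
    assert (0 <= dt * (H * H)) by (apply Rmult_le_pos; lra).
    lra. }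
  assert (W : A (S n) + A n + E (S n) + 8 * (H * H) <= (2 / lam + 8) * (Yn (S n) + Yn n)).
  { assert (X1 : A (S n) <= 2 / lam * Yn (S n)).
    { apply (Rmult_le_reg_l lam); auto. replace (lam * (2 / lam * Yn (S n))) with (2 * Yn (S n)) by (field; lra). unfold Yn. lra. }
    assert (X2 : A n <= 2 / lam * Yn n).
    { apply (Rmult_le_reg_l lam); auto. replace (lam * (2 / lam * Yn n)) with (2 * Yn n) by (field; lra). unfold Yn. lra. }
    assert (X3 : E (S n) + 8 * (H * H) <= 8 * Yn n) by (unfold Yn; lra).
    assert (X4 : 0 <= Yn (S n)) by (unfold Yn; lra). lra. }
  eapply Rle_trans; [apply S1|]. apply Rplus_le_compat_l.
  replace (dt * ((c + 9) * (2 / lam + 8)) * (Yn (S n) + Yn n)) with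
    (dt * (c + 9) * ((2 / lam + 8) * (Yn (S n) + Yn n))) by ring.
  apply Rmult_le_compat_l; auto.
  apply Rmult_le_pos; lra.
Qed.

(** At a fixed level the error equation reads (d_s e, d_s xi) = (f, xi) with f = F - G(U) a, and
    [HD], the conclusion of [fe_derive_sup], only asks for f in L1. Pointwise f is bounded by |a| +
    |d_s e| + H, which is of size H in L1. *)
Lemma sup_step C c7 n : 0 <= C -> 0 <= c7 ->
  (forall u f, fe_scalar k P u -> pcont P f ->
    (forall xi, fe_scalar k P xi -> pI (fun s => Derive u s * Derive xi s) = pI (fun s => f s * xi s)) ->
    on_cells P (fun s => Rabs (Derive u s) <= C * pI (fun s => Rabs (f s)))) ->
  (n < M)%nat -> feU n -> scheme_at alpha k P dt U n -> good n ->
  A n <= c7 * (H * H) -> E n <= c7 * (H * H) ->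
  on_cells P (fun s => norm2 (er1 (S n) s) <= 2 * C * (4 * Ca alpha * (K * K) * (c7 + 16)) * H).
Proof.
  intros HC Hc7 HD Hn HU Sn Gn HA HE. assert (HU' : feU (S n)) by apply Sn.
  assert (P1 := pv_a n Hn HU HU'). assert (P2 := pv_U1 n HU). assert (P3 := pv_F n Hn HU).
  assert (P4 := pv_er1 (S n) ltac:(lia) HU'). assert (P5 := pv_er1 n ltac:(lia) HU).
  set (f := fun s => vsub (F n s) (tri alpha (dS (U n) s) (dS (U n) s) (a n s))).
  assert (Pf : pv P f) by (unfold f; pc).
  assert (Fe := er_fe (S n) ltac:(lia) HU'). assert (De := er_dS (S n) ltac:(lia) HU').
  set (c8 := 4 * Ca alpha * (K * K)). assert (C1 := Ca_ge1 alpha).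
  assert (c80 : 0 <= c8) by (unfold c8; repeat apply Rmult_le_pos; lra).
  assert (Bf : on_cells P (fun s => norm2 (f s) <= c8 * (norm2 (a n s) + norm2 (er1 n s) + H))).
  { intros j Hj s Hs.
    assert (B0 := good_bounds n ltac:(lia) Gn j Hj s Hs).
    assert (B2 := ad_R1 _ _ _ _ _ _ _ _ _ _ data n ltac:(lia) j Hj s Hs).
    assert (B5 := ad_q _ _ _ _ _ _ _ _ _ _ data n Hn j Hj s Hs).
    assert (B7 := ad_zb _ _ _ _ _ _ _ _ _ _ data n Hn j Hj s Hs). cbv beta in *.
    unfold f, F. set (V := dS (U n) s) in *. set (r := dS (Rn n) s) in *. set (q := dq dt Rn n s) in *.
    replace (vsub (tri alpha V V q) (tri alpha r r q)) with
      (vscl (-1) (vadd (tri alpha (er1 n s) r q) (tri alpha V (er1 n s) q)))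
      by (unfold er1; fold V r; vring).
    set (e := norm2 (er1 n s)) in *. set (x := norm2 (a n s)).
    assert (e0 : 0 <= e) by apply norm2_ge0. assert (x0 : 0 <= x) by apply norm2_ge0.
    assert (T1 := norm2_tri_le alpha (er1 n s) r q e K K (Rle_refl _) ltac:(lra) B5).
    assert (T2 := norm2_tri_le alpha V (er1 n s) q (K + 1) e K ltac:(lra) (Rle_refl _) B5).
    assert (T3 := norm2_tri_le alpha V V (a n s) (K + 1) (K + 1) x ltac:(lra) ltac:(lra) (Rle_refl _)).
    eapply Rle_trans; [apply norm2_sub|].
    assert (norm2 (vadd (vscl (-1) (vadd (tri alpha (er1 n s) r q) (tri alpha V (er1 n s) q))) (z n s)) <=
       norm2 (tri alpha (er1 n s) r q) + norm2 (tri alpha V (er1 n s) q) + norm2 (z n s)).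
    { eapply Rle_trans; [apply norm2_add|]. rewrite norm2_scl. rewrite Rabs_left by lra.
      assert (Y := norm2_add (tri alpha (er1 n s) r q) (tri alpha V (er1 n s) q)). lra. }
    assert (KK : K <= K * K) by nra.
    assert (Z1 : Ca alpha * (e * K * K) + Ca alpha * ((K + 1) * e * K) <= c8 * e).
    { unfold c8. replace (Ca alpha * (e * K * K) + Ca alpha * ((K + 1) * e * K)) with (Ca alpha * e * (2 * (K * K) + K)) by ring.
      replace (4 * Ca alpha * (K * K) * e) with (Ca alpha * e * (4 * (K * K))) by ring.
      apply Rmult_le_compat_l; [apply Rmult_le_pos; lra|]. lra. }
    assert (Z2 : Ca alpha * ((K + 1) * (K + 1) * x) <= c8 * x).
    { unfold c8. rewrite <- Rmult_assoc. apply Rmult_le_compat_r; auto. rewrite (Rmult_comm 4), (Rmult_assoc (Ca alpha)). apply Rmult_le_compat_l; lra. }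
    assert (Z3 : K * H <= c8 * H) by (apply Rmult_le_compat_r; [lra|]; unfold c8; nra).
    lra. }
  assert (If : forall p : R2 -> R, pcont P (fun s => p (f s)) -> (forall v, Rabs (p v) <= norm2 v) ->
     pI (fun s => Rabs (p (f s))) <= c8 * (c7 + 16) * H).
  { intros p Pp Bp.
    (* Young's inequality with weight 1/(2 H) turns the squares, whose integrals are of size H^2,
       into an L1 bound linear in H; 16 bounds 2 times 2 pi. *)
    apply Rle_trans with (pI (fun s => c8 * ((/ (2 * H)) * (dot (a n s) (a n s) + dot (er1 n s) (er1 n s)) + 2 * H))).
    - apply (I_le P); [pc|pc|]. eapply on_cells_imp; [|apply Bf]. intros s Hs. cbv beta in *.
      eapply Rle_trans; [apply Bp|]. eapply Rle_trans; [apply Hs|]. apply Rmult_le_compat_l; auto.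
      rewrite <- !norm2_sq.
      assert (Y1 := young (/ (2 * H)) (norm2 (a n s)) 1 ltac:(apply Rinv_0_lt_compat; lra)).
      assert (Y2 := young (/ (2 * H)) (norm2 (er1 n s)) 1 ltac:(apply Rinv_0_lt_compat; lra)).
      replace (/ (4 * / (2 * H))) with (H / 2) in * by (field; lra). lra.
    - rewrite (I_scal P), (I_plus P), (I_scal P), (I_plus P), I_const by pc.
      fold (A n) (E n). rewrite (Rmult_assoc c8). apply Rmult_le_compat_l; auto.
      assert (/ (2 * H) * (A n + E n) <= / (2 * H) * (2 * (c7 * (H * H)))).
      { apply Rmult_le_compat_l; [apply Rlt_le, Rinv_0_lt_compat; lra|lra]. }
      replace (/ (2 * H) * (2 * (c7 * (H * H)))) with (c7 * H) in H0 by (field; lra).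
      assert (PB := PI_4). assert (2 * H * (2 * PI) <= 2 * H * 8) by (apply Rmult_le_compat_l; lra). lra. }
  assert (Dz : forall s : R, Derive (fun _ : R => 0) s = 0) by (intros; apply Derive_const).
  assert (X1 : on_cells P (fun s => Rabs (Derive (fun u => fst (er (S n) u)) s) <= C * pI (fun s => Rabs (fst (f s))))).
  { apply (HD (fun u => fst (er (S n) u)) (fun s => fst (f s))); [apply Fe|apply Pf|].
    intros xi Hx. assert (Hx2 := fe_space_pair _ _ _ _ Hx (fe_const k P 0)).
    assert (Q := err_eq n _ Hn HU Sn Hx2).
    assert (Px := fe_pv _ _ _ Hx2). assert (Px' := fe_pv_dS _ _ _ Hx2). assert (Pxi' := pc1_pcont _ _ _ (fe_pc1 _ _ _ Hx)).
    assert (Pe := pc1_pcont _ _ _ (fe_pc1 _ _ _ (proj1 Fe))).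
    transitivity (pI (fun s => dot (er1 (S n) s) (dS (fun s => (xi s, 0)) s))).
    - apply (I_ext P); [pc|pc|]. eapply on_cells_imp; [|apply De]. intros s Es. cbv beta in *. rewrite <- Es.
      unfold dot, dS; simpl. change (Derive (fun u : R => xi u) s) with (Derive xi s). rewrite Dz. ring.
    - transitivity (pI (fun s => dot (F n s) (xi s, 0) - dot (tri alpha (dS (U n) s) (dS (U n) s) (a n s)) (xi s, 0))).
      + rewrite (I_minus P) by pc. lra.
      + apply RI_ext; [generalize twoPI; lra|]. intros s _. unfold f. vring. }
  assert (X2 : on_cells P (fun s => Rabs (Derive (fun u => snd (er (S n) u)) s) <= C * pI (fun s => Rabs (snd (f s))))).
  { apply (HD (fun u => snd (er (S n) u)) (fun s => snd (f s))); [apply Fe|apply Pf|].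
    intros xi Hx. assert (Hx2 := fe_space_pair _ _ _ _ (fe_const k P 0) Hx).
    assert (Q := err_eq n _ Hn HU Sn Hx2).
    assert (Px := fe_pv _ _ _ Hx2). assert (Px' := fe_pv_dS _ _ _ Hx2). assert (Pxi' := pc1_pcont _ _ _ (fe_pc1 _ _ _ Hx)).
    assert (Pe := pc1_pcont _ _ _ (fe_pc1 _ _ _ (proj2 Fe))).
    transitivity (pI (fun s => dot (er1 (S n) s) (dS (fun s => (0, xi s)) s))).
    - apply (I_ext P); [pc|pc|]. eapply on_cells_imp; [|apply De]. intros s Es. cbv beta in *. rewrite <- Es.
      unfold dot, dS; simpl. change (Derive (fun u : R => xi u) s) with (Derive xi s). rewrite Dz. ring.
    - transitivity (pI (fun s => dot (F n s) (0, xi s) - dot (tri alpha (dS (U n) s) (dS (U n) s) (a n s)) (0, xi s))).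
      + rewrite (I_minus P) by pc. lra.
      + apply RI_ext; [generalize twoPI; lra|]. intros s _. unfold f. vring. }
  assert (I1 := If fst (proj1 Pf) Rabs_fst_le). assert (I2 := If snd (proj2 Pf) Rabs_snd_le).
  intros j Hj s Hs. specialize (X1 j Hj s Hs). specialize (X2 j Hj s Hs). specialize (De j Hj s Hs). cbv beta in *.
  rewrite <- De. eapply Rle_trans; [apply norm2_le_abs|].
  assert (C * pI (fun s => Rabs (fst (f s))) <= C * (c8 * (c7 + 16) * H)) by (apply Rmult_le_compat_l; auto).
  assert (C * pI (fun s => Rabs (snd (f s))) <= C * (c8 * (c7 + 16) * H)) by (apply Rmult_le_compat_l; auto).
  change (Rabs (Derive (fun u => fst (er (S n) u)) s) + Rabs (Derive (fun u => snd (er (S n) u)) s)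
    <= 2 * C * (c8 * (c7 + 16)) * H). lra.
Qed.

Lemma pow_le_exp x n : 0 <= x -> (1 + x) ^ n <= exp (INR n * x).
Proof.
  intros Hx. induction n as [|n IH]; [simpl; rewrite Rmult_0_l, exp_0; lra|].
  rewrite S_INR. replace ((INR n + 1) * x) with (x + INR n * x) by ring. rewrite exp_plus.
  simpl. apply Rmult_le_compat; auto; [lra|apply pow_le; lra|apply exp_ineq1_le].
Qed.

(** Gronwall step with the new value also on the right: (1 + x)/(1 - x) <= 1 + 4 x for x <= 1/2. *)
Lemma implicit_growth x y y' : 0 <= x <= / 2 -> 0 <= y -> y' <= y + x * (y' + y) ->
  y' <= (1 + 4 * x) * y.
Proof.
  intros Hx Hy H1. apply (Rmult_le_reg_l (1 - x)); [lra|].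
  assert (0 <= x * (1 - 2 * x) * y) by (repeat apply Rmult_le_pos; lra). lra.
Qed.

Lemma Y_nonneg n : (n < M)%nat -> feU n -> feU (S n) -> good n ->
  A n <= 2 / lam * Yn n /\ E (S n) <= Yn n /\ 0 <= Yn n.
Proof.
  intros Hn HU HU' G. assert (L := lam_pos).
  assert (G1 := A_le_g n Hn G HU HU').
  assert (N1 := I_nonneg _ (pv_a n Hn HU HU')). assert (N2 := I_nonneg _ (pv_a1 n Hn HU HU')).
  assert (N3 := I_nonneg _ (pv_er1 (S n) ltac:(lia) HU')).
  fold (A n) in N1. fold (A1 n) in N2. fold (E (S n)) in N3.
  assert (0 <= dt * A1 n) by (apply Rmult_le_pos; lra). assert (0 <= H * H) by nra.
  assert (0 <= lam * A n) by (apply Rmult_le_pos; lra).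
  split; [|unfold Yn; split; lra].
  apply (Rmult_le_reg_l lam); auto. replace (lam * (2 / lam * Yn n)) with (2 * Yn n) by (field; lra).
  unfold Yn. lra.
Qed.

(** The growth rate of the recursion in [Y_step]; then [c6], the resulting Gronwall bound for Y/H^2
    up to time T, and [c7], a common bound for A/H^2 and E/H^2. *)
Definition c5 (c : R) : R := (c + 9) * (2 / lam + 8).
Definition c6 (c T : R) : R := (8 * (K * K) / lam + 1) * exp (4 * c5 c * T).
Definition c7 (c T : R) : R := (2 / lam + 1) * c6 c T.

(** A step is assumed to exist only under [good], because solvability needs the lower bound on |d_s
    U|. The bound on [Yn n] gives [good (S n)] by [sup_step]; hence the next step exists and
    [Y_step] bounds [Yn (S n)]. The two smallness conditions on H secure the quartic threshold and
    [good] respectively. *)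
Lemma bootstrap c C T : 1 <= c -> rough_bound alpha K c -> 0 <= C ->
  (forall u f, fe_scalar k P u -> pcont P f ->
    (forall xi, fe_scalar k P xi -> pI (fun s => Derive u s * Derive xi s) = pI (fun s => f s * xi s)) ->
    on_cells P (fun s => Rabs (Derive u s) <= C * pI (fun s => Rabs (f s)))) ->
  dt <= / 8 -> dt * c5 c <= / 2 -> INR M * dt <= T ->
  c7 c T * (H * H) <= / (16 * c) ->
  2 * C * (4 * Ca alpha * (K * K) * (c7 c T + 16)) * H <= Rmin (m / 2) 1 ->
  (forall s, U O s = Rn O s) ->
  (forall n, (n < M)%nat -> feU n -> good n -> scheme_at alpha k P dt U n) ->
  feU 0 /\ good 0 /\
  forall n, (n < M)%nat -> scheme_at alpha k P dt U n /\ feU (S n) /\ good (S n).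
Proof.
  intros Hc HB HC HD Hdt8 Hdt5 HT Hs1 Hs2 H0 HS.
  assert (L := lam_pos). assert (HH : 0 <= H * H) by nra.
  assert (HU0 : feU O).
  { unfold feU. replace (U O) with (Rn O) by (extensionality s; auto). apply (ad_fe _ _ _ _ _ _ _ _ _ _ data); lia. }
  assert (e10 : forall s, er1 O s = (0, 0)).
  { intros s. unfold er1. replace (U O) with (Rn O) by (extensionality x; auto). vring. }
  assert (E0 : E 0 = 0).
  { unfold E. rewrite <- (Rmult_0_l (2 * PI)), <- I_const. apply RI_ext; [generalize twoPI; lra|].
    intros s _. rewrite e10. vring. }
  assert (G0 : good 0).
  { apply on_cells_all. intros s. rewrite e10. replace (norm2 (0, 0)) with 0.
    - apply Rmin_glb; lra.
    - unfold norm2, dot; simpl. rewrite !Rmult_0_l, Rplus_0_l, sqrt_0. auto. }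
  split; auto. split; auto.
  assert (I2 : 0 < 2 / lam) by (apply Rdiv_lt_0_compat; lra).
  assert (C5 : 0 <= c5 c) by (unfold c5; apply Rmult_le_pos; lra).
  set (B0 := 8 * (K * K) / lam + 1).
  assert (B00 : 0 <= B0). { unfold B0. assert (0 <= 8 * (K * K) / lam); [|lra]. apply Rdiv_le_0_compat; nra. }
  assert (x0 : 0 <= 4 * (dt * c5 c)) by (assert (0 <= dt * c5 c) by (apply Rmult_le_pos; lra); lra).
  assert (Pe : forall n, (n <= M)%nat -> B0 * (H * H) * (1 + 4 * (dt * c5 c)) ^ n <= c6 c T * (H * H)).
  { intros n Hn. unfold c6. fold B0.
    replace (B0 * exp (4 * c5 c * T) * (H * H)) with (B0 * (H * H) * exp (4 * c5 c * T)) by ring.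
    apply Rmult_le_compat_l; [apply Rmult_le_pos; auto|].
    eapply Rle_trans; [apply pow_le_exp; auto|].
    assert (INR n * (4 * (dt * c5 c)) <= 4 * c5 c * T).
    { assert (INR n <= INR M) by (apply le_INR; auto).
      assert (INR n * dt <= T) by (assert (INR n * dt <= INR M * dt) by (apply Rmult_le_compat_r; lra); lra).
      replace (INR n * (4 * (dt * c5 c))) with (4 * c5 c * (INR n * dt)) by ring. apply Rmult_le_compat_l; lra. }
    destruct H1 as [H1|H1]; [left; apply exp_increasing; auto|rewrite H1; lra]. }
  assert (C6 : 0 <= c6 c T) by (unfold c6; fold B0; apply Rmult_le_pos; auto; left; apply exp_pos).
  assert (C67 : c6 c T <= c7 c T) by (unfold c7; assert (0 <= 2 / lam * c6 c T) by (apply Rmult_le_pos; lra); lra).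
  assert (A67 : forall n y, y <= c6 c T * (H * H) -> A n <= 2 / lam * y -> A n <= c7 c T * (H * H)).
  { intros n y Hy Ha. unfold c7. assert (2 / lam * y <= 2 / lam * (c6 c T * (H * H))) by (apply Rmult_le_compat_l; lra).
    assert (0 <= c6 c T * (H * H)) by (apply Rmult_le_pos; auto). lra. }
  assert (Step : forall n, (n < M)%nat -> feU n -> good n -> E n <= c7 c T * (H * H) ->
     scheme_at alpha k P dt U n -> Yn n <= c6 c T * (H * H) -> good (S n)).
  { intros n Hn HU G HE Hs HY. assert (HU' : feU (S n)) by apply Hs.
    destruct (Y_nonneg n Hn HU HU' G) as [Ya [Yb Yc]].
    eapply on_cells_imp; [|apply (sup_step C (c7 c T) n); auto; [lra|apply (A67 n (Yn n)); auto]].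
    intros s Hb. cbv beta in *. lra. }
  assert (Main : forall n, (n < M)%nat -> feU n /\ good n /\ E n <= c7 c T * (H * H) /\ scheme_at alpha k P dt U n /\
     Yn n <= B0 * (H * H) * (1 + 4 * (dt * c5 c)) ^ n).
  { induction n as [|n IH]; intros Hn.
    - repeat (split; auto).
      + rewrite E0. apply Rmult_le_pos; lra.
      + simpl. rewrite Rmult_1_r. apply Y_base; auto. lra.
    - destruct (IH ltac:(lia)) as (HU & G & HE & Hs & HY).
      assert (HU' : feU (S n)) by apply Hs.
      assert (HY6 := Rle_trans _ _ _ HY (Pe n ltac:(lia))).
      assert (G' := Step n ltac:(lia) HU G HE Hs HY6).
      assert (Hs' := HS (S n) Hn HU' G').
      destruct (Y_nonneg n ltac:(lia) HU HU' G) as [Ya [Yb Yc]].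
      assert (c6 c T * (H * H) <= c7 c T * (H * H)) by (apply Rmult_le_compat_r; auto).
      split; [auto|]. split; [auto|]. split; [lra|]. split; [auto|].
      (* The quartic threshold follows from the Gronwall bound on Y and the smallness of H. *)
      assert (An : A n <= / (16 * c)) by (assert (Z := A67 n (Yn n) HY6 Ya); lra).
      assert (Ys := Y_step c n Hc HB Hdt8 Hn HU Hs Hs' G G' An). fold (c5 c) in Ys.
      apply implicit_growth in Ys; auto; [|split; auto; apply Rmult_le_pos; lra].
      eapply Rle_trans; [apply Ys|]. simpl.
      replace (B0 * (H * H) * ((1 + 4 * (dt * c5 c)) * (1 + 4 * (dt * c5 c)) ^ n)) with
        ((1 + 4 * (dt * c5 c)) * (B0 * (H * H) * (1 + 4 * (dt * c5 c)) ^ n)) by ring.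
      apply Rmult_le_compat_l; [lra|auto]. }
  intros n Hn. destruct (Main n Hn) as (HU & G & HE & Hs & HY).
  assert (HU' : feU (S n)) by apply Hs. split; auto. split; auto.
  apply (Step n); auto. eapply Rle_trans; [apply HY|apply Pe; lia].
Qed.

(** * The error bound of order h^(k+1) + dt *)

Section Fine.
Context (J : R) (z2 z3 : nat -> R -> R2).
Hypothesis hz : forall n s, z n s = vadd (z2 n s) (z3 n s).
Hypothesis pz2 : forall n, (n < M)%nat -> pv P (z2 n).
Hypothesis bz3 : forall n, (n < M)%nat -> on_cells P (fun s => norm2 (z3 n s) <= K * J).
(** The part [z2] of the defect is small only against H^1 test functions. The weight 1/8 is low
    enough for its pairing with the error to be subtracted from the energy without destroying
    positivity. *)
Hypothesis wz2 : forall n, (n < M)%nat -> forall xi, fe_space k P xi ->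
  Rabs (pI (fun s => dot (z2 n s) (xi s))) <=
  / 8 * (pI (fun s => dot (xi s) (xi s)) + pI (fun s => dot (dS xi s) (dS xi s))) + K * (J * J).
Hypothesis wdz2 : forall n, (S n < M)%nat -> forall xi, fe_space k P xi ->
  Rabs (pI (fun s => dot (vsub (z2 (S n) s) (z2 n s)) (xi s))) <=
  dt * (pI (fun s => dot (xi s) (xi s)) + pI (fun s => dot (dS xi s) (dS xi s)) + K * (J * J)).

Let L (n : nat) : R := pI (fun s => dot (er n s) (er n s)).
(** The weak defect of level n paired with the error of level i; two indices allow summation by
    parts in time. *)
Let Q (n i : nat) : R := pI (fun s => dot (z2 n s) (er i s)).
Let C2 : R := Ca alpha * Ca alpha * (K * K * (K * K)).
Let c9 : R := 18 * C2 / lam + 16 * (K * K) / lam + 4 / lam.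

Lemma S_er n : (n <= M)%nat -> feU n ->
  pI (fun s => dot (dS (er n) s) (dS (er n) s)) = E n.
Proof.
  intros Hn HU. assert (P1 := fe_pv_dS _ _ _ (er_fe n Hn HU)). assert (P2 := pv_er1 n Hn HU).
  apply (I_ext P); [pc|pc|]. eapply on_cells_imp; [|apply (er_dS n Hn HU)].
  intros s Es. cbv beta in *. rewrite Es. auto.
Qed.

(** In the test with the quotient a, dt times the weak part is exactly Q n (S n) - Q n n and is
    moved into the energy. The L2 norm L is added because bounds on Q involve the full H^1 norm of
    the error; lam A pays for its growth. *)
Lemma fine_step n : (n < M)%nat -> feU n -> good n -> scheme_at alpha k P dt U n -> dt <= lam / 4 ->
  / 2 * E (S n) - Q n (S n) + L (S n) <= / 2 * E n - Q n n + L n + dt * c9 * (E n + L n + J * J).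
Proof.
  intros Hn HU G Hs Hdtl. assert (HU' : feU (S n)) by apply Hs.
  assert (Fa := a_fe n Hn HU HU'). assert (W := err_eq n (a n) Hn HU Hs Fa).
  assert (P1 := pv_a n Hn HU HU'). assert (P2 := pv_a1 n Hn HU HU').
  assert (P3 := pv_F n Hn HU).
  assert (P5 := pv_er1 n ltac:(lia) HU). assert (P6 := pv_er1 (S n) ltac:(lia) HU').
  assert (P7 := pv_er n ltac:(lia) HU). assert (P8 := pv_er (S n) ltac:(lia) HU'). assert (P11 := fe_pv_dS _ _ _ Fa).
  change (g n + pI (fun s => dot (er1 (S n) s) (dS (a n) s)) = pI (fun s => dot (F n s) (a n s))) in W.
  assert (l0 := lam_pos). assert (C1 := Ca_ge1 alpha).
  assert (Q1 : dt * pI (fun s => dot (er1 (S n) s) (dS (a n) s)) = / 2 * E (S n) - / 2 * E n + / 2 * (dt * dt * A1 n)).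
  { transitivity (pI (fun s => / 2 * dot (er1 (S n) s) (er1 (S n) s) - / 2 * dot (er1 n s) (er1 n s) + / 2 * (dt * dt * dot (a1 n s) (a1 n s)))).
    - rewrite <- (I_scal P) by pc. apply (I_ext P); [pc|pc|].
      eapply on_cells_imp; [|apply (a_dS n Hn HU HU')]. intros s Es. cbv beta in *. rewrite Es.
      replace (er1 (S n) s) with (vadd (er1 n s) (vscl dt (a1 n s))) by (apply vadd_quot; lra).
      unfold vadd, vscl, dot; simpl; field; lra.
    - rewrite (I_plus P), (I_minus P), !(I_scal P) by pc. reflexivity. }
  assert (Q2 : dt * pI (fun s => dot (z2 n s) (a n s)) = Q n (S n) - Q n n).
  { unfold Q. rewrite <- (I_scal P), <- (I_minus P) by pc. apply RI_ext; [generalize twoPI; lra|]. intros s _.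
    replace (er (S n) s) with (vadd (er n s) (vscl dt (a n s))) by (apply vadd_quot; lra). vring. }
  assert (Q3 : L (S n) <= L n + dt * (lam / 4 * A n + 4 / lam * L n) + dt * dt * A n).
  { unfold L, A. rewrite <- !(I_scal P), <- !(I_plus P), <- !(I_scal P), <- !(I_plus P) by pc.
    apply (I_le P); [pc|pc|]. apply on_cells_all. intros s. cbv beta.
    replace (er (S n) s) with (vadd (er n s) (vscl dt (a n s))) by (apply vadd_quot; lra).
    replace (dot (vadd (er n s) (vscl dt (a n s))) (vadd (er n s) (vscl dt (a n s)))) with
      (dot (er n s) (er n s) + dt * (2 * dot (er n s) (a n s)) + dt * dt * dot (a n s) (a n s)) by vring.
    assert (D := dot_le' (er n s) (a n s)). rewrite <- !norm2_sq.
    set (x := norm2 (er n s)) in *. set (y := norm2 (a n s)) in *.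
    assert (Y := young (lam / 4) y (2 * x) ltac:(lra)).
    replace (/ (4 * (lam / 4)) * (2 * x * (2 * x))) with (4 / lam * (x * x)) in Y by (field; lra).
    assert (dt * (2 * dot (er n s) (a n s)) <= dt * (lam / 4 * (y * y) + 4 / lam * (x * x))) by (apply Rmult_le_compat_l; lra).
    lra. }
  assert (Q4 : pI (fun s => dot (F n s) (a n s)) <=
     pI (fun s => dot (z2 n s) (a n s)) + (lam / 4 * A n + (18 * C2 / lam * E n + 16 * (K * K) / lam * (J * J)))).
  { apply Rle_trans with (pI (fun s => dot (z2 n s) (a n s) + (lam / 4 * dot (a n s) (a n s) +
       (18 * C2 / lam * dot (er1 n s) (er1 n s) + 2 * (K * K) / lam * (J * J))))).
    - apply (I_le P); [pc|pc|]. intros j Hj s Hsj.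
      assert (B0 := good_bounds n ltac:(lia) G j Hj s Hsj).
      assert (B2 := ad_R1 _ _ _ _ _ _ _ _ _ _ data n ltac:(lia) j Hj s Hsj).
      assert (B5 := ad_q _ _ _ _ _ _ _ _ _ _ data n Hn j Hj s Hsj).
      assert (B7 := bz3 n Hn j Hj s Hsj). cbv beta in *.
      unfold F. rewrite hz. set (V := dS (U n) s) in *. set (r := dS (Rn n) s) in *. set (q := dq dt Rn n s) in *.
      set (D := vadd (tri alpha (er1 n s) r q) (tri alpha V (er1 n s) q)).
      replace (dot (vadd (vsub (tri alpha V V q) (tri alpha r r q)) (vadd (z2 n s) (z3 n s))) (a n s)) with
        (dot (z2 n s) (a n s) + (dot (z3 n s) (a n s) - dot D (a n s)))
        by (unfold D, er1; fold V r; vring).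
      apply Rplus_le_compat_l. rewrite <- !norm2_sq.
      set (e := norm2 (er1 n s)) in *. set (x := norm2 (a n s)) in *.
      assert (e0 : 0 <= e) by apply norm2_ge0. assert (x0 : 0 <= x) by apply norm2_ge0.
      assert (T1 := norm2_tri_le alpha (er1 n s) r q e K K (Rle_refl _) ltac:(lra) B5).
      assert (T2 := norm2_tri_le alpha V (er1 n s) q (K + 1) e K ltac:(lra) (Rle_refl _) B5).
      assert (ND : norm2 D <= 3 * Ca alpha * (K * K) * e).
      { unfold D. eapply Rle_trans; [apply norm2_add|].
        assert (Ca alpha * (e * K * K) + Ca alpha * ((K + 1) * e * K) <= 3 * Ca alpha * (K * K) * e); [|lra].
        replace (Ca alpha * (e * K * K) + Ca alpha * ((K + 1) * e * K)) with (Ca alpha * e * (2 * (K * K) + K)) by ring.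
        replace (3 * Ca alpha * (K * K) * e) with (Ca alpha * e * (3 * (K * K))) by ring.
        apply Rmult_le_compat_l; [apply Rmult_le_pos; lra|]. nra. }
      assert (D1 := dot_le (z3 n s) (a n s)). assert (D2 := dot_le D (a n s)). fold x in D1, D2.
      apply Rabs_le_between in D1. apply Rabs_le_between in D2.
      assert (norm2 (z3 n s) * x <= x * (K * J)) by (rewrite (Rmult_comm x); apply Rmult_le_compat_r; auto).
      assert (norm2 D * x <= x * (3 * Ca alpha * (K * K) * e)) by (rewrite (Rmult_comm x); apply Rmult_le_compat_r; auto).
      assert (Y1 := young (lam / 8) x (K * J) ltac:(lra)).
      assert (Y2 := young (lam / 8) x (3 * Ca alpha * (K * K) * e) ltac:(lra)).
      replace (/ (4 * (lam / 8)) * (K * J * (K * J))) with (2 * (K * K) / lam * (J * J)) in Y1 by (field; lra).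
      replace (/ (4 * (lam / 8)) * (3 * Ca alpha * (K * K) * e * (3 * Ca alpha * (K * K) * e))) with
        (18 * C2 / lam * (e * e)) in Y2 by (unfold C2; field; lra).
      lra.
    - rewrite (I_plus P), (I_plus P), (I_scal P), (I_plus P), (I_scal P), I_const by pc.
      fold (A n) (E n). do 3 apply Rplus_le_compat_l.
      assert (PB := PI_4).
      replace (16 * (K * K) / lam * (J * J)) with (2 * (K * K) / lam * (J * J) * 8) by (field; lra).
      apply Rmult_le_compat_l; [|lra]. apply Rmult_le_pos; [|nra]. apply Rdiv_le_0_compat; nra. }
  assert (G1 := A_le_g n Hn G HU HU').
  assert (N1 := I_nonneg _ P1). assert (N2 := I_nonneg _ P2). assert (N3 := I_nonneg _ P5). assert (N4 := I_nonneg _ P7).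
  fold (A n) in N1. fold (A1 n) in N2. fold (E n) in N3. fold (L n) in N4.
  assert (W' : dt * (g n + pI (fun s => dot (er1 (S n) s) (dS (a n) s))) <=
     dt * (pI (fun s => dot (z2 n s) (a n s)) + (lam / 4 * A n + (18 * C2 / lam * E n + 16 * (K * K) / lam * (J * J)))))
     by (apply Rmult_le_compat_l; lra).
  assert (dA : dt * dt * A n <= dt * (lam / 4 * A n)).
  { rewrite Rmult_assoc. apply Rmult_le_compat_l; [lra|]. apply Rmult_le_compat_r; auto. }
  assert (0 <= dt * dt * A1 n) by (repeat apply Rmult_le_pos; lra).
  assert (dt * (lam * A n) <= dt * g n) by (apply Rmult_le_compat_l; lra).
  assert (0 <= dt * (lam * A n)) by (apply Rmult_le_pos; [lra|apply Rmult_le_pos; lra]).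
  assert (JJ : 0 <= J * J) by nra. assert (KK : 1 <= K * K) by nra.
  assert (C20 : 0 <= C2) by (unfold C2; repeat apply Rmult_le_pos; lra).
  assert (z1 : 0 <= 18 * C2 / lam) by (apply Rdiv_le_0_compat; lra).
  assert (z2' : 0 <= 16 * (K * K) / lam) by (apply Rdiv_le_0_compat; lra).
  assert (z3' : 0 <= 4 / lam) by (apply Rdiv_le_0_compat; lra).
  assert (V1 : dt * (18 * C2 / lam * E n + 16 * (K * K) / lam * (J * J) + 4 / lam * L n) <= dt * c9 * (E n + L n + J * J)).
  { rewrite Rmult_assoc. apply Rmult_le_compat_l; [lra|]. unfold c9.
    assert (0 <= 18 * C2 / lam * (L n + J * J)) by (apply Rmult_le_pos; lra).
    assert (0 <= 16 * (K * K) / lam * (L n + E n)) by (apply Rmult_le_pos; lra).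
    assert (0 <= 4 / lam * (E n + J * J)) by (apply Rmult_le_pos; lra). lra. }
  lra.
Qed.

Definition fine_const (T : R) : R := 4 * ((c9 + K + 1) * exp (4 * (c9 + K + 1) * T)).

(** From one step to the next, [fine_step] leaves Q (S n) (S n) - Q n (S n), a time difference of
    the defect rather than of the error, and [wdz2] bounds it with a factor dt. *)
Lemma fine_estimate T : (forall n, (n < M)%nat -> scheme_at alpha k P dt U n) ->
  (forall n, (n <= M)%nat -> feU n) -> (forall n, (n <= M)%nat -> good n) ->
  (forall s, U O s = Rn O s) -> dt <= lam / 4 -> dt <= 1 -> INR M * dt <= T ->
  forall n, (n <= M)%nat ->
  L n + E n <= fine_const T * (J * J).
Proof.
  unfold fine_const.
  intros HS HU HG H0 Hdtl Hdt1 HT. assert (JJ : 0 <= J * J) by nra.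
  assert (c90 : 0 <= c9).
  { assert (C1 := Ca_ge1 alpha). assert (C20 : 0 <= C2) by (unfold C2; repeat apply Rmult_le_pos; lra).
    unfold c9. assert (0 <= 18 * C2 / lam) by (apply Rdiv_le_0_compat; lra).
    assert (0 <= 16 * (K * K) / lam) by (apply Rdiv_le_0_compat; nra).
    assert (0 <= 4 / lam) by (apply Rdiv_le_0_compat; lra). lra. }
  set (c10 := c9 + K + 1).
  assert (e00 : forall s, er O s = (0, 0)) by (intros s; unfold er; rewrite H0; vring).
  assert (e10 : forall s, er1 O s = (0, 0)).
  { intros s. unfold er1. replace (U O) with (Rn O) by (extensionality x; auto). vring. }
  assert (Z : forall f : R -> R, (forall s, f s = 0) -> pI f = 0).
  { intros f Hf. rewrite <- (Rmult_0_l (2 * PI)), <- I_const. apply RI_ext; [generalize twoPI; lra|]. auto. }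
  assert (E0 : E 0 = 0) by (apply Z; intros s; rewrite e10; vring).
  assert (L0 : L 0 = 0) by (apply Z; intros s; rewrite e00; vring).
  assert (Q0 : Q 0 0 = 0) by (apply Z; intros s; rewrite e00; vring).
  (* Of (K + 1) J^2, the part K J^2 compensates the bound on Q and the remaining J^2 makes the
     recursion homogeneous; together with the weight 1/8 this gives the lower bound [Lo]. *)
  set (Psi := fun n => / 2 * E (S n) - Q n (S n) + L (S n) + (K + 1) * (J * J)).
  assert (NE : forall n, (n <= M)%nat -> 0 <= E n) by (intros; apply I_nonneg, pv_er1; auto).
  assert (NL : forall n, (n <= M)%nat -> 0 <= L n) by (intros; apply I_nonneg, pv_er; auto).
  assert (Lo : forall n, (n < M)%nat -> / 4 * (E (S n) + L (S n) + J * J) <= Psi n).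
  { intros n Hn. assert (W := wz2 n Hn (er (S n)) (er_fe (S n) ltac:(lia) (HU (S n) ltac:(lia)))).
    rewrite S_er in W by (auto; lia). fold (L (S n)) (Q n (S n)) in W.
    assert (NE' := NE (S n) ltac:(lia)). assert (NL' := NL (S n) ltac:(lia)).
    apply Rabs_le_between in W. unfold Psi. lra. }
  assert (Main : forall n, (n < M)%nat -> Psi n <= c10 * (J * J) * (1 + 4 * c10 * dt) ^ n).
  { induction n as [|n IH]; intros Hn.
    - assert (F0 := fine_step 0 Hn (HU 0%nat ltac:(lia)) (HG 0%nat ltac:(lia)) (HS 0%nat Hn) Hdtl).
      rewrite E0, L0, Q0 in F0. unfold Psi. simpl.
      assert (dt * c9 * (0 + 0 + J * J) <= 1 * c9 * (0 + 0 + J * J)).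
      { apply Rmult_le_compat_r; [lra|]. apply Rmult_le_compat_r; lra. }
      unfold c10. lra.
    - assert (IHn := IH ltac:(lia)).
      assert (F1 := fine_step (S n) Hn (HU (S n) ltac:(lia)) (HG (S n) ltac:(lia)) (HS (S n) Hn) Hdtl).
      assert (W := wdz2 n Hn (er (S n)) (er_fe (S n) ltac:(lia) (HU (S n) ltac:(lia)))).
      rewrite (S_er (S n) ltac:(lia) (HU (S n) ltac:(lia))) in W. fold (L (S n)) in W.
      assert (EQ : pI (fun s => dot (vsub (z2 (S n) s) (z2 n s)) (er (S n) s)) = Q (S n) (S n) - Q n (S n)).
      { assert (P1 := pv_er (S n) ltac:(lia) (HU (S n) ltac:(lia))).
        assert (P2 := pz2 n ltac:(lia)).
        unfold Q. rewrite <- (I_minus P) by pc. apply RI_ext; [generalize twoPI; lra|]. intros s _. vring. }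
      rewrite EQ in W. apply Rabs_le_between in W.
      assert (NE' := NE (S n) ltac:(lia)). assert (NL' := NL (S n) ltac:(lia)).
      assert (LO := Lo n ltac:(lia)).
      assert (St : Psi (S n) <= Psi n + dt * c10 * (E (S n) + L (S n) + J * J)).
      { unfold Psi, c10. assert (0 <= dt * K * (E (S n) + L (S n))) by (repeat apply Rmult_le_pos; lra).
        assert (0 <= dt * (J * J)) by (apply Rmult_le_pos; lra). lra. }
      assert (dt * c10 * (E (S n) + L (S n) + J * J) <= dt * c10 * (4 * Psi n)).
      { apply Rmult_le_compat_l; [|lra]. apply Rmult_le_pos; [lra|unfold c10; lra]. }
      simpl. replace (c10 * (J * J) * ((1 + 4 * c10 * dt) * (1 + 4 * c10 * dt) ^ n)) with
        ((1 + 4 * c10 * dt) * (c10 * (J * J) * (1 + 4 * c10 * dt) ^ n)) by ring.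
      apply Rle_trans with ((1 + 4 * c10 * dt) * Psi n); [lra|].
      apply Rmult_le_compat_l; auto.
      assert (0 <= 4 * c10 * dt) by (repeat apply Rmult_le_pos; unfold c10; lra). lra. }
  assert (X : forall n, (n < M)%nat -> Psi n <= c10 * exp (4 * c10 * T) * (J * J)).
  { intros n Hn. eapply Rle_trans; [apply Main; auto|].
    replace (c10 * exp (4 * c10 * T) * (J * J)) with (c10 * (J * J) * exp (4 * c10 * T)) by ring.
    apply Rmult_le_compat_l; [apply Rmult_le_pos; [unfold c10; lra|auto]|].
    eapply Rle_trans; [apply pow_le_exp; repeat apply Rmult_le_pos; unfold c10; lra|].
    assert (H1 : INR n * (4 * c10 * dt) <= 4 * c10 * T).
    { assert (INR n <= INR M) by (apply le_INR; lia).
      assert (INR n * dt <= T) by (assert (INR n * dt <= INR M * dt) by (apply Rmult_le_compat_r; lra); lra).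
      replace (INR n * (4 * c10 * dt)) with (4 * c10 * (INR n * dt)) by ring. apply Rmult_le_compat_l; [unfold c10|]; lra. }
    destruct H1 as [H1|H1]; [left; apply exp_increasing; auto|rewrite H1; lra]. }
  intros n Hn. destruct n as [|n].
  - rewrite E0, L0. rewrite Rplus_0_l. apply Rmult_le_pos; auto. apply Rmult_le_pos; [lra|].
    apply Rmult_le_pos; [unfold c10; lra|left; apply exp_pos].
  - assert (LO := Lo n Hn). assert (XX := X n Hn). lra.
Qed.
End Fine.
End Energy.

(** * Time differences of smooth functions *)

Definition clamp (T t : R) : R := Rmax 0 (Rmin t T).

Lemma clamp_in T t : 0 <= T -> 0 <= clamp T t <= T.
Proof. intros. unfold clamp, Rmax, Rmin. repeat destruct Rle_dec; lra. Qed.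

Lemma clamp_id T t : 0 <= t <= T -> clamp T t = t.
Proof. intros. unfold clamp, Rmax, Rmin. repeat destruct Rle_dec; lra. Qed.

Lemma clamp_lip T t u : 0 <= T -> Rabs (clamp T u - clamp T t) <= Rabs (u - t).
Proof.
  intros. unfold clamp, Rmax, Rmin, Rabs. repeat destruct Rle_dec; repeat destruct Rcase_abs; lra.
Qed.

Lemma continuity_2d_slice1 f t s : continuity_2d_pt f t s -> continuous (fun u => f u s) t.
Proof.
  intros H. apply continuity_pt_filterlim. intros eps He.
  destruct (H (mkposreal eps He)) as [d Hd]. exists d. split; [apply cond_pos|].
  intros u [_ Hu]. apply Hd; auto. rewrite Rminus_diag, Rabs_R0. apply cond_pos.
Qed.

Lemma continuity_2d_slice2 f t s : continuity_2d_pt f t s -> continuous (fun u => f t u) s.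
Proof.
  intros H. apply continuity_pt_filterlim. intros eps He.
  destruct (H (mkposreal eps He)) as [d Hd]. exists d. split; [apply cond_pos|].
  intros u [_ Hu]. apply Hd; auto. rewrite Rminus_diag, Rabs_R0. apply cond_pos.
Qed.

(** For identities available in the open time interval only, derivatives in t being given at 0 and T
    by continuous extension: periodicity of the t-derivatives and the flow equation itself. *)
Lemma zero_on_closure (phi : R -> R) T : 0 < T -> (forall t, continuous phi t) ->
  (forall t, 0 < t < T -> phi t = 0) -> forall t, 0 <= t <= T -> phi t = 0.
Proof.
  intros HT Hc H t Ht. apply NNPP. intros Hn.
  assert (L : locally t (fun y => phi y <> 0)).
  { apply (Hc t (fun y => y <> 0)). apply (open_neq 0 (phi t) Hn). }
  destruct L as [d Hd]. assert (dp := cond_pos d).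
  set (e := Rmin (d / 2) (T / 4)).
  assert (e0 : 0 < e) by (apply Rmin_glb_lt; lra).
  assert (e1 : e <= d / 2) by apply Rmin_l. assert (e2 : e <= T / 4) by apply Rmin_r.
  destruct (Rle_dec t (T / 2)).
  - apply (Hd (t + e)); [|apply H; lra]. change (Rabs (t + e - t) < d). rewrite Rabs_right; lra.
  - apply (Hd (t - e)); [|apply H; lra]. change (Rabs (t - e - t) < d). rewrite Rabs_left; lra.
Qed.

(** The segment from (0, 0) to (t, s) is divided into N steps so short that, by uniform continuity,
    g changes by less than 1 along each. *)
Lemma bounded_on_box (g : R -> R -> R) a b : 0 <= a -> 0 <= b ->
  (forall t s, continuity_2d_pt g t s) ->
  exists K, forall t s, 0 <= t <= a -> 0 <= s <= b -> Rabs (g t s) <= K.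
Proof.
  intros Ha Hb Hc.
  destruct (uniform_continuity_2d g 0 a 0 b (fun x y _ _ => Hc x y) (mkposreal 1 Rlt_0_1)) as [d Hd].
  assert (dp := cond_pos d).
  destruct (INR_archimed d (a + b + 1) dp) as [N HN].
  assert (N0 : 0 < INR N).
  { destruct N; [simpl in HN; lra|]. apply lt_0_INR. lia. }
  exists (Rabs (g 0 0) + INR N). intros t s Ht Hs.
  assert (S : forall m, (m <= N)%nat -> Rabs (g (INR m / INR N * t) (INR m / INR N * s)) <= Rabs (g 0 0) + INR m).
  { assert (B : forall m, (m <= N)%nat -> 0 <= INR m / INR N <= 1).
    { intros m Hm. apply le_INR in Hm. split.
      - apply Rdiv_le_0_compat; auto. apply pos_INR.
      - apply (Rmult_le_reg_r (INR N)); auto. unfold Rdiv. rewrite Rmult_assoc, Rinv_l; lra. }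
    assert (sd : forall x, 0 <= x <= a + b -> x / INR N < d).
    { intros x Hx. apply (Rmult_lt_reg_r (INR N)); auto. unfold Rdiv. rewrite Rmult_assoc, Rinv_l; lra. }
    induction m as [|m IH]; intros Hm.
    - simpl. unfold Rdiv. rewrite !Rmult_0_l. lra.
    - specialize (IH ltac:(lia)).
      assert (B1 := B m ltac:(lia)). assert (B2 := B (S m) Hm).
      assert (X : Rabs (g (INR (S m) / INR N * t) (INR (S m) / INR N * s) - g (INR m / INR N * t) (INR m / INR N * s)) < 1).
      { apply Hd; try (split; [apply Rmult_le_pos; lra|]); try nra.
        - replace (INR (S m) / INR N * t - INR m / INR N * t) with (t / INR N) by (rewrite S_INR; field; lra).
          rewrite Rabs_right; [apply sd; lra|]. apply Rle_ge, Rdiv_le_0_compat; lra.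
        - replace (INR (S m) / INR N * s - INR m / INR N * s) with (s / INR N) by (rewrite S_INR; field; lra).
          rewrite Rabs_right; [apply sd; lra|]. apply Rle_ge, Rdiv_le_0_compat; lra. }
      rewrite (S_INR m) at 3. simpl pos in X.
      apply Rabs_def2 in X. apply Rabs_le_between in IH. apply Rabs_le_between. lra. }
  specialize (S N ltac:(lia)). replace (INR N / INR N) with 1 in S by (field; lra).
  rewrite !Rmult_1_l in S. auto.
Qed.

Lemma finite_bound (Q : nat -> R -> Prop) : (forall i, exists K, Q i K) ->
  (forall i K K', Q i K -> K <= K' -> Q i K') ->
  forall n, exists K, forall i, (i <= n)%nat -> Q i K.
Proof.
  intros H Hm. induction n as [|n [K HK]].
  - destruct (H O) as [K HK]. exists K. intros i Hi. replace i with O by lia. auto.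
  - destruct (H (S n)) as [K' HK']. exists (Rmax K K'). intros i Hi.
    destruct (Nat.eq_dec i (S n)) as [->|].
    + apply (Hm _ K'); auto. apply Rmax_r.
    + apply (Hm _ K); [apply HK; lia|apply Rmax_l].
Qed.

(* [E i j] extends the derivative of order i in t and j in s, constantly in
   time outside [0,T], so that it is continuous on the whole plane. *)
Record strip_data (r : nat) (T : R) (f : R -> R -> R) (E : nat -> nat -> R -> R -> R) (K : R) : Prop := StripData {
  sd_0 : forall t s, 0 <= t <= T -> E O O t s = f t s;
  sd_cont : forall i j, (i + j <= r)%nat -> forall t s, continuity_2d_pt (E i j) t s;
  sd_dt : forall i j, (i + j < r)%nat -> forall t s, 0 < t < T ->
    is_derive (fun u => E i j u s) t (E (S i) j t s);
  sd_ds : forall i j, (i + j < r)%nat -> forall t s, is_derive (E i j t) s (E i (S j) t s);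
  sd_per : forall i j, (i + j <= r)%nat -> forall t, periodic (E i j t);
  sd_bound : forall i j, (i + j <= r)%nat -> forall t s, Rabs (E i j t s) <= K;
  sd_clamp : forall i j t s, E i j t s = E i j (clamp T t) s
}.

Lemma strip_data_exists r T f : 0 < T -> C_strip r T f ->
  (forall t, 0 <= t <= T -> periodic (f t)) -> exists E K, strip_data r T f E K.
Proof.
  intros HT [D [D0 [Dc [Dt Ds]]]] Pf.
  set (E := fun i j t s => D i j (clamp T t) s).
  assert (Ec : forall i j, (i + j <= r)%nat -> forall t s, continuity_2d_pt (E i j) t s).
  { intros i j Hij t s eps. assert (Ct := clamp_in T t ltac:(lra)).
    destruct (Dc i j Hij (clamp T t) s Ct (ball (D i j (clamp T t) s) eps)) as [d Hd].
    { apply locally_ball. }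
    exists d. intros u v Hu Hv. apply (Hd (clamp T u, v)).
    - split; [|exact Hv]. change (Rabs (clamp T u - clamp T t) < d).
      eapply Rle_lt_trans; [apply clamp_lip; lra|auto].
    - apply clamp_in; lra. }
  assert (Es : forall i j, (i + j < r)%nat -> forall t s, is_derive (E i j t) s (E i (S j) t s)).
  { intros i j Hij t s. apply (Ds i j Hij (clamp T t) s). apply clamp_in; lra. }
  assert (Et : forall i j, (i + j < r)%nat -> forall t s, 0 < t < T ->
    is_derive (fun u => E i j u s) t (E (S i) j t s)).
  { intros i j Hij t s Ht. unfold E at 2. rewrite clamp_id by lra.
    apply (is_derive_cell _ (fun u => D i j u s) 0 T); auto.
    intros u Hu. unfold E. rewrite clamp_id; auto. }
  assert (E0 : forall t s, 0 <= t <= T -> E O O t s = f t s).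
  { intros t s Ht. unfold E. rewrite clamp_id; auto. }
  assert (Ecl : forall i j t s, E i j t s = E i j (clamp T t) s).
  { intros i j t s. unfold E. rewrite (clamp_id T (clamp T t)); auto. apply clamp_in; lra. }
  (* Periodicity passes to t-derivatives inside (0, T) by differentiation, to the end times by
     continuity, and to all other times by clamping. *)
  assert (Per0 : forall i, (i <= r)%nat -> forall t, periodic (E i O t)).
  { induction i as [|i IH]; intros Hi t s.
    - rewrite !(Ecl _ _ t), !E0 by (apply clamp_in; lra). apply Pf. apply clamp_in; lra.
    - assert (Z : forall t, 0 <= t <= T -> E (S i) O t (s + 2 * PI) - E (S i) O t s = 0).
      { apply (zero_on_closure (fun t => E (S i) O t (s + 2 * PI) - E (S i) O t s)); auto.
        - intros u. apply cont_minus; apply (continuity_2d_slice1 (E (S i) O)), Ec; lia.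
        - intros u Hu.
          assert (D1 := Et i O ltac:(lia) u (s + 2 * PI) Hu). assert (D2 := Et i O ltac:(lia) u s Hu).
          assert (Ex : Derive (fun u => E i O u (s + 2 * PI)) u = Derive (fun u => E i O u s) u).
          { apply Derive_ext. intros v. apply IH; lia. }
          assert (U1 : Derive (fun u => E i O u (s + 2 * PI)) u = E (S i) O u (s + 2 * PI)) by (apply is_derive_unique; exact D1).
          assert (U2 : Derive (fun u => E i O u s) u = E (S i) O u s) by (apply is_derive_unique; exact D2).
          lra. }
      rewrite !(Ecl _ _ t). specialize (Z (clamp T t) ltac:(apply clamp_in; lra)). lra. }
  assert (Per : forall i j, (i + j <= r)%nat -> forall t, periodic (E i j t)).
  { intros i. induction j as [|j IH]; intros Hij t.
    - apply Per0. lia.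
    - apply (deriv_periodic (E i j t)); [apply IH; lia|]. apply Es. lia. }
  assert (Bd : forall i j, exists K, (i + j <= r)%nat -> forall t s, Rabs (E i j t s) <= K).
  { intros i j. destruct (Nat.le_gt_cases (i + j) r) as [Hij|Hij]; [|exists 0; intros; lia].
    assert (TP := twoPI).
    destruct (bounded_on_box (E i j) T (2 * PI) ltac:(lra) ltac:(lra) (Ec i j Hij)) as [K HK].
    exists K. intros _ t s. destruct (period_repr 0 s) as [m Hm].
    rewrite Ecl, <- (periodic_Z (E i j (clamp T t)) (Per i j Hij _) m s).
    apply HK; [apply clamp_in; lra|lra]. }
  destruct (finite_bound (fun i K => forall j, (j <= r)%nat -> (i + j <= r)%nat -> forall t s, Rabs (E i j t s) <= K)) with (n := r) as [K HK].
  - intros i. destruct (finite_bound (fun j K => (i + j <= r)%nat -> forall t s, Rabs (E i j t s) <= K)) with (n := r) as [K HK].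
    + intros j. apply Bd.
    + intros j K K' H1 H2 Hij t s. eapply Rle_trans; [apply H1; auto|auto].
    + exists K. intros j Hj Hij t s. apply (HK j Hj Hij).
  - intros i K K' H1 H2 j Hj Hij t s. eapply Rle_trans; [apply H1; auto|auto].
  - exists E, K. split; auto. intros i j Hij t s. apply HK; lia.
Qed.

Lemma MVT_open (f f' : R -> R) a b K : a <= b ->
  (forall x, a <= x <= b -> continuous f x) ->
  (forall x, a < x < b -> is_derive f x (f' x)) ->
  (forall x, a <= x <= b -> Rabs (f' x) <= K) ->
  Rabs (f b - f a) <= K * (b - a).
Proof.
  intros ab Hc Hd HK.
  destruct (MVT_gen f a b f') as [c [Hc' E]]; rewrite ?Rmin_left, ?Rmax_right in * by lra.
  - apply Hd.
  - intros x Hx. apply continuity_pt_filterlim. apply Hc; auto.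
  - rewrite E, Rabs_mult, (Rabs_right (b - a)) by lra.
    apply Rmult_le_compat_r; [lra|]. apply HK; auto.
Qed.

(** * Mean value estimates for differences in time *)

Section TimeDifferences.
Context (r : nat) (T : R) (f : R -> R -> R) (E : nat -> nat -> R -> R -> R) (K dt : R).
Hypothesis HE : strip_data r T f E K.
Hypothesis Hdt : 0 < dt.

Lemma sd_cont_t i j s t : (i + j <= r)%nat -> continuous (fun u => E i j u s) t.
Proof. intros H. apply continuity_2d_slice1, (sd_cont _ _ _ _ _ HE); auto. Qed.

Lemma cont_shift (phi : R -> R) c x : (forall y, continuous phi y) -> continuous (fun u => phi (u + c)) x.
Proof.
  intros H. apply (continuous_comp (fun u => u + c) phi); auto.
  apply cont_plus; [apply cont_id|apply cont_const].
Qed.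

Lemma is_derive_shift (phi : R -> R) c x l : is_derive phi (x + c) l -> is_derive (fun u => phi (u + c)) x l.
Proof.
  intros H. replace l with (scal 1 l) by (unfold scal; simpl; unfold mult; simpl; ring).
  apply (is_derive_comp (K := R_AbsRing) (V := R_NormedModule) phi (fun u => u + c) x l 1); auto.
  replace 1 with (1 + 0) by ring. apply is_derive_plusR; [apply (is_derive_id (K := R_AbsRing))|apply is_derive_constR].
Qed.

Lemma time_diff1 i j t s : (S i + j <= r)%nat -> 0 <= t -> t + dt <= T ->
  Rabs (E i j (t + dt) s - E i j t s) <= K * dt.
Proof.
  intros Hij H0 H1. replace dt with (t + dt - t) at 2 by ring.
  apply (MVT_open (fun u => E i j u s) (fun u => E (S i) j u s)); [lra| | |].
  - intros x _. apply sd_cont_t; lia.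
  - intros x Hx. apply (sd_dt _ _ _ _ _ HE); [lia|lra].
  - intros x _. apply (sd_bound _ _ _ _ _ HE). lia.
Qed.

Lemma time_diff2 i j t s : (S (S i) + j <= r)%nat -> 0 <= t -> t + dt + dt <= T ->
  Rabs ((E i j (t + dt + dt) s - E i j (t + dt) s) - (E i j (t + dt) s - E i j t s)) <= K * dt * dt.
Proof.
  intros Hij H0 H1. replace dt with (t + dt - t) at 6 by ring.
  apply (MVT_open (fun u => E i j (u + dt) s - E i j u s)
    (fun u => E (S i) j (u + dt) s - E (S i) j u s)); [lra| | |].
  - intros x _. apply cont_minus; [apply (cont_shift (fun u => E i j u s))|]; intros; apply sd_cont_t; lia.
  - intros x Hx. apply is_derive_minusR; [apply (is_derive_shift (fun u => E i j u s))|];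
      apply (sd_dt _ _ _ _ _ HE); try lia; lra.
  - intros x Hx. apply time_diff1; [lia|lra|lra].
Qed.

(** The truncation error of the backward difference quotient, multiplied by dt. The mean value
    theorem is applied to u -> E(u) - u E_t(t + dt), whose derivative is of size K dt on the
    step. *)
Lemma time_tau i j t s : (S (S i) + j <= r)%nat -> 0 <= t -> t + dt <= T ->
  Rabs (E i j (t + dt) s - E i j t s - dt * E (S i) j (t + dt) s) <= K * dt * dt.
Proof.
  intros Hij H0 H1.
  assert (M := MVT_open (fun u => E i j u s - u * E (S i) j (t + dt) s)
    (fun u => E (S i) j u s - (1 * E (S i) j (t + dt) s + u * 0)) t (t + dt) (K * dt) ltac:(lra)).
  cbv beta in M. replace (t + dt - t) with dt in M by ring.
  replace (E i j (t + dt) s - E i j t s - dt * E (S i) j (t + dt) s) with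
    (E i j (t + dt) s - (t + dt) * E (S i) j (t + dt) s - (E i j t s - t * E (S i) j (t + dt) s)) by ring.
  apply M.
  - intros x _. apply cont_minus; [apply sd_cont_t; lia|]. apply cont_mult; [apply cont_id|apply cont_const].
  - intros x Hx. apply is_derive_minusR; [apply (sd_dt _ _ _ _ _ HE); [lia|lra]|].
    apply (is_derive_multR (fun u => u) (fun _ => E (S i) j (t + dt) s)); [apply (is_derive_id (K := R_AbsRing))|apply is_derive_constR].
  - intros x Hx.
    assert (Y := MVT_open (fun u => E (S i) j u s) (fun u => E (S (S i)) j u s) x (t + dt) K ltac:(lra)).
    rewrite Rabs_minus_sym.
    replace (1 * E (S i) j (t + dt) s + x * 0 - E (S i) j x s) with (E (S i) j (t + dt) s - E (S i) j x s) by ring.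
    assert (K0 : 0 <= K).
    { eapply Rle_trans; [apply Rabs_pos|apply (sd_bound _ _ _ _ _ HE (S i) j ltac:(lia) t s)]. }
    apply Rle_trans with (K * (t + dt - x)); [|apply Rmult_le_compat_l; lra].
    apply Y.
    + intros y _. apply sd_cont_t; lia.
    + intros y Hy. apply (sd_dt _ _ _ _ _ HE); [lia|lra].
    + intros y _. apply (sd_bound _ _ _ _ _ HE). lia.
Qed.

(** The truncation error is a function of t, here compared at two times dt apart; its derivative is
    the truncation error of E_t, which costs a third time derivative. *)
Lemma time_dtau i j t s : (S (S (S i)) + j <= r)%nat -> 0 <= t -> t + dt + dt <= T ->
  Rabs ((E i j (t + dt + dt) s - E i j (t + dt) s - dt * E (S i) j (t + dt + dt) s) -
        (E i j (t + dt) s - E i j t s - dt * E (S i) j (t + dt) s)) <= K * dt * dt * dt.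
Proof.
  intros Hij H0 H1.
  assert (M := MVT_open (fun u => E i j (u + dt) s - E i j u s - dt * E (S i) j (u + dt) s)
    (fun u => E (S i) j (u + dt) s - E (S i) j u s - dt * E (S (S i)) j (u + dt) s) t (t + dt) (K * dt * dt) ltac:(lra)).
  cbv beta in M. replace (t + dt - t) with dt in M by ring. apply M.
  - intros x _. repeat apply cont_minus; try apply cont_mult; try apply cont_const;
     try (apply (cont_shift (fun u => E i j u s)); intros; apply sd_cont_t; lia).
    + apply sd_cont_t; lia.
    + apply (cont_shift (fun u => E (S i) j u s)); intros; apply sd_cont_t; lia.
  - intros x Hx. repeat apply is_derive_minusR.
    + apply (is_derive_shift (fun u => E i j u s)). apply (sd_dt _ _ _ _ _ HE); [lia|lra].
    + apply (sd_dt _ _ _ _ _ HE); [lia|lra].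
    + apply is_derive_scalR. apply (is_derive_shift (fun u => E (S i) j u s)). apply (sd_dt _ _ _ _ _ HE); [lia|lra].
  - intros x Hx. apply time_tau; [lia|lra|lra].
Qed.
End TimeDifferences.

(** * Products of sequences in time and projection errors *)

(* A sequence that is O(C) together with its difference quotients in time. *)
Definition bnd (N : nat) (dt C : R) (x : nat -> R2) : Prop :=
  (forall n, (n <= N)%nat -> norm2 (x n) <= C) /\
  (forall n, (n < N)%nat -> norm2 (vsub (x (S n)) (x n)) <= C * dt).

Lemma bnd_ext N dt C x y : (forall n, (n <= N)%nat -> x n = y n) -> bnd N dt C x -> bnd N dt C y.
Proof.
  intros E [H1 H2]. split; intros n Hn; rewrite <- !E by lia; auto.
Qed.

Lemma bnd_le N dt C C' x : 0 <= dt -> C <= C' -> bnd N dt C x -> bnd N dt C' x.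
Proof.
  intros Hdt HC [H1 H2]. split; intros n Hn.
  - eapply Rle_trans; [apply H1; auto|auto].
  - eapply Rle_trans; [apply H2; auto|]. apply Rmult_le_compat_r; auto.
Qed.

Lemma bnd_add N dt a b x y : bnd N dt a x -> bnd N dt b y -> bnd N dt (a + b) (fun n => vadd (x n) (y n)).
Proof.
  intros [A1 A2] [B1 B2]. split; intros n Hn.
  - eapply Rle_trans; [apply norm2_add|]. apply Rplus_le_compat; auto.
  - replace (vsub (vadd (x (S n)) (y (S n))) (vadd (x n) (y n))) with
      (vadd (vsub (x (S n)) (x n)) (vsub (y (S n)) (y n))) by vring.
    eapply Rle_trans; [apply norm2_add|]. rewrite Rmult_plus_distr_r. apply Rplus_le_compat; auto.
Qed.

Lemma bnd_opp N dt a x : bnd N dt a x -> bnd N dt a (fun n => vscl (-1) (x n)).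
Proof.
  assert (R1 : Rabs (-1) = 1) by (rewrite Rabs_left; lra).
  intros [A1 A2]. split; intros n Hn.
  - rewrite norm2_scl, R1, Rmult_1_l. auto.
  - replace (vsub (vscl (-1) (x (S n))) (vscl (-1) (x n))) with (vscl (-1) (vsub (x (S n)) (x n))) by vring.
    rewrite norm2_scl, R1, Rmult_1_l. auto.
Qed.

(** Discrete product rule: the increment splits into three terms, each with one differenced factor,
    whence the 3. *)
Lemma bnd_tri alpha N dt a b c x y w : bnd N dt a x -> bnd N dt b y -> bnd N dt c w ->
  bnd N dt (3 * Ca alpha * (a * b * c)) (fun n => tri alpha (x n) (y n) (w n)).
Proof.
  intros [A1 A2] [B1 B2] [W1 W2].
  split; intros n Hn.
  - assert (T := norm2_tri_le alpha _ _ _ _ _ _ (A1 n Hn) (B1 n Hn) (W1 n Hn)).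
    assert (0 <= norm2 (tri alpha (x n) (y n) (w n))) by apply norm2_ge0. lra.
  - assert (T1 := norm2_tri_le alpha _ _ _ _ _ _ (A2 n Hn) (B1 (S n) Hn) (W1 (S n) Hn)).
    assert (T2 := norm2_tri_le alpha _ _ _ _ _ _ (A1 n ltac:(lia)) (B2 n Hn) (W1 (S n) Hn)).
    assert (T3 := norm2_tri_le alpha _ _ _ _ _ _ (A1 n ltac:(lia)) (B1 n ltac:(lia)) (W2 n Hn)).
    replace (vsub (tri alpha (x (S n)) (y (S n)) (w (S n))) (tri alpha (x n) (y n) (w n))) with
      (vadd (vadd (tri alpha (vsub (x (S n)) (x n)) (y (S n)) (w (S n)))
                  (tri alpha (x n) (vsub (y (S n)) (y n)) (w (S n))))
            (tri alpha (x n) (y n) (vsub (w (S n)) (w n)))) by vring.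
    eapply Rle_trans; [apply norm2_add|].
    eapply Rle_trans; [apply Rplus_le_compat_r, norm2_add|]. lra.
Qed.

(** * Products of piecewise C^1 vector functions and integration by parts *)

Definition pc1v (P : partition) (f f' : R -> R2) : Prop :=
  pc1 P (fun s => fst (f s)) (fun s => fst (f' s)) /\ pc1 P (fun s => snd (f s)) (fun s => snd (f' s)).

Lemma pc1v_pv P f f' : pc1v P f f' -> pv P f /\ pv P f'.
Proof.
  intros [H1 H2].
  split; split; eauto using pc1_pcont0; [apply (pc1_pcont _ _ _ H1)|apply (pc1_pcont _ _ _ H2)].
Qed.

Lemma pc1_ext P f f' g' : (forall s, f' s = g' s) -> pc1 P f f' -> pc1 P f g'.
Proof. intros E H. replace g' with f'; auto. extensionality s; auto. Qed.

Lemma pc1_dot P f f' g g' : pc1v P f f' -> pc1v P g g' ->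
  pc1 P (fun s => dot (f s) (g s)) (fun s => dot (f' s) (g s) + dot (f s) (g' s)).
Proof.
  intros [F1 F2] [G1 G2].
  eapply pc1_ext; [|apply (pc1_plus _ _ _ _ _ (pc1_mult _ _ _ _ _ F1 G1) (pc1_mult _ _ _ _ _ F2 G2))].
  intros s. unfold dot. simpl. ring.
Qed.

Lemma pc1v_tri P alpha f f' g g' h h' : pc1v P f f' -> pc1v P g g' -> pc1v P h h' ->
  pc1v P (fun s => tri alpha (f s) (g s) (h s))
    (fun s => vadd (vadd (tri alpha (f' s) (g s) (h s)) (tri alpha (f s) (g' s) (h s))) (tri alpha (f s) (g s) (h' s))).
Proof.
  intros F G Hh. assert (D1 := pc1_dot _ _ _ _ _ F G). assert (D2 := pc1_dot _ _ _ _ _ G Hh).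
  destruct F as [F1 F2], Hh as [H1 H2].
  split.
  - eapply pc1_ext; [|apply (pc1_plus _ _ _ _ _ (pc1_mult _ _ _ _ _ D1 H1)
      (pc1_mult _ _ _ _ _ (pc1_scal _ (alpha - 1) _ _ D2) F1))]. intros s; vring.
  - eapply pc1_ext; [|apply (pc1_plus _ _ _ _ _ (pc1_mult _ _ _ _ _ D1 H2)
      (pc1_mult _ _ _ _ _ (pc1_scal _ (alpha - 1) _ _ D2) F2))]. intros s; vring.
Qed.

Lemma fe_pc1v k P xi : fe_space k P xi -> pc1v P xi (dS xi).
Proof. intros [H1 H2]. split; eapply fe_pc1; eauto. Qed.

(** Young's inequality with weight t, integrated over a period; 2/t is 8/(4 t), with 8 as a bound
    for 2 pi. *)
Lemma weak_remainder_bound alpha P f g h w (a b c t : R) : 0 < t -> pv P f -> pv P g -> pv P h -> pv P w ->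
  on_cells P (fun s => norm2 (f s) <= a /\ norm2 (g s) <= b /\ norm2 (h s) <= c) ->
  Rabs (pI (fun s => dot (tri alpha (f s) (g s) (h s)) (w s))) <=
  t * pI (fun s => dot (w s) (w s)) + 2 / t * (Ca alpha * (a * b * c) * (Ca alpha * (a * b * c))).
Proof.
  intros Ht Pf Pg Ph Pw H. set (B := Ca alpha * (a * b * c)).
  assert (BB : 0 <= B * B) by nra.
  eapply Rle_trans; [apply (I_abs_le P); pc|].
  apply Rle_trans with (pI (fun s => t * dot (w s) (w s) + / (4 * t) * (B * B))).
  - apply (I_le P); [pc|pc|]. eapply on_cells_imp; [|apply H]. intros s [H1 [H2 H3]]. cbv beta.
    eapply Rle_trans; [apply dot_le|].
    assert (T := norm2_tri_le alpha _ _ _ _ _ _ H1 H2 H3). fold B in T.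
    assert (N := norm2_ge0 (w s)). assert (Y := young t (norm2 (w s)) B Ht). rewrite norm2_sq in Y.
    assert (norm2 (tri alpha (f s) (g s) (h s)) * norm2 (w s) <= B * norm2 (w s)) by (apply Rmult_le_compat_r; auto).
    lra.
  - rewrite (I_plus P), (I_scal P), I_const by pc. apply Rplus_le_compat_l.
    assert (PB := PI_4). replace (2 / t * (B * B)) with (/ (4 * t) * (B * B) * 8) by (field; lra).
    apply Rmult_le_compat_l; [|lra]. apply Rmult_le_pos; auto. left. apply Rinv_0_lt_compat. lra.
Qed.

Definition Sob (xi : R -> R2) : R :=
  pI (fun s => dot (xi s) (xi s)) + pI (fun s => dot (dS xi s) (dS xi s)).

(* Integration by parts trades the derivative of the small factor [f] for one
   on the smooth factors and the test function. *)
Lemma weak_bound alpha k P f f' g g' h h' xi (a b c t : R) : 0 < t -> fe_space k P xi ->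
  pc1v P f f' -> pc1v P g g' -> pc1v P h h' ->
  (forall s, norm2 (f s) <= a) ->
  (forall s, norm2 (g s) <= b) -> (forall s, norm2 (g' s) <= b) ->
  (forall s, norm2 (h s) <= c) -> (forall s, norm2 (h' s) <= c) ->
  let B := Ca alpha * (a * b * c) in
  Rabs (pI (fun s => dot (tri alpha (f' s) (g s) (h s)) (xi s))) <= t * Sob xi + 14 / t * (B * B) /\
  Rabs (pI (fun s => dot (tri alpha (g s) (f' s) (h s)) (xi s))) <= t * Sob xi + 14 / t * (B * B).
Proof.
  intros Ht Hx Hf Hg Hh Bf Bg Bg' Bh Bh' B.
  destruct (pc1v_pv _ _ _ Hf) as [Pf Pf'], (pc1v_pv _ _ _ Hg) as [Pg Pg'], (pc1v_pv _ _ _ Hh) as [Ph Ph'].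
  assert (Px := fe_pv _ _ _ Hx). assert (Px' := fe_pv_dS _ _ _ Hx).
  assert (Cb : forall p q r x, pv P p -> pv P q -> pv P r -> pv P x -> forall a b c t, 0 < t ->
     (forall s, norm2 (p s) <= a) -> (forall s, norm2 (q s) <= b) -> (forall s, norm2 (r s) <= c) ->
     Rabs (pI (fun s => dot (tri alpha (p s) (q s) (r s)) (x s))) <=
     t * pI (fun s => dot (x s) (x s)) + 2 / t * (Ca alpha * (a * b * c) * (Ca alpha * (a * b * c)))).
  { intros p q r0 x Pp Pq Pr Pxx a0 b0 c0 t0 Ht0 H1 H2 H3. apply (weak_remainder_bound _ P); auto.
    apply on_cells_all. intros s. auto. }
  assert (BB : 0 <= B * B) by nra. assert (It : 0 < / t) by (apply Rinv_0_lt_compat; auto).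
  assert (tb : 2 / (t / 2) * (B * B) = 4 * (/ t * (B * B))) by (field; lra).
  assert (tb2 : 2 / t * (B * B) = 2 * (/ t * (B * B))) by (field; lra).
  assert (tb0 : 0 <= / t * (B * B)) by (apply Rmult_le_pos; lra).
  split.
  - assert (Z := pc1_I_0 _ _ _ (pc1_dot _ _ _ _ _ (pc1v_tri P alpha _ _ _ _ _ _ Hf Hg Hh) (fe_pc1v _ _ _ Hx))).
    assert (E : pI (fun s => dot (tri alpha (f' s) (g s) (h s)) (xi s)) +
       pI (fun s => dot (tri alpha (f s) (g' s) (h s)) (xi s)) +
       pI (fun s => dot (tri alpha (f s) (g s) (h' s)) (xi s)) +
       pI (fun s => dot (tri alpha (f s) (g s) (h s)) (dS xi s)) = 0).
    { rewrite <- Z, <- !(I_plus P) by pc. apply RI_ext; [generalize twoPI; lra|]. intros s _. vring. }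
    (* The two terms tested with xi get the weight t/2 each, the one tested with its derivative gets
       t, so that together they cost t times the squared H^1 norm. *)
    assert (X1 := Cb f g' h xi Pf Pg' Ph Px a b c (t / 2) ltac:(lra) Bf Bg' Bh).
    assert (X2 := Cb f g h' xi Pf Pg Ph' Px a b c (t / 2) ltac:(lra) Bf Bg Bh').
    assert (X3 := Cb f g h (dS xi) Pf Pg Ph Px' a b c t Ht Bf Bg Bh).
    fold B in X1, X2, X3. rewrite tb in X1, X2. rewrite tb2 in X3.
    apply Rabs_le_between in X1. apply Rabs_le_between in X2. apply Rabs_le_between in X3.
    apply Rabs_le_between. unfold Sob. replace (14 / t * (B * B)) with (14 * (/ t * (B * B))) by (field; lra). lra.
  - assert (Z := pc1_I_0 _ _ _ (pc1_dot _ _ _ _ _ (pc1v_tri P alpha _ _ _ _ _ _ Hg Hf Hh) (fe_pc1v _ _ _ Hx))).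
    assert (E : pI (fun s => dot (tri alpha (g s) (f' s) (h s)) (xi s)) +
       pI (fun s => dot (tri alpha (g' s) (f s) (h s)) (xi s)) +
       pI (fun s => dot (tri alpha (g s) (f s) (h' s)) (xi s)) +
       pI (fun s => dot (tri alpha (g s) (f s) (h s)) (dS xi s)) = 0).
    { rewrite <- Z, <- !(I_plus P) by pc. apply RI_ext; [generalize twoPI; lra|]. intros s _. vring. }
    assert (X1 := Cb g' f h xi Pg' Pf Ph Px b a c (t / 2) ltac:(lra) Bg' Bf Bh).
    assert (X2 := Cb g f h' xi Pg Pf Ph' Px b a c (t / 2) ltac:(lra) Bg Bf Bh').
    assert (X3 := Cb g f h (dS xi) Pg Pf Ph Px' b a c t Ht Bg Bf Bh).
    replace (b * a * c) with (a * b * c) in X1, X2, X3 by ring.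
    fold B in X1, X2, X3. rewrite tb in X1, X2. rewrite tb2 in X3.
    apply Rabs_le_between in X1. apply Rabs_le_between in X2. apply Rabs_le_between in X3.
    apply Rabs_le_between. unfold Sob. replace (14 / t * (B * B)) with (14 * (/ t * (B * B))) by (field; lra). lra.
Qed.

(** * Projection errors and their time differences *)

Section ScalarProjection.
Context (k : nat) (P : partition) (T : R) (f : R -> R -> R) (E : nat -> nat -> R -> R -> R) (K dt C : R)
  (v : R -> R -> R).
Hypothesis hk : (1 <= k)%nat.
Hypothesis HE : strip_data (k + 3) T f E K.
Hypothesis Hdt : 0 < dt.
Hypothesis HC : forall w (D : nat -> R -> R) K, is_loc k P w (D O) (D 1%nat) ->
    (forall i, (i <= k)%nat -> forall s, is_derive (D i) s (D (S i) s)) ->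
    (forall s, Rabs (D (S k) s) <= K) ->
    on_cells P (fun s => Rabs (Derive w s - D 1%nat s) <= C * K * mesh_size P ^ k) /\
    forall s, Rabs (w s - D O s) <= C * K * mesh_size P ^ (k + 1).
Hypothesis Hv : forall t, 0 <= t <= T -> is_loc k P (v t) (E O O t) (E O 1%nat t).

Lemma proj_est0 t : 0 <= t <= T ->
  on_cells P (fun s => Rabs (Derive (v t) s - E O 1%nat t s) <= C * K * mesh_size P ^ k) /\
  forall s, Rabs (v t s - E O O t s) <= C * K * mesh_size P ^ (k + 1).
Proof.
  intros Ht. apply (HC (v t) (fun j => E O j t) K); auto.
  - intros i Hi s. apply (sd_ds _ _ _ _ _ HE). lia.
  - intros s. apply (sd_bound _ _ _ _ _ HE). lia.
Qed.

(** By [is_loc_comb] this is the projection error of the difference of the exact solution in time,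
    whose derivative of order k + 1 in s is at most K dt. *)
Lemma proj_est1 t : 0 <= t -> t + dt <= T ->
  on_cells P (fun s => Rabs ((Derive (v (t + dt)) s - E O 1%nat (t + dt) s) - (Derive (v t) s - E O 1%nat t s))
     <= C * (K * dt) * mesh_size P ^ k) /\
  forall s, Rabs ((v (t + dt) s - E O O (t + dt) s) - (v t s - E O O t s)) <= C * (K * dt) * mesh_size P ^ (k + 1).
Proof.
  intros H0 H1. assert (L1 := Hv (t + dt) ltac:(lra)). assert (L0 := Hv t ltac:(lra)).
  assert (LC := is_loc_comb _ _ _ _ _ (-1) _ _ _ L1 L0).
  destruct (HC _ (fun j s => E O j (t + dt) s + -1 * E O j t s) (K * dt) LC) as [A B].
  - intros i Hi s. apply is_derive_plusR; [|apply is_derive_scalR]; apply (sd_ds _ _ _ _ _ HE); lia.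
  - intros s. replace (E O (S k) (t + dt) s + -1 * E O (S k) t s) with (E O (S k) (t + dt) s - E O (S k) t s) by ring.
    apply (time_diff1 (k + 3) T f); auto. lia.
  - split.
    + assert (D1 := pc1_deriv _ _ _ (fe_pc1 _ _ _ (loc_fe _ _ _ _ _ L1))).
      assert (D0 := pc1_deriv _ _ _ (fe_pc1 _ _ _ (loc_fe _ _ _ _ _ L0))).
      intros j Hj s Hs. specialize (A j Hj s Hs). specialize (D1 j Hj s Hs). specialize (D0 j Hj s Hs). cbv beta in *.
      replace (Derive (fun s0 => v (t + dt) s0 + -1 * v t s0) s) with (Derive (v (t + dt)) s + -1 * Derive (v t) s) in A.
      * eapply Rle_trans; [|apply A]. apply Req_le. f_equal. ring.
      * symmetry. apply is_derive_unique, is_derive_plusR; auto. apply is_derive_scalR; auto.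
    + intros s. eapply Rle_trans; [|apply (B s)]. apply Req_le. f_equal. ring.
Qed.

(** The same for second differences: two derivatives in t of the derivative of order k + 1 in s,
    which uses up the regularity k + 3. *)
Lemma proj_est2 t : 0 <= t -> t + dt + dt <= T ->
  forall s, Rabs (((v (t + dt + dt) s - E O O (t + dt + dt) s) - (v (t + dt) s - E O O (t + dt) s)) -
                  ((v (t + dt) s - E O O (t + dt) s) - (v t s - E O O t s)))
     <= C * (K * dt * dt) * mesh_size P ^ (k + 1).
Proof.
  intros H0 H1. assert (L2 := Hv (t + dt + dt) ltac:(lra)). assert (L1 := Hv (t + dt) ltac:(lra)). assert (L0 := Hv t ltac:(lra)).
  assert (LC := is_loc_comb _ _ _ _ _ 1 _ _ _ (is_loc_comb _ _ _ _ _ (-2) _ _ _ L2 L1) L0).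
  destruct (HC _ (fun j s => (E O j (t + dt + dt) s + -2 * E O j (t + dt) s) + 1 * E O j t s) (K * dt * dt) LC) as [_ B].
  - intros i Hi s. apply is_derive_plusR; [apply is_derive_plusR; [|apply is_derive_scalR]|apply is_derive_scalR];
      apply (sd_ds _ _ _ _ _ HE); lia.
  - intros s. replace ((E O (S k) (t + dt + dt) s + -2 * E O (S k) (t + dt) s) + 1 * E O (S k) t s) with
      ((E O (S k) (t + dt + dt) s - E O (S k) (t + dt) s) - (E O (S k) (t + dt) s - E O (S k) t s)) by ring.
    apply (time_diff2 (k + 3) T f); auto. lia.
  - intros s. eapply Rle_trans; [|apply (B s)]. apply Req_le. f_equal. ring.
Qed.
End ScalarProjection.

(** * Consistency *)

Lemma norm2_comp_le v a : Rabs (fst v) <= a -> Rabs (snd v) <= a -> norm2 v <= 2 * a.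
Proof. intros. eapply Rle_trans; [apply norm2_le_abs|]. lra. Qed.

Lemma norm2_quot2_comp dt x y w a : 0 < dt ->
  Rabs ((fst x - fst y) - (fst y - fst w)) <= a * dt * dt ->
  Rabs ((snd x - snd y) - (snd y - snd w)) <= a * dt * dt ->
  norm2 (vsub (vscl (/ dt) (vsub x y)) (vscl (/ dt) (vsub y w))) <= 2 * a * dt.
Proof.
  intros Hdt H1 H2.
  replace (vsub (vscl (/ dt) (vsub x y)) (vscl (/ dt) (vsub y w))) with
    (vscl (/ dt) (vsub (vsub x y) (vsub y w))) by vring.
  apply norm2_quot; auto. replace (2 * a * dt * dt) with (2 * (a * dt * dt)) by ring.
  apply norm2_comp_le; simpl; auto.
Qed.

Lemma pow_le_1 x k : 0 < x -> x <= 1 -> (1 <= k)%nat ->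
  x ^ (k + 1) <= x ^ k /\ x ^ k <= x /\ x ^ k * x ^ k <= x ^ (k + 1).
Proof.
  intros x0 x1 hk.
  assert (p0 : forall j, 0 <= x ^ j) by (intros; apply pow_le; lra).
  assert (p1 : forall j, x ^ j <= 1) by (intros j; rewrite <- (pow1 j); apply pow_incr; lra).
  assert (E : x ^ (k + 1) = x ^ k * x) by (rewrite pow_add; simpl; ring). rewrite E.
  assert (A : x ^ k <= x).
  { destruct k as [|j]; [lia|]. simpl.
    assert (x * x ^ j <= x * 1) by (apply Rmult_le_compat_l; auto; lra). lra. }
  split; [|split; auto].
  - assert (x ^ k * x <= x ^ k * 1) by (apply Rmult_le_compat_l; auto). lra.
  - apply Rmult_le_compat_l; auto.
Qed.

Section Consistency.
Context (alpha : R) (k : nat) (P : partition) (T1 : R) (X : R -> R -> R2)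
  (E1 E2 : nat -> nat -> R -> R -> R) (K0 C m0 dt : R) (N : nat).
Hypothesis ha : 0 < alpha.
Hypothesis hk : (1 <= k)%nat.
Hypothesis HE1 : strip_data (k + 3) T1 (fun t s => fst (X t s)) E1 K0.
Hypothesis HE2 : strip_data (k + 3) T1 (fun t s => snd (X t s)) E2 K0.
Hypothesis Hper : forall t, 0 <= t <= T1 -> periodic (X t).
Let V (i j : nat) (t s : R) : R2 := (E1 i j t s, E2 i j t s).
Hypothesis Hpde : forall t s, 0 <= t <= T1 ->
  tri alpha (V 0 1 t s) (V 0 1 t s) (V 1 0 t s) = V 0 2 t s.
Hypothesis Hm : forall t s, 0 <= t <= T1 -> m0 <= norm2 (V 0 1 t s).
Hypothesis HC0 : 0 <= C.
Hypothesis HC : forall w (D : nat -> R -> R) K, is_loc k P w (D O) (D 1%nat) ->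
    (forall i, (i <= k)%nat -> forall s, is_derive (D i) s (D (S i) s)) ->
    (forall s, Rabs (D (S k) s) <= K) ->
    on_cells P (fun s => Rabs (Derive w s - D 1%nat s) <= C * K * mesh_size P ^ k) /\
    forall s, Rabs (w s - D O s) <= C * K * mesh_size P ^ (k + 1).
Hypothesis Hdt : 0 < dt.
(** There are S N steps: the curves are indexed by n <= S N, their quotients and the defect by n <=
    N. *)
Hypothesis HN : INR (S N) * dt <= T1.
Hypothesis hh : mesh_size P <= 1.
Let h := mesh_size P.
Let tn (n : nat) : R := INR n * dt.
(** One constant for the derivatives of X and for the projection errors; the factor 2 passes from
    components to vectors. *)
Definition Kv : R := 2 * (K0 + 1) * (C + 1).
Let Rn (n : nat) : R -> R2 := RhI k P (X (tn n)).
Let x0 (n : nat) (s : R) : R2 := V 0 0 (tn n) s.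
Let x1 (n : nat) (s : R) : R2 := V 0 1 (tn n) s.
Let rho (n : nat) (s : R) : R2 := vsub (Rn n s) (x0 n s).
Let rho1 (n : nat) (s : R) : R2 := vsub (dS (Rn n) s) (x1 n s).
Let dlt (n : nat) (s : R) : R2 := vsub (x1 (S n) s) (x1 n s).
Let dX : nat -> R -> R2 := dq dt x0.
Let tau (n : nat) (s : R) : R2 := vsub (dX n s) (V 1 0 (tn (S n)) s).
Let drho : nat -> R -> R2 := dq dt rho.
(** The part of G(R_h X) - G(X) linear in [rho1], applied to the quotient of the exact solution; the
    other two factors are smooth, as the integration by parts requires. *)
Definition defect_weak (n : nat) (s : R) : R2 :=
  vadd (tri alpha (rho1 n s) (x1 n s) (dX n s)) (tri alpha (x1 n s) (rho1 n s) (dX n s)).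
(** In order: the quotient of the projection error, of order h^(k+1); the part quadratic in [rho1],
    with h^(2k) <= h^(k+1); the truncation error in time; and the delay of G by one step, the last
    two of order dt. *)
Definition defect_small (n : nat) (s : R) : R2 :=
  vadd (vadd (tri alpha (dS (Rn n) s) (dS (Rn n) s) (drho n s)) (tri alpha (rho1 n s) (rho1 n s) (dX n s)))
    (vadd (tri alpha (x1 (S n) s) (x1 (S n) s) (tau n s))
      (vscl (-1) (vadd (tri alpha (dlt n s) (x1 (S n) s) (dX n s)) (tri alpha (x1 n s) (dlt n s) (dX n s))))).
Definition defect (n : nat) (s : R) : R2 := vadd (defect_weak n s) (defect_small n s).

Lemma K0_nonneg : 0 <= K0.
Proof. eapply Rle_trans; [apply Rabs_pos|apply (sd_bound _ _ _ _ _ HE1 O O ltac:(lia) 0 0)]. Qed.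

Lemma Kv_bounds : 1 <= Kv /\ 2 * K0 <= Kv /\ 2 * (C * K0) <= Kv.
Proof.
  assert (H := K0_nonneg). unfold Kv. assert (0 <= K0 * C) by (apply Rmult_le_pos; auto). lra.
Qed.

Lemma h_pos : 0 < h.
Proof. apply mesh_size_pos. Qed.

Lemma tn_S n : tn (S n) = tn n + dt.
Proof. unfold tn. rewrite S_INR. ring. Qed.

Lemma tn_in n : (n <= S N)%nat -> 0 <= tn n <= T1.
Proof.
  intros Hn. unfold tn. split; [apply Rmult_le_pos; [apply pos_INR|lra]|].
  eapply Rle_trans; [|apply HN]. apply Rmult_le_compat_r; [lra|]. apply le_INR; auto.
Qed.

Lemma X_fst t : 0 <= t <= T1 -> (fun s => fst (X t s)) = E1 0%nat 0%nat t.
Proof. intros Ht. extensionality s. symmetry. apply (sd_0 _ _ _ _ _ HE1). auto. Qed.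
Lemma X_snd t : 0 <= t <= T1 -> (fun s => snd (X t s)) = E2 0%nat 0%nat t.
Proof. intros Ht. extensionality s. symmetry. apply (sd_0 _ _ _ _ _ HE2). auto. Qed.

Lemma X_V t s : 0 <= t <= T1 -> X t s = V 0 0 t s.
Proof.
  intros Ht. unfold V. rewrite (sd_0 _ _ _ _ _ HE1), (sd_0 _ _ _ _ _ HE2); auto. apply surjective_pairing.
Qed.

Lemma cont_s1 i j t s : (i + j <= k + 3)%nat -> continuous (E1 i j t) s.
Proof. intros H. apply (continuity_2d_slice2 (E1 i j)), (sd_cont _ _ _ _ _ HE1); auto. Qed.
Lemma cont_s2 i j t s : (i + j <= k + 3)%nat -> continuous (E2 i j t) s.
Proof. intros H. apply (continuity_2d_slice2 (E2 i j)), (sd_cont _ _ _ _ _ HE2); auto. Qed.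

Lemma RhI_loc t : 0 <= t <= T1 ->
  is_loc k P (fun s => fst (RhI k P (X t) s)) (E1 O O t) (E1 O 1%nat t) /\
  is_loc k P (fun s => snd (RhI k P (X t) s)) (E2 O O t) (E2 O 1%nat t).
Proof.
  intros Ht. destruct (RhI_is_loc k P (X t) (E1 O 1%nat t) (E2 O 1%nat t) hk (Hper t Ht)) as [L1 L2].
  - intros s. apply (is_derive_ext (E1 0%nat 0%nat t)).
    + intros u. apply (sd_0 _ _ _ _ _ HE1); auto.
    + apply (sd_ds _ _ _ _ _ HE1). lia.
  - intros s. apply (is_derive_ext (E2 0%nat 0%nat t)).
    + intros u. apply (sd_0 _ _ _ _ _ HE2); auto.
    + apply (sd_ds _ _ _ _ _ HE2). lia.
  - intros s. apply cont_s1. lia.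
  - intros s. apply cont_s2. lia.
  - rewrite (X_fst t Ht) in L1. rewrite (X_snd t Ht) in L2. auto.
Qed.

Lemma Rn_fe n : (n <= S N)%nat -> fe_space k P (Rn n).
Proof.
  intros Hn. destruct (RhI_loc (tn n) (tn_in n Hn)) as [L1 L2].
  split; [apply (loc_fe _ _ _ _ _ L1)|apply (loc_fe _ _ _ _ _ L2)].
Qed.

Lemma V_pc1v i j t : (i + S j <= k + 3)%nat -> pc1v P (V i j t) (V i (S j) t).
Proof.
  intros H. split; apply pc1_smooth.
  - apply (sd_per _ _ _ _ _ HE1). lia.
  - apply (sd_per _ _ _ _ _ HE1). lia.
  - intros s. apply (sd_ds _ _ _ _ _ HE1). lia.
  - intros s. apply cont_s1. lia.
  - apply (sd_per _ _ _ _ _ HE2). lia.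
  - apply (sd_per _ _ _ _ _ HE2). lia.
  - intros s. apply (sd_ds _ _ _ _ _ HE2). lia.
  - intros s. apply cont_s2. lia.
Qed.

Lemma pc1v_sub f f' g g' : pc1v P f f' -> pc1v P g g' ->
  pc1v P (fun s => vsub (f s) (g s)) (fun s => vsub (f' s) (g' s)).
Proof. intros [] []. split; apply pc1_minus; auto. Qed.

Lemma pc1v_scl c f f' : pc1v P f f' -> pc1v P (fun s => vscl c (f s)) (fun s => vscl c (f' s)).
Proof. intros []. split; apply pc1_scal; auto. Qed.

Lemma x0_pc1v n : pc1v P (x0 n) (x1 n).
Proof. apply (V_pc1v 0 0). lia. Qed.
Lemma x1_pc1v n : pc1v P (x1 n) (V 0 2 (tn n)).
Proof. apply (V_pc1v 0 1). lia. Qed.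
Lemma rho_pc1v n : (n <= S N)%nat -> pc1v P (rho n) (rho1 n).
Proof. intros Hn. apply pc1v_sub; [apply (fe_pc1v k); apply Rn_fe; auto|apply x0_pc1v]. Qed.
Lemma dX_pc1v n : pc1v P (dX n) (dq dt x1 n).
Proof. apply pc1v_scl, pc1v_sub; apply x0_pc1v. Qed.

Lemma V_bound i j t s : (i + j <= k + 3)%nat -> norm2 (V i j t s) <= Kv.
Proof.
  intros H. assert (B := Kv_bounds). eapply Rle_trans; [apply (norm2_comp_le _ K0)|lra].
  - apply (sd_bound _ _ _ _ _ HE1). auto.
  - apply (sd_bound _ _ _ _ _ HE2). auto.
Qed.

Lemma V_diff j n s : (j <= 2)%nat -> (n < S N)%nat ->
  norm2 (vsub (V 0 j (tn (S n)) s) (V 0 j (tn n) s)) <= Kv * dt.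
Proof.
  intros Hj Hn. rewrite tn_S. assert (B := Kv_bounds).
  assert (I1 := tn_in n ltac:(lia)). assert (I2 := tn_in (S n) ltac:(lia)). rewrite tn_S in I2.
  eapply Rle_trans; [apply (norm2_comp_le _ (K0 * dt))|].
  - simpl. apply (time_diff1 (k + 3) T1 _ E1 K0 dt HE1 Hdt 0 j); [lia|lra|lra].
  - simpl. apply (time_diff1 (k + 3) T1 _ E2 K0 dt HE2 Hdt 0 j); [lia|lra|lra].
  - assert (2 * K0 * dt <= Kv * dt) by (apply Rmult_le_compat_r; lra). lra.
Qed.

Lemma V_quot j n s : (j <= 2)%nat -> (n < S N)%nat ->
  norm2 (vscl (/ dt) (vsub (V 0 j (tn (S n)) s) (V 0 j (tn n) s))) <= Kv.
Proof. intros. apply norm2_quot; auto. apply V_diff; auto. Qed.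

Lemma V_diff2 j n s : (j <= 2)%nat -> (j <= k + 1)%nat -> (S n < S N)%nat ->
  norm2 (vsub (vscl (/ dt) (vsub (V 0 j (tn (S (S n))) s) (V 0 j (tn (S n)) s)))
    (vscl (/ dt) (vsub (V 0 j (tn (S n)) s) (V 0 j (tn n) s)))) <= Kv * dt.
Proof.
  intros Hj Hjk Hn. assert (B := Kv_bounds).
  assert (I1 := tn_in n ltac:(lia)). assert (I2 := tn_in (S (S n)) ltac:(lia)). rewrite !tn_S in *.
  eapply Rle_trans; [apply (norm2_quot2_comp dt _ _ _ K0 Hdt)|].
  - simpl. apply (time_diff2 (k + 3) T1 _ E1 K0 dt HE1 Hdt 0 j); [lia|lra|lra].
  - simpl. apply (time_diff2 (k + 3) T1 _ E2 K0 dt HE2 Hdt 0 j); [lia|lra|lra].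
  - apply Rmult_le_compat_r; lra.
Qed.

Lemma tau_bound n s : (n < S N)%nat -> norm2 (tau n s) <= Kv * dt.
Proof.
  intros Hn. assert (B := Kv_bounds).
  assert (I1 := tn_in n ltac:(lia)). assert (I2 := tn_in (S n) ltac:(lia)). rewrite tn_S in I2.
  replace (tau n s) with (vscl (/ dt) (vsub (vsub (x0 (S n) s) (x0 n s)) (vscl dt (V 1 0 (tn (S n)) s)))).
  2:{ unfold tau, dX, dq, vscl, vsub. simpl. f_equal; field; lra. }
  apply norm2_quot; auto. eapply Rle_trans; [apply (norm2_comp_le _ (K0 * dt * dt))|].
  - simpl. rewrite tn_S. apply (time_tau (k + 3) T1 _ E1 K0 dt HE1 Hdt 0 0); [lia|lra|lra].
  - simpl. rewrite tn_S. apply (time_tau (k + 3) T1 _ E2 K0 dt HE2 Hdt 0 0); [lia|lra|lra].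
  - assert (2 * K0 * (dt * dt) <= Kv * (dt * dt)) by (apply Rmult_le_compat_r; nra). lra.
Qed.

Lemma tau_diff n s : (S n < S N)%nat -> norm2 (vsub (tau (S n) s) (tau n s)) <= Kv * dt * dt.
Proof.
  intros Hn. assert (B := Kv_bounds).
  assert (I1 := tn_in n ltac:(lia)). assert (I2 := tn_in (S (S n)) ltac:(lia)). rewrite !tn_S in I2.
  replace (vsub (tau (S n) s) (tau n s)) with (vscl (/ dt) (vsub
    (vsub (vsub (x0 (S (S n)) s) (x0 (S n) s)) (vscl dt (V 1 0 (tn (S (S n))) s)))
    (vsub (vsub (x0 (S n) s) (x0 n s)) (vscl dt (V 1 0 (tn (S n)) s))))).
  2:{ unfold tau, dX, dq, vscl, vsub. simpl. f_equal; field; lra. }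
  apply norm2_quot; auto. eapply Rle_trans; [apply (norm2_comp_le _ (K0 * dt * dt * dt))|].
  - simpl. rewrite !tn_S. apply (time_dtau (k + 3) T1 _ E1 K0 dt HE1 Hdt 0 0); [lia|lra|lra].
  - simpl. rewrite !tn_S. apply (time_dtau (k + 3) T1 _ E2 K0 dt HE2 Hdt 0 0); [lia|lra|lra].
  - assert (2 * K0 * (dt * dt * dt) <= Kv * (dt * dt * dt)).
    { apply Rmult_le_compat_r; [|lra]. repeat apply Rmult_le_pos; lra. } lra.
Qed.

Lemma CK_le x : 0 <= x -> 2 * (C * K0 * x) <= Kv * x.
Proof. intros Hx. assert (B := Kv_bounds). assert (2 * (C * K0) * x <= Kv * x) by (apply Rmult_le_compat_r; lra). lra. Qed.

Lemma hpow j : 0 <= h ^ j.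
Proof. apply pow_le. left. apply h_pos. Qed.

Lemma rho_bound n s : (n <= S N)%nat -> norm2 (rho n s) <= Kv * h ^ (k + 1).
Proof.
  intros Hn. assert (I1 := tn_in n Hn).
  eapply Rle_trans; [apply (norm2_comp_le _ (C * K0 * h ^ (k + 1)))|apply CK_le, hpow].
  - apply (proj2 (proj_est0 k P T1 _ E1 K0 C (fun t s => fst (RhI k P (X t) s)) hk HE1 HC (fun t Ht => proj1 (RhI_loc t Ht)) (tn n) I1) s).
  - apply (proj2 (proj_est0 k P T1 _ E2 K0 C (fun t s => snd (RhI k P (X t) s)) hk HE2 HC (fun t Ht => proj2 (RhI_loc t Ht)) (tn n) I1) s).
Qed.

Lemma rho1_bound n : (n <= S N)%nat -> on_cells P (fun s => norm2 (rho1 n s) <= Kv * h ^ k).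
Proof.
  intros Hn. assert (I1 := tn_in n Hn).
  eapply on_cells_imp2; [|
    apply (proj1 (proj_est0 k P T1 _ E1 K0 C (fun t s => fst (RhI k P (X t) s)) hk HE1 HC (fun t Ht => proj1 (RhI_loc t Ht)) (tn n) I1))|
    apply (proj1 (proj_est0 k P T1 _ E2 K0 C (fun t s => snd (RhI k P (X t) s)) hk HE2 HC (fun t Ht => proj2 (RhI_loc t Ht)) (tn n) I1))].
  intros s H1 H2. cbv beta in *.
  eapply Rle_trans; [apply (norm2_comp_le _ (C * K0 * h ^ k))|apply CK_le, hpow]; auto.
Qed.

Lemma rho1_diff n : (n < S N)%nat ->
  on_cells P (fun s => norm2 (vsub (rho1 (S n) s) (rho1 n s)) <= Kv * h ^ k * dt).
Proof.
  intros Hn. assert (I1 := tn_in n ltac:(lia)). assert (I2 := tn_in (S n) ltac:(lia)).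
  rewrite tn_S in I2.
  eapply on_cells_imp2; [|
    apply (proj1 (proj_est1 k P T1 _ E1 K0 dt C (fun t s => fst (RhI k P (X t) s)) hk HE1 Hdt HC (fun t Ht => proj1 (RhI_loc t Ht)) (tn n) ltac:(lra) ltac:(lra)))|
    apply (proj1 (proj_est1 k P T1 _ E2 K0 dt C (fun t s => snd (RhI k P (X t) s)) hk HE2 Hdt HC (fun t Ht => proj2 (RhI_loc t Ht)) (tn n) ltac:(lra) ltac:(lra)))].
  intros s H1 H2. cbv beta in *. rewrite <- tn_S in H1, H2.
  assert (hp := hpow k).
  eapply Rle_trans; [apply (norm2_comp_le _ (C * (K0 * dt) * h ^ k))|]; auto.
  assert (W := CK_le (h ^ k * dt) ltac:(apply Rmult_le_pos; lra)). lra.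
Qed.

Lemma rho_diff n s : (n < S N)%nat ->
  norm2 (vsub (rho (S n) s) (rho n s)) <= Kv * h ^ (k + 1) * dt.
Proof.
  intros Hn. assert (I1 := tn_in n ltac:(lia)). assert (I2 := tn_in (S n) ltac:(lia)).
  rewrite tn_S in I2. assert (hp := hpow (k + 1)).
  eapply Rle_trans; [apply (norm2_comp_le _ (C * (K0 * dt) * h ^ (k + 1)))|].
  - unfold rho, Rn, x0. rewrite tn_S.
    apply (proj2 (proj_est1 k P T1 _ E1 K0 dt C (fun t s => fst (RhI k P (X t) s)) hk HE1 Hdt HC (fun t Ht => proj1 (RhI_loc t Ht)) (tn n) ltac:(lra) ltac:(lra)) s).
  - unfold rho, Rn, x0. rewrite tn_S.
    apply (proj2 (proj_est1 k P T1 _ E2 K0 dt C (fun t s => snd (RhI k P (X t) s)) hk HE2 Hdt HC (fun t Ht => proj2 (RhI_loc t Ht)) (tn n) ltac:(lra) ltac:(lra)) s).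
  - assert (W := CK_le (h ^ (k + 1) * dt) ltac:(apply Rmult_le_pos; lra)). lra.
Qed.

Lemma drho_bound n s : (n < S N)%nat -> norm2 (drho n s) <= Kv * h ^ (k + 1).
Proof. intros Hn. apply norm2_quot; auto. apply rho_diff; auto. Qed.

Lemma drho_diff n s : (S n < S N)%nat ->
  norm2 (vsub (drho (S n) s) (drho n s)) <= Kv * h ^ (k + 1) * dt.
Proof.
  intros Hn. assert (I1 := tn_in n ltac:(lia)). assert (I2 := tn_in (S (S n)) ltac:(lia)).
  rewrite !tn_S in I2. assert (hp := hpow (k + 1)).
  eapply Rle_trans; [apply (norm2_quot2_comp dt _ _ _ (C * K0 * h ^ (k + 1)) Hdt)|].
  - unfold rho, Rn, x0. rewrite !tn_S. eapply Rle_trans;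
    [apply (proj_est2 k P T1 _ E1 K0 dt C (fun t s => fst (RhI k P (X t) s)) hk HE1 Hdt HC (fun t Ht => proj1 (RhI_loc t Ht)) (tn n) ltac:(lra) ltac:(lra) s)|].
    unfold h. lra.
  - unfold rho, Rn, x0. rewrite !tn_S. eapply Rle_trans;
    [apply (proj_est2 k P T1 _ E2 K0 dt C (fun t s => snd (RhI k P (X t) s)) hk HE2 Hdt HC (fun t Ht => proj2 (RhI_loc t Ht)) (tn n) ltac:(lra) ltac:(lra) s)|].
    unfold h. lra.
  - assert (W := CK_le (h ^ (k + 1) * dt) ltac:(apply Rmult_le_pos; lra)).
    replace (2 * (C * K0 * h ^ (k + 1)) * dt) with (2 * (C * K0 * (h ^ (k + 1) * dt))) by ring. lra.
Qed.

(** * Sizes of the factors of the defect *)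

Lemma bnd_x1 s : bnd N dt Kv (fun n => x1 n s).
Proof.
  split; intros n Hn; [apply V_bound; lia|apply V_diff; lia].
Qed.
Lemma bnd_x1S s : bnd N dt Kv (fun n => x1 (S n) s).
Proof.
  split; intros n Hn; [apply V_bound; lia|apply V_diff; lia].
Qed.
Lemma bnd_dlt s : bnd N dt (Kv * dt) (fun n => dlt n s).
Proof.
  split; intros n Hn; [apply V_diff; lia|].
  replace (vsub (dlt (S n) s) (dlt n s)) with (vscl dt (vsub (dq dt x1 (S n) s) (dq dt x1 n s))).
  - rewrite norm2_scl, (Rabs_right dt), Rmult_comm by lra. apply Rmult_le_compat_r; [lra|].
    apply (V_diff2 1); lia.
  - unfold dq, dlt, vscl, vsub. simpl. f_equal; field; lra.
Qed.
Lemma bnd_dX s : bnd N dt Kv (fun n => dX n s).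
Proof.
  split; intros n Hn; [apply V_quot; lia|apply (V_diff2 0); lia].
Qed.
Lemma bnd_tau s : bnd N dt (Kv * dt) (fun n => tau n s).
Proof. split; intros n Hn; [apply tau_bound; lia|apply tau_diff; lia]. Qed.
Lemma bnd_drho s : bnd N dt (Kv * h ^ (k + 1)) (fun n => drho n s).
Proof. split; intros n Hn; [apply drho_bound; lia|apply drho_diff; lia]. Qed.
Lemma bnd_rho1 : on_cells P (fun s => bnd N dt (Kv * h ^ k) (fun n => rho1 n s)).
Proof.
  intros j Hj s Hs. split; intros n Hn.
  - apply (rho1_bound n ltac:(lia) j Hj s Hs).
  - apply (rho1_diff n ltac:(lia) j Hj s Hs).
Qed.

Let J : R := h ^ (k + 1) + dt.
Let H : R := h ^ k + dt.
Let B3 : R := Ca alpha * (Kv * Kv * Kv).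
(** One constant for all bounds of the section. The largest demand, 504 = 6 * 84 times B3^2, comes
    from the six terms of [weak_diff_estimate]. *)
Definition Khat : R := 1000 * (B3 * B3).

Lemma h_powers : h ^ (k + 1) <= h ^ k /\ h ^ k <= h /\ h ^ k * h ^ k <= h ^ (k + 1).
Proof. apply pow_le_1; auto. apply h_pos. Qed.

Lemma B3_bounds : 1 <= B3 /\ Kv <= B3.
Proof.
  assert (B := Kv_bounds). assert (C1 := Ca_ge1 alpha). unfold B3. assert (Kv <= Kv * Kv * Kv) by nra. nra.
Qed.

Lemma Khat_bounds : 1 <= Khat /\ 21 * B3 <= Khat /\ 2 * Kv <= Khat /\ 504 * (B3 * B3) <= Khat.
Proof.
  assert (B := B3_bounds). unfold Khat. assert (B3 <= B3 * B3) by nra. lra.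
Qed.

Lemma J_H : 0 < J /\ J <= H /\ h ^ (k + 1) <= J /\ dt <= J /\ h ^ k <= H.
Proof.
  assert (W := h_powers). assert (W2 := hpow (k + 1)). unfold J, H. lra.
Qed.

Lemma bnd_weak : on_cells P (fun s => bnd N dt (6 * B3 * h ^ k) (fun n => defect_weak n s)).
Proof.
  eapply on_cells_imp; [|apply bnd_rho1]. intros s Hs. cbv beta in *.
  replace (6 * B3 * h ^ k) with (3 * Ca alpha * (Kv * h ^ k * Kv * Kv) + 3 * Ca alpha * (Kv * (Kv * h ^ k) * Kv))
    by (unfold B3; ring).
  apply bnd_add; apply bnd_tri; auto using bnd_x1, bnd_dX.
Qed.

Lemma bnd_R1 : on_cells P (fun s => bnd N dt (2 * Kv) (fun n => dS (Rn n) s)).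
Proof.
  assert (B := Kv_bounds). assert (W := h_powers). fold h in hh.
  eapply on_cells_imp; [|apply bnd_rho1]. intros s Hs. cbv beta in *.
  apply (bnd_ext N dt _ (fun n => vadd (x1 n s) (rho1 n s))).
  - intros n Hn. unfold rho1. rewrite (surjective_pairing (dS (Rn n) s)). vring.
  - replace (2 * Kv) with (Kv + Kv) by ring. apply bnd_add; [apply bnd_x1|].
    apply (bnd_le N dt (Kv * h ^ k)); auto; [lra|].
    rewrite <- (Rmult_1_r Kv) at 2. apply Rmult_le_compat_l; lra.
Qed.

Lemma bnd_small : on_cells P (fun s => bnd N dt (15 * B3 * J) (fun n => defect_small n s)).
Proof.
  assert (B := B3_bounds). assert (W := h_powers).
  eapply on_cells_imp2; [|apply bnd_rho1|apply bnd_R1]. intros s Hs HR. cbv beta in *.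
  apply (bnd_le N dt (3 * Ca alpha * (2 * Kv * (2 * Kv) * (Kv * h ^ (k + 1))) + 3 * Ca alpha * (Kv * h ^ k * (Kv * h ^ k) * Kv) +
    (3 * Ca alpha * (Kv * Kv * (Kv * dt)) + (3 * Ca alpha * (Kv * dt * Kv * Kv) + 3 * Ca alpha * (Kv * (Kv * dt) * Kv))))); [lra| |].
  - replace (3 * Ca alpha * (2 * Kv * (2 * Kv) * (Kv * h ^ (k + 1))) + 3 * Ca alpha * (Kv * h ^ k * (Kv * h ^ k) * Kv) +
    (3 * Ca alpha * (Kv * Kv * (Kv * dt)) + (3 * Ca alpha * (Kv * dt * Kv * Kv) + 3 * Ca alpha * (Kv * (Kv * dt) * Kv)))) with
      (B3 * (12 * h ^ (k + 1) + 3 * (h ^ k * h ^ k) + 9 * dt)) by (unfold B3; ring).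
    replace (15 * B3 * J) with (B3 * (15 * J)) by ring. apply Rmult_le_compat_l; [lra|]. unfold J. lra.
  - apply bnd_add; [apply bnd_add; apply bnd_tri; auto using bnd_drho, bnd_dX|].
    apply bnd_add; [apply bnd_tri; auto using bnd_x1S, bnd_tau|].
    apply bnd_opp, bnd_add; apply bnd_tri; auto using bnd_x1, bnd_x1S, bnd_dlt, bnd_dX.
Qed.

Lemma bnd_defect : on_cells P (fun s => bnd N dt (Khat * H) (fun n => defect n s)).
Proof.
  eapply on_cells_imp2; [|apply bnd_weak|apply bnd_small]. intros s H1 H2. cbv beta in *.
  assert (B := B3_bounds). assert (W := J_H). assert (Wk := Khat_bounds).
  apply (bnd_le N dt (6 * B3 * h ^ k + 15 * B3 * J)); [lra| |apply bnd_add; auto].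
  assert (6 * B3 * h ^ k <= 6 * B3 * H) by (apply Rmult_le_compat_l; lra).
  assert (15 * B3 * J <= 15 * B3 * H) by (apply Rmult_le_compat_l; lra).
  assert (21 * B3 * H <= Khat * H) by (apply Rmult_le_compat_r; lra). lra.
Qed.

Lemma dq_split n s : dq dt Rn n s = vadd (dX n s) (drho n s).
Proof. unfold dX, drho, rho, dq. vring. Qed.

(** The terms of the defect telescope to the difference between the time term of the scheme at the
    projected curves and that of the flow at the new level. *)
Lemma defect_eq n s : defect n s =
  vsub (tri alpha (dS (Rn n) s) (dS (Rn n) s) (dq dt Rn n s))
       (tri alpha (x1 (S n) s) (x1 (S n) s) (V 1 0 (tn (S n)) s)).
Proof.
  rewrite dq_split. unfold defect, defect_weak, defect_small.
  unfold tau, dlt, rho1. generalize (dX n s) (drho n s) (x1 n s) (x1 (S n) s) (dS (Rn n) s) (V 1 0 (tn (S n)) s).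
  intros. vring.
Qed.

(** * The perturbed scheme and weak bounds of the defect *)

Lemma pv_x1 n : pv P (x1 n).
Proof. apply (pc1v_pv _ _ _ (x1_pc1v n)). Qed.
Lemma pv_Rn1' n : (n <= S N)%nat -> pv P (dS (Rn n)).
Proof. intros Hn. apply (fe_pv_dS k), Rn_fe; auto. Qed.
Lemma pv_dX n : pv P (dX n).
Proof. apply (pc1v_pv _ _ _ (dX_pc1v n)). Qed.
Lemma pv_rho1 n : (n <= S N)%nat -> pv P (rho1 n).
Proof. intros Hn. apply (pc1v_pv _ _ _ (rho_pc1v n Hn)). Qed.
Lemma pv_rho n : (n <= S N)%nat -> pv P (rho n).
Proof. intros Hn. apply (pc1v_pv _ _ _ (rho_pc1v n Hn)). Qed.
Lemma pv_Vt n : pv P (V 1 0 (tn n)).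
Proof. apply (pc1v_pv _ _ _ (V_pc1v 1 0 (tn n) ltac:(lia))). Qed.

Lemma pv_weak n : (n < S N)%nat -> pv P (defect_weak n).
Proof.
  intros Hn. assert (A1 := pv_x1 n). assert (A2 := pv_dX n). assert (A3 := pv_rho1 n ltac:(lia)).
  unfold defect_weak. pc.
Qed.

Lemma pv_small n : (n < S N)%nat -> pv P (defect_small n).
Proof.
  intros Hn. assert (A1 := pv_x1 n). assert (A2 := pv_dX n). assert (A3 := pv_rho1 n ltac:(lia)).
  assert (A4 := pv_x1 (S n)). assert (A5 := pv_Rn1' n ltac:(lia)). assert (A6 := pv_Vt (S n)).
  assert (A7 : pv P (dlt n)) by (unfold dlt; pc).
  assert (A8 : pv P (tau n)) by (unfold tau; pc).
  assert (A9 : pv P (drho n)).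
  { apply (pv_dq dt P rho); apply pv_rho; lia. }
  unfold defect_small. pc.
Qed.

Lemma pv_defect n : (n < S N)%nat -> pv P (defect n).
Proof. intros Hn. assert (A1 := pv_weak n Hn). assert (A2 := pv_small n Hn). unfold defect. pc. Qed.

(** This covers the nodal interpolation too: for k = 1 the derivative of its error has zero mean on
    every cell, where the derivative of xi is constant. The stiffness term therefore contributes
    nothing to the defect. *)
Lemma ritz_orth n xi : (n <= S N)%nat -> fe_space k P xi ->
  pI (fun s => dot (dS (Rn n) s) (dS xi s)) = pI (fun s => dot (x1 n s) (dS xi s)).
Proof.
  intros Hn Hx. destruct (RhI_loc (tn n) (tn_in n Hn)) as [L1 L2].
  assert (O1 := loc_orth_global _ _ _ _ _ _ L1 (proj1 Hx)). assert (O2 := loc_orth_global _ _ _ _ _ _ L2 (proj2 Hx)).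
  assert (P1 := pv_Rn1' n Hn). assert (P2 := pv_x1 n). assert (P3 := fe_pv_dS _ _ _ Hx).
  assert (P4 := pv_rho1 n Hn).
  assert (Z : pI (fun s => dot (rho1 n s) (dS xi s)) = 0).
  { rewrite (pI_dot P) by auto. rewrite <- (Rplus_0_r 0). exact (f_equal2 Rplus O1 O2). }
  assert (E : pI (fun s => dot (rho1 n s) (dS xi s)) =
    pI (fun s => dot (dS (Rn n) s) (dS xi s)) - pI (fun s => dot (x1 n s) (dS xi s))).
  { rewrite <- (I_minus P) by pc. apply RI_ext; [generalize twoPI; lra|]. intros s _. unfold rho1. vring. }
  lra.
Qed.

Lemma pde_weak n xi : (n <= S N)%nat -> fe_space k P xi ->
  pI (fun s => dot (tri alpha (x1 n s) (x1 n s) (V 1 0 (tn n) s)) (xi s)) +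
  pI (fun s => dot (x1 n s) (dS xi s)) = 0.
Proof.
  intros Hn Hx. assert (Z := pc1_I_0 _ _ _ (pc1_dot _ _ _ _ _ (x1_pc1v n) (fe_pc1v _ _ _ Hx))).
  assert (P2 := pv_x1 n). assert (P3 := fe_pv_dS _ _ _ Hx). assert (P5 := fe_pv _ _ _ Hx).
  assert (P4 : pv P (V 0 2 (tn n))) by apply (pc1v_pv _ _ _ (x1_pc1v n)).
  rewrite (I_plus P) in Z by pc. rewrite <- Z. f_equal.
  apply RI_ext; [generalize twoPI; lra|]. intros s _. unfold x1. rewrite Hpde; auto. apply tn_in; auto.
Qed.

(** The condition on h keeps the projected curves regular, since |rho1| <= Kv h^k <= Kv h. The
    equation is the weak form of the flow at the new level, combined with [ritz_orth]. *)
Lemma consistency : Kv * h <= m0 / 2 ->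
  approx_data alpha k P (S N) dt Khat (m0 / 2) H Rn defect.
Proof.
  intros Hh. assert (W := h_powers). assert (WK := Khat_bounds). assert (BK := Kv_bounds).
  split.
  - apply Rn_fe.
  - apply pv_defect.
  - intros n Hn.
    assert (A1 := rho1_bound n Hn).
    eapply on_cells_imp; [|apply A1]. intros s Hs. cbv beta in *.
    assert (Vb : norm2 (x1 n s) <= Kv) by (apply V_bound; lia).
    assert (Vm := Hm (tn n) s (tn_in n Hn)). fold (x1 n s) in Vm.
    assert (Kh : Kv * h ^ k <= Kv * h) by (apply Rmult_le_compat_l; lra).
    assert (T2 : norm2 (x1 n s) <= norm2 (dS (Rn n) s) + norm2 (rho1 n s)).
    { replace (x1 n s) with (vsub (dS (Rn n) s) (rho1 n s)) at 1; [apply norm2_sub|]. unfold rho1.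
      rewrite (surjective_pairing (x1 n s)). vring. }
    assert (T1' : norm2 (dS (Rn n) s) <= norm2 (x1 n s) + norm2 (rho1 n s)).
    { replace (dS (Rn n) s) with (vadd (x1 n s) (rho1 n s)) at 1; [apply norm2_add|]. unfold rho1.
      rewrite (surjective_pairing (dS (Rn n) s)). vring. }
    fold h in hh. lra.
  - intros n Hn.
    eapply on_cells_imp; [|apply (rho1_diff n Hn)]. intros s Hs. cbv beta in *.
    assert (Vd : norm2 (vsub (x1 (S n) s) (x1 n s)) <= Kv * dt) by (apply V_diff; lia).
    replace (vsub (dS (Rn (S n)) s) (dS (Rn n) s)) with
      (vadd (vsub (x1 (S n) s) (x1 n s)) (vsub (rho1 (S n) s) (rho1 n s))) by (unfold rho1; vring).
    eapply Rle_trans; [apply norm2_add|].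
    fold h in hh. assert (Kv * h ^ k * dt <= Kv * 1 * dt).
    { apply Rmult_le_compat_r; [lra|]. apply Rmult_le_compat_l; lra. }
    assert (2 * Kv * dt <= Khat * dt) by (apply Rmult_le_compat_r; lra). lra.
  - intros n Hn. apply on_cells_all. intros s. rewrite dq_split.
    eapply Rle_trans; [apply norm2_add|].
    assert (A1 := drho_bound n s Hn). assert (A2 : norm2 (dX n s) <= Kv) by (apply V_quot; lia).
    fold h in hh. assert (Kv * h ^ (k + 1) <= Kv * 1) by (apply Rmult_le_compat_l; lra). lra.
  - intros n Hn. apply on_cells_all. intros s. rewrite !dq_split.
    replace (vsub (vadd (dX (S n) s) (drho (S n) s)) (vadd (dX n s) (drho n s))) with
      (vadd (vsub (dX (S n) s) (dX n s)) (vsub (drho (S n) s) (drho n s))) by vring.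
    eapply Rle_trans; [apply norm2_add|].
    assert (A1 := drho_diff n s Hn). assert (A2 : norm2 (vsub (dX (S n) s) (dX n s)) <= Kv * dt) by (apply (V_diff2 0); lia).
    fold h in hh. assert (Kv * h ^ (k + 1) * dt <= Kv * 1 * dt).
    { apply Rmult_le_compat_r; [lra|]. apply Rmult_le_compat_l; lra. }
    assert (2 * Kv * dt <= Khat * dt) by (apply Rmult_le_compat_r; lra). lra.
  - intros n Hn. eapply on_cells_imp; [|apply bnd_defect]. intros s [Hs _]. apply Hs. lia.
  - intros n Hn. eapply on_cells_imp; [|apply bnd_defect]. intros s [_ Hs]. apply Hs. lia.
  - intros n Hn xi Hx.
    assert (P1 := pv_Rn1' n ltac:(lia)). assert (P2 := pv_x1 (S n)). assert (P3 := fe_pv _ _ _ Hx).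
    assert (P4 := pv_Vt (S n)).
    assert (P6 : pv P (dq dt Rn n)) by (apply pv_dq; apply (fe_pv k), Rn_fe; lia).
    rewrite (ritz_orth (S n) xi) by (auto; lia).
    assert (Z := pde_weak (S n) xi ltac:(lia) Hx).
    assert (E : pI (fun s => dot (defect n s) (xi s)) =
      pI (fun s => dot (tri alpha (dS (Rn n) s) (dS (Rn n) s) (dq dt Rn n s)) (xi s)) -
      pI (fun s => dot (tri alpha (x1 (S n) s) (x1 (S n) s) (V 1 0 (tn (S n)) s)) (xi s))).
    { rewrite <- (I_minus P) by pc. apply RI_ext; [generalize twoPI; lra|]. intros s _. rewrite defect_eq. vring. }
    lra.
Qed.

Lemma weak_estimate n xi : (n < S N)%nat -> fe_space k P xi ->
  Rabs (pI (fun s => dot (defect_weak n s) (xi s))) <= / 8 * Sob xi + Khat * (J * J).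
Proof.
  intros Hn Hx. assert (WK := Khat_bounds). assert (WJ := J_H). assert (hp := hpow (k + 1)).
  assert (P1 := pv_x1 n). assert (P2 := pv_dX n). assert (P3 := pv_rho1 n ltac:(lia)). assert (P4 := fe_pv _ _ _ Hx).
  (* Weight 1/16 for each of the two terms of the weak defect gives 1/8 in total. *)
  assert (WB := weak_bound alpha k P _ _ _ _ _ _ xi (Kv * h ^ (k + 1)) Kv Kv (/ 16) ltac:(lra) Hx
    (rho_pc1v n ltac:(lia)) (x1_pc1v n) (dX_pc1v n)
    (fun s => rho_bound n s ltac:(lia)) (fun s => V_bound 0 1 (tn n) s ltac:(lia)) (fun s => V_bound 0 2 (tn n) s ltac:(lia))
    (fun s => V_quot 0 n s ltac:(lia) Hn) (fun s => V_quot 1 n s ltac:(lia) Hn)).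
  cbv zeta in WB. destruct WB as [W1 W2].
  assert (E : pI (fun s => dot (defect_weak n s) (xi s)) =
    pI (fun s => dot (tri alpha (rho1 n s) (x1 n s) (dX n s)) (xi s)) +
    pI (fun s => dot (tri alpha (x1 n s) (rho1 n s) (dX n s)) (xi s))).
  { rewrite <- (I_plus P) by pc. apply RI_ext; [generalize twoPI; lra|]. intros s _. unfold defect_weak. vring. }
  assert (Bd : 14 / / 16 * (Ca alpha * (Kv * h ^ (k + 1) * Kv * Kv) * (Ca alpha * (Kv * h ^ (k + 1) * Kv * Kv))) <= 224 * (B3 * B3) * (J * J)).
  { replace (14 / / 16 * (Ca alpha * (Kv * h ^ (k + 1) * Kv * Kv) * (Ca alpha * (Kv * h ^ (k + 1) * Kv * Kv)))) with
      (224 * (B3 * B3) * (h ^ (k + 1) * h ^ (k + 1))) by (unfold B3; field).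
    apply Rmult_le_compat_l; [nra|]. apply Rmult_le_compat; lra. }
  rewrite E. eapply Rle_trans; [apply Rabs_triang|].
  assert (448 * (B3 * B3) * (J * J) <= Khat * (J * J)) by (apply Rmult_le_compat_r; nra).
  change (fun s => dot (tri alpha (rho1 n s) (x1 n s) (dX n s)) (xi s)) with (fun s => dot (tri alpha (rho1 n s) (x1 n s) (dX n s)) (xi s)) in W1.
  lra.
Qed.

(** The discrete product rule gives six terms, each with one factor differenced in time and hence of
    size dt. Their squared bounds carry dt^2, which divided by the weight dt/6 leaves the required
    factor dt. *)
Lemma weak_diff_estimate n xi : (S n < S N)%nat -> fe_space k P xi ->
  Rabs (pI (fun s => dot (vsub (defect_weak (S n) s) (defect_weak n s)) (xi s))) <= dt * (Sob xi + Khat * (J * J)).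
Proof.
  intros Hn Hx. assert (WK := Khat_bounds). assert (WJ := J_H). assert (hp := hpow (k + 1)).
  assert (P1 := pv_x1 n). assert (P2 := pv_dX n). assert (P3 := pv_rho1 n ltac:(lia)). assert (P4 := fe_pv _ _ _ Hx).
  assert (P1' := pv_x1 (S n)). assert (P2' := pv_dX (S n)). assert (P3' := pv_rho1 (S n) ltac:(lia)).
  assert (t0 : 0 < dt / 6) by lra.
  assert (G1 := weak_bound alpha k P _ _ _ _ _ _ xi (Kv * h ^ (k + 1) * dt) Kv Kv (dt / 6) t0 Hx
    (pc1v_sub _ _ _ _ (rho_pc1v (S n) ltac:(lia)) (rho_pc1v n ltac:(lia))) (x1_pc1v (S n)) (dX_pc1v (S n))
    (fun s => rho_diff n s ltac:(lia)) (fun s => V_bound 0 1 (tn (S n)) s ltac:(lia)) (fun s => V_bound 0 2 (tn (S n)) s ltac:(lia))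
    (fun s => V_quot 0 (S n) s ltac:(lia) Hn) (fun s => V_quot 1 (S n) s ltac:(lia) Hn)).
  assert (G2 := weak_bound alpha k P _ _ _ _ _ _ xi (Kv * h ^ (k + 1)) (Kv * dt) Kv (dt / 6) t0 Hx
    (rho_pc1v n ltac:(lia)) (pc1v_sub _ _ _ _ (x1_pc1v (S n)) (x1_pc1v n)) (dX_pc1v (S n))
    (fun s => rho_bound n s ltac:(lia)) (fun s => V_diff 1 n s ltac:(lia) ltac:(lia)) (fun s => V_diff 2 n s ltac:(lia) ltac:(lia))
    (fun s => V_quot 0 (S n) s ltac:(lia) Hn) (fun s => V_quot 1 (S n) s ltac:(lia) Hn)).
  assert (G3 := weak_bound alpha k P _ _ _ _ _ _ xi (Kv * h ^ (k + 1)) Kv (Kv * dt) (dt / 6) t0 Hx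
    (rho_pc1v n ltac:(lia)) (x1_pc1v n) (pc1v_sub _ _ _ _ (dX_pc1v (S n)) (dX_pc1v n))
    (fun s => rho_bound n s ltac:(lia)) (fun s => V_bound 0 1 (tn n) s ltac:(lia)) (fun s => V_bound 0 2 (tn n) s ltac:(lia))
    (fun s => V_diff2 0 n s ltac:(lia) ltac:(lia) Hn) (fun s => V_diff2 1 n s ltac:(lia) ltac:(lia) Hn)).
  cbv zeta in G1, G2, G3.
  replace (Kv * h ^ (k + 1) * (Kv * dt) * Kv) with (Kv * h ^ (k + 1) * dt * Kv * Kv) in G2 by ring.
  replace (Kv * h ^ (k + 1) * Kv * (Kv * dt)) with (Kv * h ^ (k + 1) * dt * Kv * Kv) in G3 by ring.
  set (Bq := 14 / (dt / 6) * _) in G1, G2, G3.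
  assert (Bd : Bq <= dt * (84 * (B3 * B3) * (J * J))).
  { unfold Bq.
    replace (14 / (dt / 6) * (Ca alpha * (Kv * h ^ (k + 1) * dt * Kv * Kv) * (Ca alpha * (Kv * h ^ (k + 1) * dt * Kv * Kv)))) with
      (dt * (84 * (B3 * B3) * (h ^ (k + 1) * h ^ (k + 1)))) by (unfold B3; field; lra).
    apply Rmult_le_compat_l; [lra|]. apply Rmult_le_compat_l; [nra|]. apply Rmult_le_compat; lra. }
  destruct G1 as [W1 W2], G2 as [W3 W4], G3 as [W5 W6].
  assert (E : pI (fun s => dot (vsub (defect_weak (S n) s) (defect_weak n s)) (xi s)) =
    pI (fun s => dot (tri alpha (vsub (rho1 (S n) s) (rho1 n s)) (x1 (S n) s) (dX (S n) s)) (xi s)) +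
    pI (fun s => dot (tri alpha (x1 (S n) s) (vsub (rho1 (S n) s) (rho1 n s)) (dX (S n) s)) (xi s)) +
    pI (fun s => dot (tri alpha (rho1 n s) (vsub (x1 (S n) s) (x1 n s)) (dX (S n) s)) (xi s)) +
    pI (fun s => dot (tri alpha (vsub (x1 (S n) s) (x1 n s)) (rho1 n s) (dX (S n) s)) (xi s)) +
    pI (fun s => dot (tri alpha (rho1 n s) (x1 n s) (vsub (dX (S n) s) (dX n s))) (xi s)) +
    pI (fun s => dot (tri alpha (x1 n s) (rho1 n s) (vsub (dX (S n) s) (dX n s))) (xi s))).
  { rewrite <- !(I_plus P) by pc. apply RI_ext; [generalize twoPI; lra|]. intros s _. unfold defect_weak. vring. }
  rewrite E.
  apply Rabs_le_between in W1. apply Rabs_le_between in W2. apply Rabs_le_between in W3.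
  apply Rabs_le_between in W4. apply Rabs_le_between in W5. apply Rabs_le_between in W6.
  assert (dt * (504 * (B3 * B3) * (J * J)) <= dt * (Khat * (J * J))).
  { apply Rmult_le_compat_l; [lra|]. apply Rmult_le_compat_r; nra. }
  apply Rabs_le_between. lra.
Qed.

Lemma small_estimate n : (n < S N)%nat -> on_cells P (fun s => norm2 (defect_small n s) <= Khat * J).
Proof.
  intros Hn. assert (WK := Khat_bounds). assert (WJ := J_H).
  eapply on_cells_imp; [|apply bnd_small]. intros s [Hs _]. eapply Rle_trans; [apply Hs; lia|].
  apply Rmult_le_compat_r; lra.
Qed.
End Consistency.

(** * The error bound *)

Ltac split_continuous := repeat match goal with
  | |- continuous (fun u => _ + _) _ => apply cont_plus
  | |- continuous (fun u => _ - _) _ => apply cont_minus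
  | |- continuous (fun u => _ * _) _ => apply cont_mult
  | |- continuous (fun _ => ?c) _ => apply cont_const
  end.

Lemma norm2_pos p : p <> (0, 0) -> 0 < norm2 p.
Proof.
  intros H. apply sqrt_lt_R0. destruct p as [x y]. unfold dot; simpl.
  destruct (Req_dec x 0) as [->|]; [destruct (Req_dec y 0) as [->|]; [congruence|]|]; nra.
Qed.

(** With tau = p/|p|, the projection onto the normal is the identity minus the projection onto tau;
    the matrix of the flow is therefore |p|^2 I + (alpha - 1) p p^T, the G of the scheme. *)
Lemma flow_matrix alpha p v : p <> (0, 0) ->
  let nu := scal (/ norm2 p) (perp p) in
  mulmv (scal (norm2 p ^ 2) (plus (scal alpha id22) (scal (1 - alpha) (outer nu nu)))) v = tri alpha p p v.
Proof.
  intros Hp nu. assert (N0 := norm2_pos p Hp). assert (N2 := norm2_sq p).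
  unfold nu. clear nu. set (n := norm2 p) in *. clearbody n.
  destruct p as [x y], v as [v1 v2]. unfold dot in N2; simpl in N2.
  unfold mulmv, tri, dot, outer, perp, id22; simpl.
  do 4 (unfold plus, scal, mult; simpl).
  f_equal.
  - rewrite <- N2. transitivity (alpha * (n * n) * v1 + (1 - alpha) * (y * y) * v1 - (1 - alpha) * (x * y) * v2); [field; lra|].
    rewrite N2. ring.
  - rewrite <- N2. transitivity (alpha * (n * n) * v2 + (1 - alpha) * (x * x) * v2 - (1 - alpha) * (x * y) * v1); [field; lra|].
    rewrite N2. ring.
Qed.

Lemma strip_data_le r T f E K K' : K <= K' -> strip_data r T f E K -> strip_data r T f E K'.
Proof.
  intros H []. split; auto. intros. eapply Rle_trans; eauto.
Qed.

Lemma pair_neq0_dot p : p <> (0, 0) -> dot p p <> 0.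
Proof. intros H. assert (N := norm2_pos p H). rewrite <- norm2_sq. nra. Qed.

(** The flow equation extends from 0 < t < T1 to the closed interval by continuity. The uniform
    bound m0 comes from the boundedness of the continuous function 1/|d_s X|^2 on one period. *)
Lemma flow_regularity k alpha T1 X0 X : 0 < T1 -> (1 <= k)%nat ->
  flow_solution alpha T1 X0 X -> smooth (k + 3) T1 X ->
  exists E1 E2 K0 m0, strip_data (k + 3) T1 (fun t s => fst (X t s)) E1 K0 /\
    strip_data (k + 3) T1 (fun t s => snd (X t s)) E2 K0 /\
    (forall t s, 0 <= t <= T1 ->
       tri alpha (E1 0%nat 1%nat t s, E2 0%nat 1%nat t s) (E1 0%nat 1%nat t s, E2 0%nat 1%nat t s)
         (E1 1%nat 0%nat t s, E2 1%nat 0%nat t s) = (E1 0%nat 2%nat t s, E2 0%nat 2%nat t s)) /\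
    0 < m0 /\ (forall t s, 0 <= t <= T1 -> m0 <= norm2 (E1 0%nat 1%nat t s, E2 0%nat 1%nat t s)).
Proof.
  intros HT hk [_ [Hper [Hreg [_ Hflow]]]] [S1 S2].
  destruct (strip_data_exists _ _ _ HT S1) as [E1 [K1 D1]].
  { intros t Ht s. simpl. rewrite (Hper t Ht). auto. }
  destruct (strip_data_exists _ _ _ HT S2) as [E2 [K2 D2]].
  { intros t Ht s. simpl. rewrite (Hper t Ht). auto. }
  assert (XS : forall t s, 0 <= t <= T1 -> dS (X t) s = (E1 0%nat 1%nat t s, E2 0%nat 1%nat t s)).
  { intros t s Ht. unfold dS. f_equal.
    - rewrite (Derive_ext _ (E1 0%nat 0%nat t)) by (intros; symmetry; apply (sd_0 _ _ _ _ _ D1); auto).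
      apply is_derive_unique, (sd_ds _ _ _ _ _ D1). lia.
    - rewrite (Derive_ext _ (E2 0%nat 0%nat t)) by (intros; symmetry; apply (sd_0 _ _ _ _ _ D2); auto).
      apply is_derive_unique, (sd_ds _ _ _ _ _ D2). lia. }
  assert (XSS : forall t s, 0 <= t <= T1 -> dS (dS (X t)) s = (E1 0%nat 2%nat t s, E2 0%nat 2%nat t s)).
  { intros t s Ht. unfold dS at 1. f_equal.
    - rewrite (Derive_ext _ (E1 0%nat 1%nat t)) by (intros; rewrite XS; auto).
      apply is_derive_unique, (sd_ds _ _ _ _ _ D1). lia.
    - rewrite (Derive_ext _ (E2 0%nat 1%nat t)) by (intros; rewrite XS; auto).
      apply is_derive_unique, (sd_ds _ _ _ _ _ D2). lia. }
  assert (XT : forall t s, 0 < t < T1 -> dT X t s = (E1 1%nat 0%nat t s, E2 1%nat 0%nat t s)).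
  { intros t s Ht. unfold dT. f_equal; apply is_derive_unique.
    - apply (is_derive_cell _ (fun u => E1 0%nat 0%nat u s) 0 T1); auto.
      + intros u Hu. symmetry. apply (sd_0 _ _ _ _ _ D1); auto.
      + apply (sd_dt _ _ _ _ _ D1); [lia|auto].
    - apply (is_derive_cell _ (fun u => E2 0%nat 0%nat u s) 0 T1); auto.
      + intros u Hu. symmetry. apply (sd_0 _ _ _ _ _ D2); auto.
      + apply (sd_dt _ _ _ _ _ D2); [lia|auto]. }
  assert (C1 : forall i j t s, (i + j <= k + 3)%nat -> continuous (fun u => E1 i j u s) t).
  { intros. apply (sd_cont_t _ _ _ _ _ D1); auto. }
  assert (C2 : forall i j t s, (i + j <= k + 3)%nat -> continuous (fun u => E2 i j u s) t).
  { intros. apply (sd_cont_t _ _ _ _ _ D2); auto. }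
  assert (Pde : forall t s, 0 <= t <= T1 ->
       tri alpha (E1 0%nat 1%nat t s, E2 0%nat 1%nat t s) (E1 0%nat 1%nat t s, E2 0%nat 1%nat t s)
         (E1 1%nat 0%nat t s, E2 1%nat 0%nat t s) = (E1 0%nat 2%nat t s, E2 0%nat 2%nat t s)).
  { assert (In : forall t s, 0 < t < T1 ->
       tri alpha (E1 0%nat 1%nat t s, E2 0%nat 1%nat t s) (E1 0%nat 1%nat t s, E2 0%nat 1%nat t s)
         (E1 1%nat 0%nat t s, E2 1%nat 0%nat t s) = (E1 0%nat 2%nat t s, E2 0%nat 2%nat t s)).
    { intros t s Ht. assert (Fl := Hflow t s Ht). cbv zeta in Fl. unfold unit_normal in Fl.
      rewrite (flow_matrix alpha (dS (X t) s)) in Fl by (apply Hreg; lra).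
      rewrite XT, XSS, XS in Fl by lra. exact Fl. }
    intros t s Ht. rewrite (surjective_pairing (tri _ _ _ _)). f_equal.
    - apply Rminus_diag_uniq.
      apply (zero_on_closure (fun t => fst (tri alpha (E1 0%nat 1%nat t s, E2 0%nat 1%nat t s) (E1 0%nat 1%nat t s, E2 0%nat 1%nat t s)
         (E1 1%nat 0%nat t s, E2 1%nat 0%nat t s)) - E1 0%nat 2%nat t s) T1); auto.
      + intros u. unfold tri, dot. cbn [fst snd].
        split_continuous; first [apply C1; lia | apply C2; lia].
      + intros u Hu. rewrite In by auto. simpl. ring.
    - apply Rminus_diag_uniq.
      apply (zero_on_closure (fun t => snd (tri alpha (E1 0%nat 1%nat t s, E2 0%nat 1%nat t s) (E1 0%nat 1%nat t s, E2 0%nat 1%nat t s)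
         (E1 1%nat 0%nat t s, E2 1%nat 0%nat t s)) - E2 0%nat 2%nat t s) T1); auto.
      + intros u. unfold tri, dot. cbn [fst snd].
        split_continuous; first [apply C1; lia | apply C2; lia].
      + intros u Hu. rewrite In by auto. simpl. ring. }
  set (N := fun t s => E1 0%nat 1%nat t s * E1 0%nat 1%nat t s + E2 0%nat 1%nat t s * E2 0%nat 1%nat t s).
  (* Clamping in time makes this hold on the whole plane, as continuity of the inverse requires. *)
  assert (Nn : forall t s, N t s <> 0).
  { intros t s. unfold N. rewrite (sd_clamp _ _ _ _ _ D1), (sd_clamp _ _ _ _ _ D2).
    assert (Ic := clamp_in T1 t ltac:(lra)).
    apply (pair_neq0_dot (E1 0%nat 1%nat (clamp T1 t) s, E2 0%nat 1%nat (clamp T1 t) s)).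
    rewrite <- XS by auto. apply Hreg; auto. }
  assert (NC : forall t s, continuity_2d_pt (fun t s => / N t s) t s).
  { intros t s. apply continuity_2d_pt_inv; auto. unfold N.
    assert (A1 := sd_cont _ _ _ _ _ D1 0%nat 1%nat ltac:(lia) t s). assert (A2 := sd_cont _ _ _ _ _ D2 0%nat 1%nat ltac:(lia) t s).
    apply continuity_2d_pt_plus; apply continuity_2d_pt_mult; auto. }
  assert (TP := twoPI).
  destruct (bounded_on_box _ T1 (2 * PI) ltac:(lra) ltac:(lra) NC) as [Kn HKn].
  (* With q = max(1, Kn), |d_s X|^2 >= 1/q >= 1/q^2, which avoids a square root. *)
  exists E1, E2, (Rmax K1 K2), (/ Rmax 1 Kn).
  assert (R1 : 1 <= Rmax 1 Kn) by apply Rmax_l. assert (R2 : Kn <= Rmax 1 Kn) by apply Rmax_r.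
  set (q := Rmax 1 Kn) in *.
  split; [apply (strip_data_le _ _ _ _ K1); auto; apply Rmax_l|].
  split; [apply (strip_data_le _ _ _ _ K2); auto; apply Rmax_r|].
  split; [exact Pde|]. split; [apply Rinv_0_lt_compat; lra|].
  intros t s Ht. destruct (period_repr 0 s) as [m Hm].
  rewrite <- (periodic_Z (E1 0%nat 1%nat t) (sd_per _ _ _ _ _ D1 0%nat 1%nat ltac:(lia) t) m s).
  rewrite <- (periodic_Z (E2 0%nat 1%nat t) (sd_per _ _ _ _ _ D2 0%nat 1%nat ltac:(lia) t) m s).
  set (s' := s - _) in *.
  specialize (HKn t s' Ht ltac:(lra)). apply Rabs_le_between in HKn.
  assert (Nt := Nn t s').
  assert (Np : 0 < N t s').
  { unfold N in *. assert (0 <= E1 0%nat 1%nat t s' * E1 0%nat 1%nat t s') by apply Rle_0_sqr.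
    assert (0 <= E2 0%nat 1%nat t s' * E2 0%nat 1%nat t s') by apply Rle_0_sqr. lra. }
  assert (I1 : / q <= 1) by (rewrite <- Rinv_1; apply Rinv_le_contravar; lra).
  assert (I0 : 0 < / q) by (apply Rinv_0_lt_compat; lra).
  apply sq_le_le; [apply norm2_ge0|]. rewrite norm2_sq.
  change (/ q * / q <= N t s').
  assert (/ q <= N t s').
  { rewrite <- (Rinv_inv (N t s')). apply Rinv_le_contravar; [apply Rinv_0_lt_compat; auto|lra]. }
  nra.
Qed.

(** * The discrete solution and L2 bounds *)

Definition is_step (alpha : R) (k : nat) (P : partition) (dt : R) (b u : R -> R2) : Prop :=
  fe_space k P u /\ forall xi, fe_space k P xi ->
    inner (fun s => mulmv (Gmat alpha b s) (scal (/ dt) (diff u b s))) xi + inner (dS u) (dS xi) = 0.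

(** A total sequence, chosen before solvability is known; its values are meaningful once the
    bootstrap has shown that each step exists. *)
Fixpoint euler_iter (alpha : R) (k : nat) (P : partition) (dt : R) (X0 : R -> R2) (n : nat) : R -> R2 :=
  match n with
  | O => RhI k P X0
  | S n => epsilon (inhabits (fun _ => (0, 0))) (is_step alpha k P dt (euler_iter alpha k P dt X0 n))
  end.

Lemma is_step_scheme alpha k P dt U n : is_step alpha k P dt (U n) (U (S n)) <-> scheme_at alpha k P dt U n.
Proof.
  assert (E : forall xi, inner (fun s => mulmv (Gmat alpha (U n) s) (scal (/ dt) (diff (U (S n)) (U n) s))) xi =
    pI (fun s => dot (tri alpha (dS (U n) s) (dS (U n) s) (dq dt U n s)) (xi s))).
  { intros xi. rewrite inner_pI. apply RI_ext; [generalize twoPI; lra|]. intros s _. rewrite mulmv_Gmat. reflexivity. }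
  split; intros [H1 H2]; split; auto; intros xi Hx; specialize (H2 xi Hx).
  - rewrite E in H2. exact H2.
  - rewrite E. exact H2.
Qed.

(** |f|^2 <= 2 |a|^2 + 2 y^2, integrated over the period, with 4 pi <= 16. Here a will be the
    discrete error and b the projection error. *)
Lemma L2_bound P (f a b : R -> R2) (x y z : R) : pv P f -> pv P a -> 0 <= y -> 0 <= z ->
  on_cells P (fun s => norm2 (f s) <= norm2 (a s) + norm2 (b s)) ->
  on_cells P (fun s => norm2 (b s) <= y) ->
  pI (fun s => dot (a s) (a s)) <= x * (z * z) -> 0 <= x ->
  y <= z ->
  forall c, 2 * x + 16 <= c * c -> 0 <= c -> L2norm f <= c * z.
Proof.
  intros Pf Pa Hy Hz H1 H2 H3 Hx Hyz c Hc Hc0.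
  unfold L2norm. rewrite <- (sqrt_square (c * z)) by (apply Rmult_le_pos; auto).
  apply sqrt_le_1_alt. change (inner f f) with (pI (fun s => dot (f s) (f s))).
  apply Rle_trans with (pI (fun s => 2 * dot (a s) (a s) + 2 * (y * y))).
  - apply (I_le P); [pc|pc|]. eapply on_cells_imp2; [|apply H1|apply H2]. intros s A B. cbv beta in *.
    rewrite <- !norm2_sq. assert (N1 := norm2_ge0 (f s)).
    assert (0 <= (norm2 (a s) - y) * (norm2 (a s) - y)) by apply Rle_0_sqr.
    assert (norm2 (f s) * norm2 (f s) <= (norm2 (a s) + y) * (norm2 (a s) + y)) by (apply Rmult_le_compat; lra).
    lra.
  - rewrite (I_plus P), (I_scal P), I_const by pc. assert (PB := PI_4).
    assert (2 * (y * y) * (2 * PI) <= 16 * (z * z)) by nra.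
    assert ((2 * x + 16 * 1) * (z * z) <= c * c * (z * z)) by (apply Rmult_le_compat_r; nra).
    lra.
Qed.

Lemma L2norm_le (f : R -> R2) x z : 0 <= x -> 0 <= z -> pI (fun s => dot (f s) (f s)) <= x * (z * z) ->
  L2norm f <= (x + 1) * z.
Proof.
  intros Hx Hz H. unfold L2norm. rewrite <- (sqrt_square ((x + 1) * z)) by (apply Rmult_le_pos; lra).
  apply sqrt_le_1_alt. change (inner f f) with (pI (fun s => dot (f s) (f s))).
  eapply Rle_trans; [apply H|].
  replace ((x + 1) * z * ((x + 1) * z)) with ((x + 1) * (x + 1) * (z * z)) by ring.
  apply Rmult_le_compat_r; nra.
Qed.

Lemma dS_periodic (f : R -> R2) : periodic f -> periodic (dS f).
Proof.
  intros H s. unfold dS. f_equal; apply Derive_periodic; intros x; rewrite H; auto.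
Qed.

Lemma euler_iter_step alpha k P dt X0 n :
  (exists u, is_step alpha k P dt (euler_iter alpha k P dt X0 n) u) ->
  is_step alpha k P dt (euler_iter alpha k P dt X0 n) (euler_iter alpha k P dt X0 (S n)).
Proof. intros H. exact (epsilon_spec (inhabits (fun _ => (0, 0))) _ H). Qed.

Theorem theorem3p1 (k : nat) (hk : (1 <= k)%nat) :
  exists r : nat,
  forall (alpha T T1 : R) (X0 : R -> R2) (X : R -> R -> R2),
    0 < alpha -> 0 < T -> T < T1 ->
    flow_solution alpha T1 X0 X ->
    (forall Y, flow_solution alpha T1 X0 Y ->
       forall t s, 0 <= t <= T1 -> Y t s = X t s) ->
    smooth r T1 X ->
    exists h0 dt0 c : R,
      0 < h0 <= 1 /\ 0 < dt0 /\ 0 < c /\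
      forall (P : partition) (M : nat),
        (1 <= M)%nat ->
        let h := mesh_size P in
        let dt := T / INR M in
        h <= h0 -> dt <= sqrt h -> dt <= dt0 ->
        exists Xh : nat -> R -> R2,
          euler_scheme alpha k P dt M (X 0) Xh /\
          (forall Yh, euler_scheme alpha k P dt M (X 0) Yh ->
             forall m s, (m <= M)%nat -> Yh m s = Xh m s) /\
          (forall m, (m <= M)%nat ->
             let e := diff (RhI k P (X (INR m * dt))) (Xh m) in
             L2norm e + L2norm (dS e) <= c * (dt + h ^ (k + 1))) /\
          (forall m p, (m <= M)%nat -> (p <= 1)%nat ->
             L2norm (Nat.iter p dS (diff (Xh m) (X (INR m * dt))))
             <= c * (dt + h ^ (k + 1 - p))).
Proof.
  (* Demanded by [proj_est2]: two derivatives in t and k + 1 in s. *)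
  exists (k + 3)%nat. intros alpha T T1 X0 X ha HT HT1 Hfl _ Hsm.
  destruct (flow_regularity k alpha T1 X0 X ltac:(lra) hk Hfl Hsm) as (E1 & E2 & K0 & m0 & D1 & D2 & Pde & m00 & Hm).
  assert (Hper := proj1 (proj2 Hfl)).
  destruct (is_loc_estimate k hk) as [C [C0 HC]].
  destruct (fe_derive_sup k hk) as [Cs [Cs0 HCs]].
  assert (KvB := Kv_bounds k T1 X E1 K0 C hk D1 C0).
  assert (KhB := Khat_bounds alpha k T1 X E1 K0 C hk D1 C0).
  set (K := Khat alpha K0 C) in *. set (kv := Kv K0 C) in *.
  destruct (rough_pointwise alpha K ha ltac:(lra)) as [cr [cr1 Hcr]].
  set (m := m0 / 2). assert (mpos : 0 < m) by (unfold m; lra).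
  assert (lam0 := lam_pos alpha m ha mpos).
  assert (c50 : 0 <= c5 alpha m cr).
  { unfold c5. assert (0 < 2 / coer alpha m) by (apply Rdiv_lt_0_compat; lra). apply Rmult_le_pos; lra. }
  assert (c70 : 0 <= c7 alpha K m cr T).
  { unfold c7, c6. assert (0 < 2 / coer alpha m) by (apply Rdiv_lt_0_compat; lra).
    assert (0 <= 8 * (K * K) / coer alpha m) by (apply Rdiv_le_0_compat; nra).
    apply Rmult_le_pos; [lra|]. apply Rmult_le_pos; [lra|left; apply exp_pos]. }
  set (q7 := c7 alpha K m cr T) in *.
  assert (Ca1 := Ca_ge1 alpha).
  set (Q := 2 * Cs * (4 * Ca alpha * (K * K) * (q7 + 16))).
  assert (Q0 : 0 <= Q).
  { unfold Q. apply Rmult_le_pos; [lra|]. apply Rmult_le_pos; [|lra]. apply Rmult_le_pos; nra. }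
  set (ep := Rmin (m / 2) 1). assert (ep0 : 0 < ep) by (apply Rmin_glb_lt; lra).
  (* Thresholds for H = h^k + dt: below [b1], and below 1, the quartic threshold holds; below [b2]
     the sup bound of [sup_step] implies [good]. *)
  set (b1 := / (16 * cr * (q7 + 1))). set (b2 := ep / (Q + 1)).
  assert (b10 : 0 < b1) by (apply Rinv_0_lt_compat; apply Rmult_lt_0_compat; lra).
  assert (b20 : 0 < b2) by (apply Rdiv_lt_0_compat; lra).
  set (Hx := Rmin 1 (Rmin b1 b2)).
  assert (Hx0 : 0 < Hx) by (apply Rmin_glb_lt; [lra|apply Rmin_glb_lt; auto]).
  assert (Hx1 : Hx <= 1) by apply Rmin_l.
  assert (Hx2 : Hx <= b1) by (eapply Rle_trans; [apply Rmin_r|apply Rmin_l]).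
  assert (Hx3 : Hx <= b2) by (eapply Rle_trans; [apply Rmin_r|apply Rmin_r]).
  (* Below [d1] the Gronwall step of [implicit_growth] is admissible. *)
  set (d1 := / (2 * (c5 alpha m cr + 1))). assert (d10 : 0 < d1) by (apply Rinv_0_lt_compat; lra).
  set (Cf := fine_const alpha K m T).
  assert (Cf0 : 0 <= Cf).
  { unfold Cf, fine_const.
    assert (0 <= 18 * (Ca alpha * Ca alpha * (K * K * (K * K))) / coer alpha m).
    { assert (0 <= Ca alpha * Ca alpha) by nra.
      apply Rdiv_le_0_compat; [|lra]. apply Rmult_le_pos; [lra|]. apply Rmult_le_pos; [lra|nra]. }
    assert (0 <= 16 * (K * K) / coer alpha m) by (apply Rdiv_le_0_compat; [nra|lra]).
    assert (0 <= 4 / coer alpha m) by (apply Rdiv_le_0_compat; lra).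
    apply Rmult_le_pos; [lra|]. apply Rmult_le_pos; [lra|left; apply exp_pos]. }
  (* m0/(2 kv) keeps the projected curves regular; the halves of Hx here and in [dt0] give h^k + dt
     <= Hx. *)
  set (h0 := Rmin 1 (Rmin (m0 / (2 * kv)) (Hx / 2))).
  set (dt0 := Rmin (Hx / 2) (Rmin (/ 8) (Rmin d1 (coer alpha m / 4)))).
  (* The second summand bounds the two norms of the discrete error. The first one bounds the total
     error through [L2_bound], where 2 Cf + 17 satisfies 2 Cf + 16 <= (2 Cf + 17)^2. *)
  exists h0, dt0, (kv * (2 * Cf + 17) + 2 * (Cf + 1)).
  assert (a1 : 0 < m0 / (2 * kv)) by (apply Rdiv_lt_0_compat; lra).
  split; [split; [apply Rmin_glb_lt; [lra|apply Rmin_glb_lt; [auto|lra]]|apply Rmin_l]|].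
  split; [apply Rmin_glb_lt; [lra|apply Rmin_glb_lt; [lra|apply Rmin_glb_lt; [auto|lra]]]|].
  assert (kc : 0 <= kv * (2 * Cf + 17)) by (apply Rmult_le_pos; lra).
  split; [lra|].
  intros P M HM h dt Hh _ Hdt0.
  assert (h1 : h <= 1) by (eapply Rle_trans; [apply Hh|apply Rmin_l]).
  assert (h2 : h <= m0 / (2 * kv)) by (eapply Rle_trans; [apply Hh|eapply Rle_trans; [apply Rmin_r|apply Rmin_l]]).
  assert (h3 : h <= Hx / 2) by (eapply Rle_trans; [apply Hh|eapply Rle_trans; [apply Rmin_r|apply Rmin_r]]).
  assert (t1 : dt <= Hx / 2) by (eapply Rle_trans; [apply Hdt0|apply Rmin_l]).
  assert (t2 : dt <= / 8) by (eapply Rle_trans; [apply Hdt0|eapply Rle_trans; [apply Rmin_r|apply Rmin_l]]).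
  assert (t3 : dt <= d1).
  { eapply Rle_trans; [apply Hdt0|]. eapply Rle_trans; [apply Rmin_r|]. eapply Rle_trans; [apply Rmin_r|apply Rmin_l]. }
  assert (t4 : dt <= coer alpha m / 4).
  { eapply Rle_trans; [apply Hdt0|]. eapply Rle_trans; [apply Rmin_r|]. eapply Rle_trans; [apply Rmin_r|apply Rmin_r]. }
  assert (hpos : 0 < h) by apply mesh_size_pos.
  destruct M as [|N]; [lia|]. clear HM.
  assert (IN : 0 < INR (S N)) by (apply lt_0_INR; lia).
  assert (dtpos : 0 < dt) by (apply Rdiv_lt_0_compat; auto).
  assert (MT : INR (S N) * dt = T) by (unfold dt; field; lra).
  assert (HN : INR (S N) * dt <= T1) by lra.
  assert (hp := pow_le_1 h k hpos h1 hk).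
  assert (pk : 0 <= h ^ k) by (apply pow_le; lra). assert (pk1 : 0 < h ^ (k + 1)) by (apply pow_lt; lra).
  assert (kvh : kv * h <= m0 / 2).
  { apply (Rmult_le_reg_r (/ kv)); [apply Rinv_0_lt_compat; lra|].
    replace (kv * h * / kv) with h by (field; lra). replace (m0 / 2 * / kv) with (m0 / (2 * kv)) by (field; lra). auto. }
  set (Rn := fun n : nat => RhI k P (X (INR n * dt))).
  set (U := euler_iter alpha k P dt (X 0)).
  assert (Data : approx_data alpha k P (S N) dt K m (h ^ k + dt) Rn (defect alpha k P X E1 E2 dt)).
  { apply (consistency alpha k P T1 X E1 E2 K0 C m0 dt N); auto. }
  assert (X00 : X (INR 0 * dt) = X 0) by (simpl; f_equal; ring).
  assert (U0 : forall s, U O s = Rn O s).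
  { intros s. unfold U, Rn. rewrite X00. reflexivity. }
  set (H := h ^ k + dt) in *.
  assert (H0 : 0 < H) by (unfold H; lra). assert (HHx : H <= Hx) by (unfold H; lra).
  (* Regularity of the discrete curve in the form that both solvability and uniqueness of a step
     require. *)
  assert (StepReg : forall n, (n <= S N)%nat -> fe_space k P (U n) ->
     on_cells P (fun s => norm2 (vsub (dS (Rn n) s) (dS (U n) s)) <= Rmin (m / 2) 1) ->
     on_cells P (fun s => m / 2 * (m / 2) <= dot (dS (U n) s) (dS (U n) s))).
  { intros n Hn HU G. eapply on_cells_imp; [|apply (good_bounds _ _ _ _ _ _ _ _ _ _ U Data n Hn G)].
    intros s [_ [B _]]. rewrite <- norm2_sq. apply Rmult_le_compat; lra. }
  assert (m2 : 0 < m / 2 * (m / 2)) by (apply Rmult_lt_0_compat; lra).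
  assert (Bt := bootstrap alpha K m dt H k (S N) P Rn _ U ha ltac:(lra) mpos dtpos H0 hk Data cr Cs T cr1 Hcr Cs0
    (fun u f => HCs P u f) t2).
  fold q7 in Bt. destruct Bt as [F0 [G0 Bt]]; auto.
  { assert (dt * c5 alpha m cr <= d1 * (c5 alpha m cr + 1)) by (apply Rmult_le_compat; lra).
    replace (d1 * (c5 alpha m cr + 1)) with (/ 2) in H1 by (unfold d1; field; lra). auto. }
  { lra. }
  { assert (q7 * (H * H) <= (q7 + 1) * b1).
    { apply Rmult_le_compat; try nra. }
    replace ((q7 + 1) * b1) with (/ (16 * cr)) in H1 by (unfold b1; field; lra). auto. }
  { fold Q. fold ep. assert (Q * H <= (Q + 1) * b2) by (apply Rmult_le_compat; lra).
    replace ((Q + 1) * b2) with ep in H1 by (unfold b2; field; lra). auto. }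
  { intros n Hn HU G. apply (proj1 (is_step_scheme alpha k P dt U n)). apply euler_iter_step.
    destruct (step_exists alpha dt k P (U n) (m / 2 * (m / 2)) ha dtpos m2 HU (StepReg n ltac:(lia) HU G)) as [u Hu].
    exists u. exact Hu. }
  assert (HU : forall n, (n <= S N)%nat -> fe_space k P (U n)).
  { intros [|n] Hn; [exact F0|apply (Bt n Hn)]. }
  assert (HG : forall n, (n <= S N)%nat -> on_cells P (fun s => norm2 (vsub (dS (Rn n) s) (dS (U n) s)) <= Rmin (m / 2) 1)).
  { intros [|n] Hn; [exact G0|apply (Bt n Hn)]. }
  assert (HS : forall n, (n < S N)%nat -> scheme_at alpha k P dt U n) by (intros n Hn; apply (Bt n Hn)).
  set (J := h ^ (k + 1) + dt). assert (J0 : 0 < J) by (unfold J; lra).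
  assert (Fe : forall n, (n <= S N)%nat ->
    pI (fun s => dot (vsub (Rn n s) (U n s)) (vsub (Rn n s) (U n s))) +
    pI (fun s => dot (vsub (dS (Rn n) s) (dS (U n) s)) (vsub (dS (Rn n) s) (dS (U n) s))) <= Cf * (J * J)).
  (* H = h^k + dt has served the bootstrap; the final rate is that of J = h^(k+1) + dt. *)
  { apply (fine_estimate alpha K m dt H k (S N) P Rn _ U ha ltac:(lra) mpos dtpos hk Data J
      (defect_weak alpha k P X E1 E2 dt) (defect_small alpha k P X E1 E2 dt)); auto.
    - intros n Hn. apply (pv_weak alpha k P T1 X E1 E2 K0 dt N); auto.
    - intros n Hn. apply (small_estimate alpha k P T1 X E1 E2 K0 C dt N); auto.
    - intros n Hn xi Hxi. apply (weak_estimate alpha k P T1 X E1 E2 K0 C dt N); auto.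
    - intros n Hn xi Hxi. apply (weak_diff_estimate alpha k P T1 X E1 E2 K0 C dt N); auto.
    - lra.
    - lra. }
  assert (PvR : forall n, (n <= S N)%nat -> fe_space k P (Rn n)).
  { intros n Hn. apply (Rn_fe k P T1 X E1 E2 K0 dt N); auto. }
  assert (NL : forall n, (n <= S N)%nat -> 0 <= pI (fun s => dot (vsub (Rn n s) (U n s)) (vsub (Rn n s) (U n s)))).
  { intros n Hn. assert (P1 := fe_pv _ _ _ (PvR n Hn)). assert (P2 := fe_pv _ _ _ (HU n Hn)).
    apply (I_nonneg P (fun s => vsub (Rn n s) (U n s))). pc. }
  assert (NE : forall n, (n <= S N)%nat -> 0 <= pI (fun s => dot (vsub (dS (Rn n) s) (dS (U n) s)) (vsub (dS (Rn n) s) (dS (U n) s)))).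
  { intros n Hn. assert (P1 := fe_pv_dS _ _ _ (PvR n Hn)). assert (P2 := fe_pv_dS _ _ _ (HU n Hn)).
    apply (I_nonneg P (fun s => vsub (dS (Rn n) s) (dS (U n) s))). pc. }
  exists U. split; [|split; [|split]].
  - split; [reflexivity|]. intros n Hn. apply is_step_scheme. apply HS; auto.
  (* Any other solution agrees with U step by step: once it equals U at level n it shares the
     regular curve in G, so [step_unique] applies with no a priori bound on Yh. *)
  - intros Yh [Y0 Ys] n. induction n as [|n IH]; intros s Hn.
    + rewrite Y0. reflexivity.
    + assert (En : Yh n = U n) by (extensionality x; apply IH; lia).
      destruct (Ys n Hn) as [Yf Ye]. rewrite En in Ye.
      destruct (proj2 (is_step_scheme alpha k P dt U n) (HS n Hn)) as [Uf Ue].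
      apply (step_unique alpha dt k P (U n) (m / 2 * (m / 2)) ha dtpos m2 (HU n ltac:(lia))
        (StepReg n ltac:(lia) (HU n ltac:(lia)) (HG n ltac:(lia)))); auto.
  - intros n Hn e. assert (Fn := Fe n Hn). assert (L0 := NL n Hn). assert (L1 := NE n Hn).
    assert (A1 : L2norm e <= (Cf + 1) * J).
    { apply L2norm_le; [lra|lra|]. change (pI (fun s => dot (e s) (e s))) with
        (pI (fun s => dot (vsub (Rn n s) (U n s)) (vsub (Rn n s) (U n s)))). lra. }
    assert (A2 : L2norm (dS e) <= (Cf + 1) * J).
    { apply L2norm_le; [lra|lra|].
      assert (Se := S_er _ _ _ _ _ _ _ _ _ _ U Data n Hn (HU n Hn)).
      change (pI (fun s => dot (dS e s) (dS e s)) =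
        pI (fun s => dot (vsub (dS (Rn n) s) (dS (U n) s)) (vsub (dS (Rn n) s) (dS (U n) s)))) in Se. lra. }
    replace (dt + h ^ (k + 1)) with J by (unfold J; ring).
    assert (0 <= kv * (2 * Cf + 17) * J) by (apply Rmult_le_pos; lra). lra.
  - intros n p Hn Hp. assert (Fn := Fe n Hn). assert (L0 := NL n Hn). assert (L1 := NE n Hn).
    assert (It : 0 <= INR n * dt <= T1).
    { split; [apply Rmult_le_pos; [apply pos_INR|lra]|]. eapply Rle_trans; [|apply HN].
      apply Rmult_le_compat_r; [lra|]. apply le_INR; auto. }
    assert (XV : forall s, X (INR n * dt) s = (E1 0%nat 0%nat (INR n * dt) s, E2 0%nat 0%nat (INR n * dt) s)).
    { intros s. apply (X_V k T1 X E1 E2 K0); auto. }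
    assert (Pc := V_pc1v k P T1 X E1 E2 K0 hk D1 D2 0 0 (INR n * dt) ltac:(lia)). cbv beta in Pc.
    destruct (pc1v_pv _ _ _ Pc) as [PV0 PV1].
    assert (PU := fe_pv _ _ _ (HU n Hn)). assert (PU1 := fe_pv_dS _ _ _ (HU n Hn)).
    assert (PR := fe_pv _ _ _ (PvR n Hn)). assert (PR1 := fe_pv_dS _ _ _ (PvR n Hn)).
    assert (cc : 2 * Cf + 16 <= (2 * Cf + 17) * (2 * Cf + 17)) by nra.
    assert (jj : J * J <= kv * J * (kv * J)).
    { apply Rmult_le_compat; try lra; rewrite <- (Rmult_1_l J) at 1; apply Rmult_le_compat_r; lra. }
    destruct p as [|[|p]]; [| |lia].
    + replace (k + 1 - 0)%nat with (k + 1)%nat by lia. simpl Nat.iter.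
      replace (dt + h ^ (k + 1)) with J by (unfold J; ring).
      assert (B : L2norm (diff (U n) (X (INR n * dt))) <= (2 * Cf + 17) * (kv * J)).
      { apply (L2_bound P _ (fun s => vsub (Rn n s) (U n s))
          (fun s => vsub (Rn n s) (E1 0%nat 0%nat (INR n * dt) s, E2 0%nat 0%nat (INR n * dt) s)) Cf (kv * h ^ (k + 1))); auto; try lra.
        - replace (diff (U n) (X (INR n * dt))) with (fun s => vsub (U n s) (E1 0%nat 0%nat (INR n * dt) s, E2 0%nat 0%nat (INR n * dt) s)).
          + apply pv_sub; auto.
          + extensionality s. unfold diff. rewrite XV. reflexivity.
        - pc.
        - apply Rmult_le_pos; lra.
        - apply Rmult_le_pos; lra.
        - apply on_cells_all. intros s.
          change (diff (U n) (X (INR n * dt)) s) with (vsub (U n s) (X (INR n * dt) s)). rewrite XV.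
          eapply Rle_trans; [|rewrite Rplus_comm; apply norm2_sub]. apply Req_le. f_equal. vring.
        - apply on_cells_all. intros s. apply (rho_bound k P T1 X E1 E2 K0 C dt N); auto.
        - assert (Cf * (J * J) <= Cf * (kv * J * (kv * J))) by (apply Rmult_le_compat_l; lra). lra.
        - apply Rmult_le_compat_l; [lra|]. unfold J; lra. }
      assert (0 <= (Cf + 1) * J) by (apply Rmult_le_pos; lra). lra.
    + replace (k + 1 - 1)%nat with k by lia. simpl Nat.iter.
      replace (dt + h ^ k) with H by (unfold H; ring).
      assert (JH : J <= H) by (unfold J, H; lra).
      assert (De : on_cells P (fun s => dS (diff (U n) (X (INR n * dt))) s =
         vsub (dS (U n) s) (E1 0%nat 1%nat (INR n * dt) s, E2 0%nat 1%nat (INR n * dt) s))).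
      { destruct (pc1v_sub P _ _ _ _ (fe_pc1v _ _ _ (HU n Hn)) Pc) as [Q1 Q2].
        eapply on_cells_imp2; [|apply (pc1_deriv _ _ _ Q1)|apply (pc1_deriv _ _ _ Q2)].
        intros s S1 S2. cbv beta in *.
        replace (diff (U n) (X (INR n * dt))) with (fun s => vsub (U n s) (E1 0%nat 0%nat (INR n * dt) s, E2 0%nat 0%nat (INR n * dt) s))
          by (extensionality x; unfold diff; rewrite XV; reflexivity).
        unfold dS at 1. rewrite (surjective_pairing (vsub (dS (U n) s) _)). f_equal; apply is_derive_unique; auto. }
      assert (Pd : periodic (dS (diff (U n) (X (INR n * dt))))).
      { apply dS_periodic. intros s. unfold diff. rewrite (Hper _ It).
        destruct (HU n Hn) as [[q1 _] [q2 _]]. f_equal.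
        rewrite (surjective_pairing (U n (s + 2 * PI))), q1, q2. symmetry; apply surjective_pairing. }
      assert (B : L2norm (dS (diff (U n) (X (INR n * dt)))) <= (2 * Cf + 17) * (kv * H)).
      { apply (L2_bound P _ (fun s => vsub (dS (Rn n) s) (dS (U n) s))
          (fun s => vsub (dS (Rn n) s) (E1 0%nat 1%nat (INR n * dt) s, E2 0%nat 1%nat (INR n * dt) s)) Cf (kv * h ^ k)); auto; try lra.
        - assert (Pv := pv_sub P _ _ PU1 PV1).
          assert (PE : forall c : R2 -> R, periodic (fun s => c (dS (diff (U n) (X (INR n * dt))) s))).
          { intros c s. apply (f_equal c (Pd s)). }
          split; (eapply pcont_ext; [|eapply on_cells_imp; [|apply De]|]);
            [apply (PE fst)|intros s Es; cbv beta in *; rewrite Es; reflexivity|apply (proj1 Pv)|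
             apply (PE snd)|intros s Es; cbv beta in *; rewrite Es; reflexivity|apply (proj2 Pv)].
        - pc.
        - apply Rmult_le_pos; lra.
        - apply Rmult_le_pos; lra.
        - eapply on_cells_imp; [|apply De]. intros s Es. cbv beta in *. rewrite Es.
          eapply Rle_trans; [|rewrite Rplus_comm; apply norm2_sub]. apply Req_le. f_equal. vring.
        - apply (rho1_bound k P T1 X E1 E2 K0 C dt N); auto.
        - assert (J * J <= kv * H * (kv * H)).
          { eapply Rle_trans; [apply jj|]. assert (kv * J <= kv * H) by (apply Rmult_le_compat_l; lra).
            assert (0 <= kv * J) by (apply Rmult_le_pos; lra). apply Rmult_le_compat; lra. }
          assert (Cf * (J * J) <= Cf * (kv * H * (kv * H))) by (apply Rmult_le_compat_l; lra). lra.
        - apply Rmult_le_compat_l; [lra|]. unfold H; lra. }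
      assert (0 <= (Cf + 1) * H) by (apply Rmult_le_pos; lra). lra.
Qed.
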